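(* Let $(E,\|\cdot\|)$ be a Banach space, $r\in \mathbb{N}_0 \cup \{\infty\}$, and $s,k \in \mathbb{N} \cup \{\infty\}$ with $k \geq r+s$. Let $J \subseteq \mathbb{R}$ be a non-degenerate interval, $F$ a locally convex space, and $P \subseteq F$, $U \subseteq E$ open subsets. Let $f \colon J \times (U \times P) \rightarrow E$ be a $C^{r,k}$-map with respect to $J\times (U\times P)$. Fix $t_0\in J$. For $(x_0,p_0)\in U\times P$ let $\varphi_{t_0,x_0,p_0}\colon J^{t_0}_{x_0,p_0}\to U$ denote the unique maximal solution of the initial value problem $$x'(t)=f(t,x(t),p_0),\qquad x(t_0)=x_0 .$$ Then $$\Omega_{t_0} := \bigcup_{x_0 \in U ,\, p_0 \in P} J^{t_0}_{x_0,p_0} \times \{(x_0,p_0)\}$$ is an open subset of $J \times (U \times P)$, and the map $$\mathrm{Fl}^f_{t_0}\colon \Omega_{t_0}\to U,\quad (t,(x_0,p_0))\mapsto \varphi_{t_0,x_0,p_0}(t)$$ is a $C^{r+1,s}$-map on $\Omega_{t_0}$.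
   Context: Locally convex spaces are real Hausdorff locally convex topological vector spaces. A subset of a locally convex space is called locally convex if each of its points has a convex neighbourhood in it. Conventions: $\infty+1=\infty$ and $r+s=\infty$ if $r=\infty$ or $s=\infty$. $C^{r,s}$-maps: let $E_1,E_2,H$ be locally convex spaces and $D_hf(z):=\lim_{t\to0}t^{-1}(f(z+th)-f(z))$. For $A\subseteq E_1$, $B\subseteq E_2$ open, $f\colon A\times B\to H$ is $C^{r,s}$ if for all $i,j\in\mathbb{N}_0$ with $i\le r$, $j\le s$ the iterated directional derivative $d^{(i,j)}f(x,y,w_1,\dots,w_i,v_1,\dots,v_j):=(D_{(w_i,0)}\cdots D_{(w_1,0)}D_{(0,v_j)}\cdots D_{(0,v_1)}f)(x,y)$ exists everywhere and $d^{(i,j)}f\colon A\times B\times E_1^i\times E_2^j\to H$ is continuous. If $A,B$ are locally convex subsets with dense interior (e.g. $A$ a non-degenerate interval), $f$ is $C^{r,s}$ if $f|_{A^\circ\times B^\circ}$ is $C^{r,s}$ and each $d^{(i,j)}(f|_{A^\circ\times B^\circ})$ extends to a continuous map $d^{(i,j)}f\colon A\times B\times E_1^i\times E_2^j\to H$ (with $d^{(0,0)}f=f$). A map on an open subset $\Omega\subseteq J\times(U\times P)$ is called $C^{r+1,s}$ if each point of $\Omega$ has a neighbourhood $I\times W\subseteq\Omega$, with $I\subseteq J$ a relatively open convex subset and $W\subseteq U\times P$ open, on which the map is $C^{r+1,s}$. By local existence and uniqueness of solutions, for each $(t_0,x_0,p_0)\in J\times U\times P$ the initial value problem has a unique maximal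 solution $\varphi_{t_0,x_0,p_0}$, defined on an interval $J^{t_0}_{x_0,p_0}\subseteq J$ which is a relatively open neighbourhood of $t_0$ in $J$. *)

(* Defs.v *)
From mathcomp Require Import all_boot all_order all_algebra.
From mathcomp Require Import all_classical all_reals all_analysis.

Set Implicit Arguments.
Unset Strict Implicit.
Unset Printing Implicit Defensive.

Import Order.TTheory GRing.Theory Num.Theory.
Import numFieldNormedType.Exports.

Local Open Scope classical_set_scope.
Local Open Scope ring_scope.

(* Differentiability orders in {0, 1, 2, ...} U {oo}; None stands for oo. *)
Definition diff_order := option nat.

Definition diff_order_le (m n : diff_order) : Prop :=
  match m, n with
  | _, None => True
  | None, Some _ => False
  | Some a, Some b => (a <= b)%N
  end.

Definition diff_order_add (m n : diff_order) : diff_order :=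
  match m, n with
  | Some a, Some b => Some (a + b)%N
  | _, _ => None
  end.

Section DirectionalDerivatives.
Context {R : realType} {E H : tvsType R}.

(* The library's derive and derivable require normed modules. *)
Definition dir_quotient (f : E -> H) (z h : E) (t : R) : H :=
  t^-1 *: (f (z + t *: h) - f z).

Definition dir_derivable (f : E -> H) (z h : E) : Prop :=
  exists l : H, dir_quotient f z h t @[t --> 0^'] --> l.

(* D_h f (z); the value is 0 where the limit does not exist, and the limit is
   unique when H is Hausdorff. *)
Definition dir_derive (h : E) (f : E -> H) (z : E) : H :=
  xget 0 [set l : H | dir_quotient f z h t @[t --> 0^'] --> l].

(* D_(h_n) ... D_(h_1) f for hs = [:: h_1; ...; h_n]. *)
Fixpoint iter_derive (f : E -> H) (hs : seq E) : E -> H :=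
  if hs is h :: hs' then iter_derive (dir_derive h f) hs' else f.

Fixpoint iter_derivable (f : E -> H) (hs : seq E) (z : E) : Prop :=
  if hs is h :: hs' then
    dir_derivable f z h /\ iter_derivable (dir_derive h f) hs' z
  else True.

End DirectionalDerivatives.

Section Crs.
Context {R : realType} {E1 E2 H : tvsType R}.

(* The directions of d^(i,j) in order of application:
   (0, v_1), ..., (0, v_j), (w_1, 0), ..., (w_i, 0). *)
Definition mixed_dirs (i j : nat) (w : 'rV[E1]_i) (v : 'rV[E2]_j) :
    seq (E1 * E2) :=
  [seq (0, v ord0 l) | l <- enum 'I_j] ++ [seq (w ord0 l, 0) | l <- enum 'I_i].

(* d^(i,j) f, with E1^i and E2^j given the product topology of row vectors. *)
Definition dij (i j : nat) (f : E1 * E2 -> H)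
    (q : (E1 * E2) * ('rV[E1]_i * 'rV[E2]_j)) : H :=
  iter_derive f (mixed_dirs q.2.1 q.2.2) q.1.

Definition Crs_open (r s : diff_order) (A : set E1) (B : set E2)
    (f : E1 * E2 -> H) : Prop :=
  forall i j : nat, diff_order_le (Some i) r -> diff_order_le (Some j) s ->
    (forall (z : E1 * E2) (w : 'rV[E1]_i) (v : 'rV[E2]_j),
       (A `*` B) z -> iter_derivable f (mixed_dirs w v) z) /\
    {within (A `*` B) `*` setT, continuous (@dij i j f)}.

(* The C^(r,s) property on A x B, for locally convex sets A and B with dense
   interior; the extension g of d^(0,0) f has to be f itself. *)
Definition Crs (r s : diff_order) (A : set E1) (B : set E2)
    (f : E1 * E2 -> H) : Prop :=
  Crs_open r s A° B° f /\
  forall i j : nat, diff_order_le (Some i) r -> diff_order_le (Some j) s ->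
    exists g : (E1 * E2) * ('rV[E1]_i * 'rV[E2]_j) -> H,
      [/\ {within (A `*` B) `*` setT, continuous g},
          {in (A° `*` B°) `*` setT, g =1 @dij i j f} &
          i = 0%N -> j = 0%N -> {in (A `*` B) `*` setT, forall q, g q = f q.1}].

(* [O] is an open subset of the subspace [X]. *)
Definition relatively_open {T : topologicalType} (X O : set T) : Prop :=
  exists2 G : set T, open G & O = X `&` G.

(* The C^(r,s) property on a relatively open subset Omega of A x B, where B is
   open. *)
Definition Crs_on (r s : diff_order) (A : set E1) (B : set E2)
    (Omega : set (E1 * E2)) (f : E1 * E2 -> H) : Prop :=
  forall z, Omega z -> exists (I : set E1) (W : set E2),
    [/\ relatively_open A I /\ convex_set I, open W /\ W `<=` B,
        (I `*` W) z, I `*` W `<=` Omega & Crs r s I W f].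

End Crs.

Section InitialValueProblem.
Context {R : realType} {E : completeNormedModType R} {F : tvsType R}.

Definition nondegenerate_interval (I : set R) : Prop :=
  is_interval I /\ exists a b, [/\ I a, I b & a < b].

(* x : I -> U solves x'(t) = f(t, x(t), p0), x(t0) = x0; the derivative is
   taken within I, hence one-sided at the endpoints that belong to I. *)
Definition ivp_solution (J : set R) (U : set E) (f : R * (E * F) -> E)
    (t0 : R) (x0 : E) (p0 : F) (I : set R) (x : R -> E) : Prop :=
  [/\ nondegenerate_interval I, I `<=` J, I t0 /\ x t0 = x0 &
      forall t, I t -> U (x t) /\
        (u - t)^-1 *: (x u - x t) @[u --> within I t^'] --> f (t, (x t, p0))].

Definition maximal_ivp_solution (J : set R) (U : set E)
    (f : R * (E * F) -> E) (t0 : R) (x0 : E) (p0 : F)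
    (I : set R) (x : R -> E) : Prop :=
  ivp_solution J U f t0 x0 p0 I x /\
  forall (I' : set R) (x' : R -> E), ivp_solution J U f t0 x0 p0 I' x' ->
    I `<=` I' -> {in I, x' =1 x} -> I' = I.

Definition flow_domain (U : set E) (P : set F) (dom : E * F -> set R) :
    set (R * (E * F)) :=
  \bigcup_(q in U `*` P) (dom q `*` [set q]).

Definition flow (phi : E * F -> R -> E) (z : R * (E * F)) : E := phi z.2 z.1.

End InitialValueProblem.

(* Main.v *)
From HB Require Import structures.
Require Import Defs.
From mathcomp Require Import all_boot all_order all_algebra.
From mathcomp Require Import all_classical all_reals all_analysis.
From mathcomp Require Import ring lra.
Set Implicit Arguments.
Unset Strict Implicit.
Unset Printing Implicit Defensive.
Import Order.TTheory GRing.Theory Num.Theory.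
Import numFieldNormedType.Exports.
Local Open Scope classical_set_scope.
Local Open Scope ring_scope.

(** The idea of the proof. Once a compact interval [[a, b]] is fixed on which a
   solution exists, everything is a statement about the solutions on [[a, b]] with
   nearby data.

   Openness and continuity. A C^(r,k)-map with [k >= 1] is locally Lipschitz in the
   state. Gronwall's inequality ([solution_close]) keeps curves that satisfy the
   equation near a given solution, and solutions of a truncated, globally
   Lipschitz equation ([lipschitz_ode_exists], [truncated_solution]) therefore solve
   the original one for all nearby data ([solutions_exist_near]). Two solutions that
   meet agree ([solution_unique]) and glue, so a maximal solution contains every
   solution that meets it ([maximal_solution_absorbs]). Hence near a point of the
   flow domain the maximal solutions are defined on a common compact interval that
   contains a neighbourhood of the given time ([flow_box]).

   Smoothness. The derivative of the flow in a direction [v] of the data solves the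
   linear variational equation along the flow ([flow_has_dirderiv]). The flow and its
   derivative together are the flow of the tangent equation, whose right-hand side
   is the tangent map of the given one: an equation of the same kind, on the
   doubled spaces, with one order of space differentiability less. Induction on the
   order [s] yields all space derivatives ([flow_smooth_of_continuous]). Time
   derivatives come from the equation itself by the chain rule; a time derivative
   of order [i + 1] takes derivatives of [f] of total order [i], and this is where
   [k >= r + s] is needed. The initial state is treated as one more parameter, so
   that the data are a point of [E * F] and the initial value is a linear function of
   it.

   The parameter space has no norm. Derivatives are therefore directional, and
   uniform estimates come from two sources: a continuous directional derivative is
   a strict one ([strict_dirderiv]), and properties that hold locally in time hold on
   the whole of a compact interval for nearby data ([tube]).

   Two notions of regularity. The C^(r,s) property is given by derivatives in
   frozen directions, while the induction needs tangent maps, which differentiate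
   base point and direction together. The passage from the former to the latter
   ([dir_smooth_tangent_smooth], [Crs_mixed_smooth]) uses that a continuous
   directional derivative is linear in the direction and that time and space
   derivatives commute ([schwarz]); at the end points of [J] all relations hold by
   continuity. The converse is [flow_smooth_Crs].

   Existence for Lipschitz equations needs no integral of vector-valued curves,
   only primitives of continuous ones. They are limits of primitives of finite
   combinations of fixed vectors with real coefficient functions
   ([exists_primitive]). *)

(** * Linear identities in modules *)

Section LinearExpressions.
Context {K : pzRingType} {M : lmodType K}.

(** Reification of linear combinations: an identity in a module follows from the
   identities of the coefficients, which [ring] decides. *)
Inductive lin_expr :=
  | LinVar of nat
  | LinZero
  | LinAdd of lin_expr & lin_expr
  | LinOpp of lin_expr
  | LinScale of K & lin_expr.

Fixpoint lin_eval (env : seq M) (e : lin_expr) : M :=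
  match e with
  | LinVar n => nth 0 env n
  | LinZero => 0
  | LinAdd a b => lin_eval env a + lin_eval env b
  | LinOpp a => - lin_eval env a
  | LinScale k a => k *: lin_eval env a
  end.

Fixpoint lin_coef (e : lin_expr) (n : nat) : K :=
  match e with
  | LinVar m => if m == n then 1 else 0
  | LinZero => 0
  | LinAdd a b => lin_coef a n + lin_coef b n
  | LinOpp a => - lin_coef a n
  | LinScale k a => k * lin_coef a n
  end.

Lemma lin_evalE env e :
  lin_eval env e = \sum_(i < size env) lin_coef e i *: nth 0 env i.
Proof.
elim: e => [n| |a IHa b IHb|a IHa|k a IHa] /=; rewrite ?IHa ?IHb.
- have [lt_n|le_n] := ltnP n (size env).
    rewrite (bigD1 (Ordinal lt_n)) //= eqxx scale1r big1 ?addr0// => i.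
    by rewrite eq_sym -val_eqE /= => /negPf ->; rewrite scale0r.
  rewrite nth_default// big1// => i _.
  by rewrite gtn_eqF ?scale0r// (leq_trans (ltn_ord i)).
- by rewrite big1// => i _; rewrite scale0r.
- by rewrite -big_split; apply: eq_bigr => i _; rewrite scalerDl.
- by rewrite -sumrN; apply: eq_bigr => i _; rewrite scaleNr.
- by rewrite scaler_sumr; apply: eq_bigr => i _; rewrite scalerA.
Qed.

Fixpoint lin_coefs_eq (a b : lin_expr) (n : nat) : Prop :=
  if n is m.+1 then lin_coef a m = lin_coef b m /\ lin_coefs_eq a b m else True.

Lemma lin_eval_eq env a b :
  lin_coefs_eq a b (size env) -> lin_eval env a = lin_eval env b.
Proof.
move=> ab; rewrite !lin_evalE; apply: eq_bigr => -[i lt_i] _ /=; congr (_ *: _).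
elim: (size env) ab lt_i => //= n IHn [abn /IHn abi].
by rewrite ltnS leq_eqVlt => /orP[/eqP ->|].
Qed.

End LinearExpressions.

Ltac lin_index x env :=
  match env with
  | x :: _ => constr:(0%N)
  | _ :: ?env' => let n := lin_index x env' in constr:(S n)
  end.
Ltac lin_atoms K M env t :=
  match t with
  | GRing.add ?a ?b =>
      let env1 := lin_atoms K M env a in lin_atoms K M env1 b
  | GRing.opp ?a => lin_atoms K M env a
  | GRing.zero => env
  | GRing.scale _ ?a => lin_atoms K M env a
  | _ => match env with
         | _ => let _ := lin_index t env in env
         | _ => constr:(t :: env)
         end
  end.
Ltac lin_reify K M env t :=
  match t with
  | GRing.add ?a ?b =>
      let a' := lin_reify K M env a in
      let b' := lin_reify K M env b in constr:(@LinAdd K a' b')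
  | GRing.opp ?a => let a' := lin_reify K M env a in constr:(@LinOpp K a')
  | GRing.zero => constr:(@LinZero K)
  | GRing.scale ?k ?a =>
      let a' := lin_reify K M env a in constr:(@LinScale K k a')
  | _ => let n := lin_index t env in constr:(@LinVar K n)
  end.
(** Proves an identity between linear combinations in a module by comparing the
   coefficients of each vector; these remain as goals when [ring] fails. *)
Ltac linear_identity K M :=
  match goal with
  | |- @eq ?T ?a ?b =>
    let env0 := lin_atoms K M (@nil M) a in
    let env := lin_atoms K M env0 b in
    let a' := lin_reify K M env a in
    let b' := lin_reify K M env b in
    change (lin_eval (env : seq M) a' = lin_eval (env : seq M) b');
    apply: lin_eval_eq; cbn [size lin_coefs_eq lin_coef];
    repeat split; try (rewrite /=; ring)
  end.

(** * Derivatives of curves *)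

Section RealLine.
Context {R : realType}.

Lemma near_realP (t : R) (P : R -> Prop) :
  (\forall x \near t, P x) <-> exists2 d, 0 < d & forall x, `|x - t| < d -> P x.
Proof.
split=> [/nbhs_ballP[d /= d0 dP]|[d d0 dP]].
  by exists d => // x xt; apply: dP; rewrite -ball_normE /= distrC.
apply/nbhs_ballP; exists d => //= x; rewrite -ball_normE /= distrC; exact: dP.
Qed.

(** The supremum of the [t] such that [P] holds on [[a, t]] belongs to these [t] by the
   last hypothesis, and it cannot be smaller than [b] by the one before. *)
Lemma real_induction (a b : R) (P : R -> Prop) : a <= b -> P a ->
  (forall c, a <= c < b -> (forall s, a <= s <= c -> P s) ->
     exists2 d, 0 < d & forall s, c < s < c + d -> s <= b -> P s) ->
  (forall c, a < c <= b -> (forall s, a <= s < c -> P s) -> P c) ->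
  forall s, a <= s <= b -> P s.
Proof.
move=> ab Pa Pr Pl.
pose S := [set t | a <= t <= b /\ forall s, a <= s <= t -> P s].
have Sa : S a by split; [rewrite lexx|move=> s /andP[? ?]; have -> : s = a by lra].
have hS : has_sup S by split; [exists a|exists b => t [/andP[]]].
set c := sup S.
have ac : a <= c by exact: sup_upper_bound.
have cb : c <= b by apply: ge_sup; [exists a|move=> t [/andP[]]].
have Pc s : a <= s < c -> P s.
  move=> /andP[as_ sc].
  have [|t [/andP[? ?] tP] st] := @sup_adherent _ S (c - s) _ hS; first by lra.
  by apply: tP; rewrite -/c in st; lra.
have Sc : S c.
  split=> [|s /andP[as_ sc]]; first by rewrite ac.
  have [sc'|cs] := ltP s c; first by apply: Pc; rewrite as_.
  have -> : s = c by lra.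
  have [ca|ca] := eqVneq c a; first by rewrite ca.
  by apply: Pl; rewrite ?Pc // cb andbT lt_neqAle eq_sym ca ac.
suff -> : b = c by exact: Sc.2.
apply/eqP; rewrite eq_le cb andbT leNgt; apply/negP => cb'.
have [|d d0 dP] := Pr c _ Sc.2; first by rewrite ac.
pose t := Num.min b (c + d / 2).
have ct : c < t by rewrite lt_min cb' /=; lra.
have tb : t <= b by rewrite ge_min lexx.
have tc : t <= c + d / 2 by rewrite ge_min lexx orbT.
suff : S t by move=> /(sup_upper_bound hS); rewrite -/c; lra.
split=> [|s /andP[as_ st]]; first by apply/andP; split; lra.
have [sc|cs] := leP s c; first by apply: Sc.2; rewrite as_.
by apply: dP; [apply/andP; split; lra|lra].
Qed.

End RealLine.

(** Continuity of the restriction, stated for an unrestricted function so that it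
   composes without subspace topologies. *)
Definition continuous_on {T U : topologicalType} (A : set T) (f : T -> U) :=
  forall x, A x -> f y @[y --> within A (nbhs x)] --> f x.

Lemma cvg_to_pair {T : Type} {F : set_system T} {FF : Filter F}
    {U V : topologicalType} (f : T -> U) (g : T -> V) (a : U) (b : V) :
  f x @[x --> F] --> a -> g x @[x --> F] --> b ->
  (f x, g x) @[x --> F] --> (a, b).
Proof. by move=> fa gb; exact: cvg_pair. Qed.

(** The derivative of a curve, as a first order approximation: unlike the
   difference quotient, this form has no division and needs no case h = 0. *)
Definition has_deriv {R : realType} {H : normedModType R}
    (phi : R -> H) (t : R) (l : H) :=
  forall e : R, 0 < e ->
    \forall h \near (0 : R), `|phi (t + h) - phi t - h *: l| <= e * `|h|.

Section Curves.
Context {R : realType} {H : normedModType R}.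
Implicit Types (phi psi : R -> H) (t : R).

Lemma has_derivP phi t l : has_deriv phi t l <->
  forall e, 0 < e -> exists2 d, 0 < d & forall s, `|s - t| < d ->
    `|phi s - phi t - (s - t) *: l| <= e * `|s - t|.
Proof.
split=> H0 e e0.
  have /near_realP[d d0 dP] := H0 e e0; exists d => // s st.
  by have := dP (s - t); rewrite subr0 [t + _]addrC subrK => /(_ st).
have [d d0 dP] := H0 e e0; apply/near_realP; exists d => // h.
by rewrite subr0 => hd; have := dP (t + h); rewrite addrAC subrr add0r; apply.
Qed.

Lemma has_derivD phi psi t l m :
  has_deriv phi t l -> has_deriv psi t m ->
  has_deriv (fun s => phi s + psi s) t (l + m).
Proof.
move=> Hl Hm e e0; near=> h.
have -> : phi (t + h) + psi (t + h) - (phi t + psi t) - h *: (l + m) =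
  (phi (t + h) - phi t - h *: l) + (psi (t + h) - psi t - h *: m).
  by linear_identity R H.
rewrite (le_trans (ler_normD _ _))// [e]splitr mulrDl lerD//; near: h.
  by apply: Hl; rewrite divr_gt0.
by apply: Hm; rewrite divr_gt0.
Unshelve. all: by end_near. Qed.

Lemma has_derivZ phi t l (k : R) :
  has_deriv phi t l -> has_deriv (fun s => k *: phi s) t (k *: l).
Proof.
move=> Hl e e0; have k0 : 0 < `|k| + 1 by rewrite ltr_wpDl.
near=> h.
have -> : k *: phi (t + h) - k *: phi t - h *: (k *: l) =
  k *: (phi (t + h) - phi t - h *: l) by linear_identity R H.
rewrite normrZ; have : `|phi (t + h) - phi t - h *: l| <= e / (`|k| + 1) * `|h|.
  by near: h; apply: Hl; rewrite divr_gt0.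
move=> /(ler_wpM2l (normr_ge0 k))/le_trans; apply.
rewrite [leLHS]mulrA ler_wpM2r// [leLHS]mulrA ler_pdivrMr// [leLHS]mulrC.
by rewrite ler_wpM2l ?lerDl// ltW.
Unshelve. all: by end_near. Qed.

Lemma has_derivN phi t l : has_deriv phi t l -> has_deriv (fun s => - phi s) t (- l).
Proof.
move=> /(@has_derivZ _ _ _ (-1)); rewrite scaleN1r.
by congr has_deriv; apply/funext => s; rewrite scaleN1r.
Qed.

Lemma has_derivB phi psi t l m :
  has_deriv phi t l -> has_deriv psi t m ->
  has_deriv (fun s => phi s - psi s) t (l - m).
Proof. by move=> Hl /has_derivN; exact: has_derivD. Qed.

Lemma has_deriv_cst (a : H) t : has_deriv (fun=> a) t 0.
Proof.
by move=> e e0; near=> h; rewrite subrr scaler0 subr0 normr0 mulr_ge0// ltW.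
Unshelve. all: by end_near. Qed.

Lemma has_deriv_line (a : H) t : has_deriv (fun s => s *: a) t a.
Proof.
move=> e e0; near=> h.
have -> : (t + h) *: a - t *: a - h *: a = 0 by linear_identity R H.
by rewrite normr0 mulr_ge0// ltW.
Unshelve. all: by end_near. Qed.

Lemma has_deriv_near phi psi t l : (\forall s \near t, phi s = psi s) ->
  has_deriv phi t l -> has_deriv psi t l.
Proof.
move=> E Hl e e0; near=> h.
have <- : phi t = psi t by exact: nbhs_singleton E.
have <- : phi (t + h) = psi (t + h); last by near: h; exact: Hl.
near: h; have /near_realP[d d0 dP] := E; apply/near_realP; exists d => // h.
by rewrite subr0 => hd; apply: dP; rewrite addrAC subrr add0r.
Unshelve. all: by end_near. Qed.

Lemma has_deriv_shift phi t s l :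
  has_deriv phi (s + t) l -> has_deriv (fun u => phi (s + u)) t l.
Proof. by move=> Hl e e0; near do rewrite addrA; exact: Hl. Unshelve. all: by end_near. Qed.

Lemma has_deriv_flip phi t s l :
  has_deriv phi (s - t) l -> has_deriv (fun u => phi (s - u)) t (- l).
Proof.
move=> Hl; apply/has_derivP => e e0; have /has_derivP/(_ _ e0)[d d0 dP] := Hl.
exists d => // u; have -> : u - t = - ((s - u) - (s - t)) by ring.
by rewrite !normrN => /dP; rewrite scaleNr scalerN opprK.
Qed.

Lemma has_deriv_continuous phi t l : has_deriv phi t l -> {for t, continuous phi}.
Proof.
move=> /has_derivP Hl; apply/cvgrPdist_le => e e0.
have [d d0 dP] := Hl 1 ltr01.
have L0 : 0 < 1 + `|l| by rewrite ltr_wpDr.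
near=> s.
have sd : `|s - t| < d by near: s; apply/near_realP; exists d.
have se : `|s - t| <= e / (1 + `|l|).
  near: s; apply/near_realP; exists (e / (1 + `|l|)); first exact: divr_gt0.
  by move=> s /ltW.
have -> : phi t - phi s = - ((phi s - phi t - (s - t) *: l) + (s - t) *: l).
  by linear_identity R H.
rewrite normrN (le_trans (ler_normD _ _))// normrZ.
rewrite (le_trans (lerD (dP _ sd) (lexx _)))// mul1r -{1}[`|s - t|]mulr1 -mulrDr.
by rewrite -ler_pdivlMr.
Unshelve. all: by end_near. Qed.

End Curves.

(** * The mean value inequality *)

Lemma continuous_on_curve {R : realType} {H : normedModType R} (A : set R)
    (phi : R -> H) : continuous_on A phi <->
  forall t, A t -> forall e, 0 < e -> exists2 d, 0 < d &
    forall s, `|s - t| < d -> A s -> `|phi t - phi s| <= e.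
Proof.
split=> cA t At; first by move=> e e0;
  have /cvgrPdist_le/(_ _ e0) := cA t At; move/near_realP.
by apply/cvgrPdist_le => e /(cA t At)/near_realP.
Qed.

Section MeanValue.
Context {R : realType} {H : normedModType R}.

(** Both sides of the mean value inequality are compared on first order
   approximations; the sign makes the statement valid on both sides of [c]. *)
Let mean_value_local (D : R -> H) (m : R -> R) (c : R) (l : H) (k e : R) :
  has_deriv D c l -> has_deriv m c k -> `|l| <= k -> 0 < e ->
  exists2 d, 0 < d & forall s, `|s - c| < d ->
    `|D s - D c| <= (m s - m c) * Num.sg (s - c) + e * `|s - c|.
Proof.
move=> /has_derivP Dl /has_derivP mk lk e0.
have e20 : 0 < e / 2 by rewrite divr_gt0.
have [d d0 dP] := Dl _ e20; have [d' d'0 dP'] := mk _ e20.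
exists (Num.min d d'); first by rewrite lt_min d0.
move=> s; rewrite lt_min => /andP[/dP A /dP' B].
have -> : D s - D c = (D s - D c - (s - c) *: l) + (s - c) *: l.
  by linear_identity R H.
apply: le_trans (ler_normD _ _) _; rewrite normrZ.
have := ler_wpM2l (normr_ge0 (s - c)) lk.
have {B} : `|m s - m c - (s - c) * k| <= e / 2 * `|s - c| := B.
have [sc|sc|->] := ltgtP s c; last first.
- by move=> _ _; rewrite !subrr scale0r subr0 !normr0 !(mul0r, mulr0) !addr0.
- have sc0 : 0 < s - c by lra.
  move: A; rewrite gtr0_sg// gtr0_norm// mulr1 ler_norml => A /andP[B _] C.
  lra.
have sc0 : s - c < 0 by lra.
move: A; rewrite ltr0_sg// ltr0_norm// mulrN1 ler_norml => A /andP[_ B] C.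
lra.
Qed.

(** The bound propagates along the interval by real induction, with an error term
   [e * (s - a')] that absorbs the approximation of [D] and [m] at each point. The
   end points are reached by continuity. *)
Lemma mean_value_le (D : R -> H) (m : R -> R) (dD : R -> H) (dm : R -> R) a b :
  a <= b ->
  continuous_on `[a, b] D -> continuous_on `[a, b] m ->
  (forall t, a < t < b ->
     [/\ has_deriv D t (dD t), has_deriv m t (dm t) & `|dD t| <= dm t]) ->
  `|D b - D a| <= m b - m a.
Proof.
move=> ab cD cm hd.
have inner e a' b' : 0 < e -> a < a' -> a' <= b' -> b' < b ->
    `|D b' - D a'| <= m b' - m a' + e * (b' - a').
  move=> e0 aa' ab' bb'.
  pose P s := `|D s - D a'| <= m s - m a' + e * (s - a').
  have trans u v : P u -> `|D v - D u| <= m v - m u + e * (v - u) -> P v.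
    rewrite /P => Pu Puv.
    have -> : D v - D a' = (D v - D u) + (D u - D a') by linear_identity R H.
    by apply: le_trans (ler_normD _ _) _; lra.
  apply: (@real_induction R a' b' P); rewrite ?ab' ?lexx//.
  - by rewrite /P !subrr normr0 mulr0 addr0.
  - move=> c /andP[ac cb] Pc.
    have [|Dc mc dc] := hd c; first by apply/andP; split; lra.
    have [d d0 dP] := mean_value_local Dc mc dc e0.
    exists d => // s /andP[cs sd] sb; apply: (trans c).
      by apply: Pc; rewrite ac lexx.
    have sc0 : 0 < s - c by lra.
    have := dP s; rewrite gtr0_norm// gtr0_sg// mulr1; apply; lra.
  - move=> c /andP[ac cb] Pc.
    have [|Dc mc dc] := hd c; first by apply/andP; split; lra.
    have [d d0 dP] := mean_value_local Dc mc dc e0.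
    pose s := Num.max a' (c - d / 2).
    have as_ : a' <= s by rewrite le_max lexx.
    have ds : c - d / 2 <= s by rewrite le_max lexx orbT.
    have sc : s < c by rewrite gt_max ac /=; lra.
    apply: (trans s); first by apply: Pc; rewrite as_.
    have sc0 : s - c < 0 by lra.
    have := dP s; rewrite ltr0_norm// ltr0_sg// mulrN1 distrC !opprB; apply; lra.
have [->|nab] := eqVneq a b; first by rewrite !subrr normr0.
have {}ab : a < b by rewrite lt_neqAle nab.
apply/ler_addgt0Pr => e e0.
have e60 : 0 < e / 6 by rewrite divr_gt0.
have [d1 d10 A] : exists2 d, 0 < d & forall s, `|s - a| < d -> a <= s <= b ->
    `|D a - D s| <= e / 6 /\ `|m a - m s| <= e / 6.
  have aI : `[a, b]%classic a by rewrite /= in_itv /= lexx ltW.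
  have [d d0 dP] := iffLR (continuous_on_curve _ _) cD a aI _ e60.
  have [d' d'0 dP'] := iffLR (continuous_on_curve _ _) cm a aI _ e60.
  exists (Num.min d d'); first by rewrite lt_min d0.
  move=> s; rewrite lt_min => /andP[sd sd'] sI.
  by split; [exact: dP|exact: dP'].
have [d2 d20 B] : exists2 d, 0 < d & forall s, `|s - b| < d -> a <= s <= b ->
    `|D b - D s| <= e / 6 /\ `|m b - m s| <= e / 6.
  have bI : `[a, b]%classic b by rewrite /= in_itv /= lexx ltW.
  have [d d0 dP] := iffLR (continuous_on_curve _ _) cD b bI _ e60.
  have [d' d'0 dP'] := iffLR (continuous_on_curve _ _) cm b bI _ e60.
  exists (Num.min d d'); first by rewrite lt_min d0.
  move=> s; rewrite lt_min => /andP[sd sd'] sI.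
  by split; [exact: dP|exact: dP'].
pose d := Num.min (Num.min d1 d2) (b - a).
have dd1 : d <= d1 by rewrite !ge_min lexx.
have dd2 : d <= d2 by rewrite !ge_min lexx orbT.
have dab : d <= b - a by rewrite !ge_min lexx !orbT.
have d0 : 0 < d by rewrite !lt_min d10 d20 subr_gt0.
pose a' := a + d / 3; pose b' := b - d / 3.
have [] := A a'.
- by rewrite /a' addrAC subrr add0r gtr0_norm; lra.
- by rewrite /a'; apply/andP; split; lra.
move=> Da ma; have [] := B b'.
- by rewrite /b' addrAC subrr add0r normrN gtr0_norm; lra.
- by rewrite /b'; apply/andP; split; lra.
move=> Db mb.
have e' : 0 < e / 3 / (b - a) by rewrite !divr_gt0// subr_gt0.
have := inner _ a' b' e' => /(_ _ _ _)I.
have {}I : `|D b' - D a'| <= m b' - m a' + e / 3.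
  have ee : e / 3 / (b - a) * (b' - a') <= e / 3.
    rewrite mulrAC ler_pdivrMr ?subr_gt0// ler_wpM2l//; first by lra.
    by rewrite /a' /b'; lra.
  by apply: le_trans (I _ _ _) _; rewrite /a' /b' in ee *; lra.
have -> : D b - D a = (D b - D b') - (D a - D a') + (D b' - D a').
  by linear_identity R H.
apply: le_trans (ler_normD _ _) _; have X := ler_normB (D b - D b') (D a - D a').
move: ma mb; rewrite !ler_norml => /andP[? ?] /andP[? ?]; lra.
Qed.

End MeanValue.

Section MeanValueConsequences.
Context {R : realType}.

Lemma has_deriv_continuous_on {H : normedModType R} (A : set R)
    (phi dphi : R -> H) :
  (forall t, A t -> has_deriv phi t (dphi t)) -> continuous_on A phi.
Proof.
move=> Hd t At; apply: cvg_within_filter.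
exact: has_deriv_continuous (Hd t At).
Qed.

Context {H : normedModType R}.

Lemma is_derive_has_deriv (phi : R -> H) (t : R) (l : H) :
  is_derive t 1 phi l -> has_deriv phi t l.
Proof.
move=> [dphi <-] e e0.
have /cvgrPdist_le/(_ _ e0) : h^-1 *: ((phi \o shift t) (h *: 1) - phi t)
  @[h --> 0^'] --> 'D_1 phi t by exact: dphi.
rewrite near_withinE => Q; near=> h.
have [->|h0] := eqVneq h 0.
  by rewrite addr0 subrr scale0r subrr !normr0 mulr0.
have : `|'D_1 phi t - h^-1 *: ((phi \o shift t) (h *: 1) - phi t)| <= e.
  by move: h0; near: h.
rewrite /= /GRing.scale /= mulr1 [h + t]addrC => hl.
have hu : h \is a GRing.unit by rewrite unitfE.
have -> : phi (t + h) - phi t - h *: 'D_1 phi t =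
   - (h *: ('D_1 phi t - h^-1 *: (phi (t + h) - phi t))).
  by rewrite scalerBr scalerA divff// scale1r opprB.
by rewrite normrN normrZ mulrC ler_wpM2r.
Unshelve. all: by end_near. Qed.

(** The mean value inequality for [D u - u *: l], in either time direction. *)
Lemma mean_value_segment (D dD : R -> H) (l : H) (K s t : R) :
  (forall u : R, (s <= u <= t) || (t <= u <= s) ->
     has_deriv D u (dD u) /\ `|dD u - l| <= K) ->
  `|D t - D s - (t - s) *: l| <= K * `|t - s|.
Proof.
move=> hD; pose F u := D u - u *: l.
have dF u : (s <= u <= t) || (t <= u <= s) -> has_deriv F u (dD u - l).
  by move=> /hD[? _]; apply: has_derivB => //; exact: has_deriv_line.
have dK u : has_deriv (fun v : R => K * v) u K.
  have := @has_deriv_line R R K u; congr has_deriv; apply/funext => v.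
  by rewrite /GRing.scale /= mulrC.
have -> : D t - D s - (t - s) *: l = F t - F s.
  by rewrite /F; linear_identity R H.
have [st|ts] := leP s t.
- rewrite (@ger0_norm _ (t - s)) ?subr_ge0// mulrBr.
  apply: (@mean_value_le _ _ F (fun v => K * v) (fun u => dD u - l) (fun=> K)) => //.
  + apply: (@has_deriv_continuous_on _ _ _ (fun u => dD u - l)) => u /=.
    by rewrite in_itv /= => u_st; apply: dF; rewrite u_st.
  + by apply: (@has_deriv_continuous_on _ _ _ (fun=> K)) => u _; exact: dK.
  + move=> u /andP[su ut]; have uI : (s <= u <= t) || (t <= u <= s).
      by rewrite (ltW su) ltW.
    by split=> //; [exact: dF|exact: (hD u uI).2].
- rewrite distrC (@ltr0_norm _ (t - s)) ?subr_lt0// [- (t - s)]opprB mulrBr.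
  apply: (@mean_value_le _ _ F (fun v => K * v) (fun u => dD u - l) (fun=> K)).
  + exact: ltW.
  + apply: (@has_deriv_continuous_on _ _ _ (fun u => dD u - l)) => u /=.
    by rewrite in_itv /= => u_ts; apply: dF; rewrite u_ts orbT.
  + by apply: (@has_deriv_continuous_on _ _ _ (fun=> K)) => u _; exact: dK.
  + move=> u /andP[tu us]; have uI : (s <= u <= t) || (t <= u <= s).
      by rewrite (ltW tu) (ltW us) orbT.
    by split=> //; [exact: dF|exact: (hD u uI).2].
Qed.

Lemma mean_value_line (D dD : R -> H) (l : H) (K s t : R) :
  (forall u : R, `|u - s| <= `|t - s| -> has_deriv D u (dD u) /\ `|dD u - l| <= K) ->
  `|D t - D s - (t - s) *: l| <= K * `|t - s|.
Proof.
move=> hD; apply: (@mean_value_segment _ dD) => u uI; apply: hD.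
by have [/andP[? ?]|/andP[? ?]] := orP uI; [rewrite !ger0_norm|rewrite !ler0_norm]; lra.
Qed.

(** A first order approximation with relative error [K] determines the
   derivative up to [K]. *)
Lemma has_deriv_dist (phi : R -> H) (t : R) (l m : H) (K : R) :
  has_deriv phi t l ->
  (\forall s \near t, `|phi s - phi t - (s - t) *: m| <= K * `|s - t|) ->
  `|l - m| <= K.
Proof.
move=> Hl /near_realP[d' d'0 dP']; apply/ler_addgt0Pr => e e0.
have [d d0 dP] := iffLR (has_derivP _ _ _) Hl _ e0.
have m0 : 0 < Num.min d d' by rewrite lt_min d0.
have md : Num.min d d' <= d by rewrite ge_min lexx.
have md' : Num.min d d' <= d' by rewrite ge_min lexx orbT.
pose h := Num.min d d' / 2.
have h0 : 0 < h by rewrite divr_gt0.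
have := dP (t + h); have := dP' (t + h).
have -> : t + h - t = h by ring.
rewrite gtr0_norm// => /(_ _)A /(_ _)B.
rewrite -(ler_pM2l h0) -{1}(gtr0_norm h0) -normrZ.
have -> : h *: (l - m) = (phi (t + h) - phi t - h *: m) -
   (phi (t + h) - phi t - h *: l) by linear_identity R H.
apply: le_trans (ler_normB _ _) _.
have := A _; have := B _; rewrite /h in h0 *; lra.
Qed.

Lemma has_deriv_unique (phi : R -> H) (t : R) (l m : H) :
  has_deriv phi t l -> has_deriv phi t m -> l = m.
Proof.
move=> dl /has_derivP dm; apply/eqP; rewrite -subr_eq0 -normr_le0.
apply/ler_addgt0Pr => e /dm[d d0 dP]; rewrite add0r.
by apply: (has_deriv_dist dl); apply/near_realP; exists d.
Qed.

(** The mean value inequality bounds the first order remainders of all the [yn n]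
   by the oscillation of their derivatives near [t], which is uniformly small in
   [n]; the bound passes to the pointwise limit. *)
Lemma has_deriv_uniform_limit (O : set R) (y c : R -> H) (yn cn : nat -> R -> H) :
  open O ->
  (forall n t, O t -> has_deriv (yn n) t (cn n t)) ->
  (forall n t, O t -> {for t, continuous (cn n)}) ->
  (forall e, 0 < e -> \forall n \near \oo, forall t, O t -> `|cn n t - c t| <= e) ->
  (forall t, O t -> yn n t @[n --> \oo] --> y t) ->
  forall t, O t -> has_deriv y t (c t).
Proof.
move=> oO dy ccn cu yl t Ot; apply/has_derivP => e e0.
have e40 : 0 < e / 4 by rewrite divr_gt0.
have [N _ /(_ N (leqnn N)) NP] := cu _ e40.
have /cvgrPdist_le/(_ _ e40)/near_realP[d1 d10 d1P] := ccn N t Ot.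
have /near_realP[d2 d20 d2P] : \forall s \near t, O s by exact: open_nbhs_nbhs.
exists (Num.min d1 d2); first by rewrite lt_min d10.
move=> s sd.
have near_t u : `|u - t| <= `|s - t| -> O u /\ `|c u - c t| <= 3 * (e / 4).
  move=> /le_lt_trans/(_ sd); rewrite lt_min => /andP[/d1P ut1 /d2P Ou].
  split=> //; have -> : c u - c t = (cn N t - c t) - (cn N t - cn N u) - (cn N u - c u).
    by linear_identity R H.
  apply: le_trans (ler_normB _ _) _.
  have := NP _ Ou; have := NP _ Ot.
  by have := ler_normB (cn N t - c t) (cn N t - cn N u); lra.
have bound : \forall n \near \oo,
    `|yn n s - yn n t - (s - t) *: c t| <= e * `|s - t|.
  near=> n.
  have cnc u : O u -> `|cn n u - c u| <= e / 4 by move: u; near: n; exact: cu.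
  apply: (@mean_value_line _ (cn n)) => u /near_t[Ou cut]; split; first exact: dy.
  have -> : cn n u - c t = (cn n u - c u) + (c u - c t) by linear_identity R H.
  by apply: le_trans (ler_normD _ _) _; have := cnc u Ou; lra.
have [Os _] := near_t s (lexx _).
have lim : `|yn n s - yn n t - (s - t) *: c t| @[n --> \oo] -->
    `|y s - y t - (s - t) *: c t|.
  by apply: cvg_norm; apply: cvgB; [apply: cvgB|exact: cvg_cst]; exact: yl.
exact: ler_cvg_to lim (cvg_cst _) bound.
Unshelve. all: by end_near. Qed.

End MeanValueConsequences.

(** * Mixed partial derivatives and Gronwall's inequality *)

Section SchwarzGronwall.
Context {R : realType} {H : normedModType R}.

Lemma near_real_pairP (x y : R) (P : R * R -> Prop) :
  (\forall p \near (x, y), P p) <->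
  exists2 d, 0 < d & forall s h, `|s - x| < d -> `|h - y| < d -> P (s, h).
Proof.
split=> [[[A B]] /= [/near_realP[d d0 dA] /near_realP[d' d'0 dB]] AB|[d d0 dP]].
  exists (Num.min d d'); first by rewrite lt_min d0.
  move=> s h; rewrite !lt_min => /andP[sd _] /andP[_ hd].
  by apply: (AB (s, h)); split=> /=; [exact: dA|exact: dB].
exists ([set s | `|s - x| < d], [set h | `|h - y| < d]).
  by split=> /=; apply/near_realP; exists d.
by move=> [s h] [/= sd hd]; exact: dP.
Qed.

(** Equality of mixed partial derivatives: [a1] is the derivative in the first
   variable, [a12] the derivative of [a1] in the second one, [a2] the derivative
   in the second variable. The second order difference of [a] is
   estimated by the mean value inequality, once in each variable. *)
Lemma schwarz (a a1 a12 : R -> R -> H) (a2 : R -> H) (s0 h0 : R) :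
  (\forall p \near (s0, h0),
     has_deriv (fun s => a s p.2) p.1 (a1 p.1 p.2) /\
     has_deriv (a1 p.1) p.2 (a12 p.1 p.2)) ->
  {for (s0, h0), continuous (fun p => a12 p.1 p.2)} ->
  (\forall s \near s0, has_deriv (a s) h0 (a2 s)) ->
  has_deriv a2 s0 (a12 s0 h0).
Proof.
move=> /near_real_pairP[d1 d10 da] ca /near_realP[d2 d20 d2P].
apply/has_derivP => e e0.
have /cvgrPdist_le/(_ _ e0)/near_real_pairP[d3 d30 d3P] := ca.
pose d := Num.min d1 (Num.min d2 d3).
have d0 : 0 < d by rewrite !lt_min d10 d20.
exists d => // s sd.
have mixed u v : `|u - s0| < d -> `|v - h0| < d ->
    `|a1 u v - a1 u h0 - (v - h0) *: a12 s0 h0| <= e * `|v - h0|.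
  rewrite !lt_min => /andP[ud1 /andP[_ ud3]] /andP[vd1 /andP[_ vd3]].
  apply: (@mean_value_line _ _ _ (a12 u)) => w wv.
  split; first by apply: (da u w ud1 _).2; exact: le_lt_trans wv vd1.
  by rewrite distrC; apply: d3P => //; exact: le_lt_trans wv vd3.
have diff v : `|v - h0| < d ->
    `|(a s v - a s h0) - (a s0 v - a s0 h0) - (s - s0) *: ((v - h0) *: a12 s0 h0)|
      <= e * `|v - h0| * `|s - s0|.
  move=> vd.
  apply: (@mean_value_line _ _ (fun u => a u v - a u h0)
    (fun u => a1 u v - a1 u h0)) => u us.
  have ud : `|u - s0| < d by exact: le_lt_trans us sd.
  split; last exact: mixed.
  move: ud vd; rewrite !lt_min => /andP[ud _] /andP[vd _].
  apply: has_derivB; first exact: (da _ _ ud vd).1.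
  by apply: (da _ _ ud _).1; rewrite subrr normr0.
have s0d : `|s0 - s0| < d2 by rewrite subrr normr0.
have sd2 : `|s - s0| < d2 by move: sd; rewrite !lt_min => /and3P[].
have D2 := has_derivB (d2P _ sd2) (d2P _ s0d).
apply: (has_deriv_dist D2); apply/near_realP; exists d => // v vd.
have := diff v vd; rewrite mulrAC scalerA mulrC -scalerA.
congr (_ <= _); congr `|_|; first by linear_identity R H.
Qed.

Lemma has_deriv_expR (c k t : R) :
  has_deriv (fun s : R => c * expR (k * s)) t (c * (k * expR (k * t)) : R).
Proof.
apply: (@has_derivZ _ R); apply: is_derive_has_deriv.
have dk : is_derive t 1 (fun s : R => k * s) k.
  by have := @is_deriveZ _ _ _ id k t 1 1 (is_derive_id _ _); rewrite /GRing.scale /= mulr1.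
have := is_derive1_comp (is_derive_expR (k * t)) dk; rewrite mulrC; exact.
Qed.

(** Gronwall's inequality in a form that also localises: the growth condition
   is needed only while the curve stays in the ball of radius [rho], and the
   conclusion keeps it there. *)
Lemma gronwall_right (D dD : R -> H) (l L e rho : R) :
  0 <= l -> 0 <= L -> 0 < e -> 2 * e * expR ((L + 1) * l) <= rho ->
  continuous_on `[0, l] D -> `|D 0| <= e ->
  (forall t, 0 < t < l -> has_deriv D t (dD t) /\
     (`|D t| < rho -> `|dD t| <= L * `|D t| + e)) ->
  forall t, 0 <= t <= l -> `|D t| <= 2 * e * expR ((L + 1) * l).
Proof.
move=> l0 L0 e0 erho cD D0 dDP.
(* The bound propagates strictly, since the growth rate [(L + 1) * m t] of the
   majorant exceeds [L * m t + e]. *)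
pose m t : R := 2 * e * expR ((L + 1) * t).
have m_le s t : s <= t -> m s <= m t.
  by move=> st; rewrite ler_pM2l ?mulr_gt0// ler_expR ler_wpM2l ?addr_ge0.
have m0 : m 0 = 2 * e by rewrite /m mulr0 expR0 mulr1.
have dm t : has_deriv m t ((L + 1) * m t : R).
  have := has_deriv_expR (2 * e) (L + 1) t; congr has_deriv.
  by rewrite /m mulrCA.
have ml t : t <= l -> m t <= rho by move=> /m_le/le_trans; apply.
suff lt_m t : 0 <= t <= l -> `|D t| < m t.
  by move=> t /andP[t0 tl]; rewrite (le_trans (ltW (lt_m t _))) ?t0// m_le.
move: t; apply: real_induction => //; first by rewrite m0; lra.
- move=> c /andP[c0 cl] lt_m.
  have Dc : `|D c| < m c by apply: lt_m; rewrite c0 lexx.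
  have cI : `[0, l]%classic c by rewrite /= in_itv /= c0 ltW.
  have g0 : 0 < (m c - `|D c|) / 2 by rewrite divr_gt0// subr_gt0.
  have [d d0 dP] := iffLR (continuous_on_curve _ _) cD c cI _ g0.
  exists d => // s /andP[cs sd] sl.
  have sI : `[0, l]%classic s by rewrite /= in_itv /= sl (le_trans c0 (ltW cs)).
  have /dP/(_ sI) : `|s - c| < d by rewrite gtr0_norm; lra.
  have := m_le _ _ (ltW cs); have := lerB_dist (D s) (D c); rewrite (distrC (D s)).
  lra.
- move=> c /andP[c0 cl] lt_m.
  have sub (X : topologicalType) (f : R -> X) :
      continuous_on `[0, l] f -> continuous_on `[0, c] f.
    move=> cf s sI; apply: cvg_trans (cf s _); last first.
      by move: sI; rewrite /= !in_itv /= => /andP[-> /le_trans]; exact.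
    apply: cvg_app; apply: within_subset => x.
    by rewrite /= !in_itv /= => /andP[-> /le_trans]; exact.
  have : `|D c - D 0| <= m c - m 0.
    apply: (@mean_value_le _ _ D m dD (fun t => (L + 1) * m t)).
    + exact: ltW.
    + exact: sub.
    + by apply: (@has_deriv_continuous_on _ _ _ _ (fun t => (L + 1) * m t)) => t _.
    + move=> t /andP[t0 tc]; have [|Dt bD] := dDP t.
        by rewrite t0 (lt_le_trans tc).
      split=> //; have Dm : `|D t| < m t by apply: lt_m; rewrite (ltW t0).
      have /bD : `|D t| < rho by apply: lt_le_trans Dm (ml _ _); lra.
      have := ler_wpM2l L0 (ltW Dm); have := m_le _ _ (ltW t0); rewrite m0; lra.
  have := lerB_dist (D c) (D 0); rewrite m0; lra.
Qed.

(** The two time directions of [gronwall_right], starting from an inner time. *)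
Lemma gronwall (D dD : R -> H) (a b t0 L e rho : R) :
  a <= t0 <= b -> 0 <= L -> 0 < e -> 2 * e * expR ((L + 1) * (b - a)) <= rho ->
  continuous_on `[a, b] D -> `|D t0| <= e ->
  (forall t, a < t < b -> has_deriv D t (dD t) /\
     (`|D t| < rho -> `|dD t| <= L * `|D t| + e)) ->
  forall t, a <= t <= b -> `|D t| <= 2 * e * expR ((L + 1) * (b - a)).
Proof.
move=> /andP[at0 t0b] L0 e0 erho cD D0 dDP t /andP[at_ tb].
have exp_le l : l <= b - a ->
    2 * e * expR ((L + 1) * l) <= 2 * e * expR ((L + 1) * (b - a)).
  by move=> lba; rewrite ler_pM2l ?mulr_gt0// ler_expR ler_wpM2l ?addr_ge0.
have /continuous_on_curve {}cD := cD.
have [t0t|tt0] := leP t0 t.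
- have lba : b - t0 <= b - a by lra.
  apply: le_trans (exp_le _ lba).
  have -> : D t = D (t0 + (t - t0)) by congr D; ring.
  apply: (@gronwall_right (fun s => D (t0 + s)) (fun s => dD (t0 + s))
    (b - t0) L e rho) => //; try lra.
  + exact: le_trans (exp_le _ lba) erho.
  + apply/continuous_on_curve => s; rewrite /= in_itv /= => /andP[s0 sb] g g0.
    have [|d d0 dP] := cD (t0 + s) _ g g0; first by rewrite /= in_itv /=; lra.
    exists d => // u us /=; rewrite in_itv /= => /andP[u0 ub]; apply: dP.
      by rewrite opprD addrACA subrr add0r.
    by rewrite /= in_itv /=; lra.
  + by rewrite addr0.
  + move=> s /andP[s0 sb]; have [|Ds bD] := dDP (t0 + s); first lra.
    by split=> //; exact: has_deriv_shift.
- have lba : t0 - a <= b - a by lra.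
  apply: le_trans (exp_le _ lba).
  have -> : D t = D (t0 - (t0 - t)) by congr D; ring.
  apply: (@gronwall_right (fun s => D (t0 - s)) (fun s => - dD (t0 - s))
    (t0 - a) L e rho) => //; try lra.
  + exact: le_trans (exp_le _ lba) erho.
  + apply/continuous_on_curve => s; rewrite /= in_itv /= => /andP[s0 sb] g g0.
    have [|d d0 dP] := cD (t0 - s) _ g g0; first by rewrite /= in_itv /=; lra.
    exists d => // u us /=; rewrite in_itv /= => /andP[u0 ub]; apply: dP.
      by rewrite opprB addrC addrA subrK distrC.
    by rewrite /= in_itv /=; lra.
  + by rewrite subr0.
  + move=> s /andP[s0 sb]; have [|Ds bD] := dDP (t0 - s); first lra.
    by rewrite normrN; split=> //; exact: has_deriv_flip.
Qed.

End SchwarzGronwall.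

(** * Primitives of continuous curves *)

Section Primitive.
Context {R : realType}.

(** The explicit rate is what later yields convergence that is uniform in time. *)
Lemma geometric_cvg {E : completeNormedModType R} (u : nat -> E) (K : R) :
  (forall n, `|u n.+1 - u n| <= K * 2^-1 ^+ n) ->
  exists2 l : E, u n @[n --> \oo] --> l & forall n, `|u n - l| <= 2 * K * 2^-1 ^+ n.
Proof.
move=> uK.
have K0 : 0 <= K by have := le_trans (normr_ge0 _) (uK 0%N); rewrite expr0 mulr1.
have far n m : (n <= m)%N -> `|u m - u n| <= 2 * K * (2^-1 ^+ n - 2^-1 ^+ m).
  elim: m => [|m IHm]; first by rewrite leqn0 => /eqP ->; rewrite !subrr normr0 mulr0.
  rewrite leq_eqVlt => /predU1P[->|]; first by rewrite !subrr normr0 mulr0.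
  rewrite ltnS => /IHm A; have B := uK m.
  have -> : u m.+1 - u n = (u m.+1 - u m) + (u m - u n) by linear_identity R E.
  by apply: le_trans (ler_normD _ _) _; move: B; rewrite exprS; lra.
have cu : cvgn (series (telescope u)).
  apply: normed_cvg; apply: (@series_le_cvg _ _ (fun n => K * 2^-1 ^+ n)).
  - by move=> n; exact: normr_ge0.
  - by move=> n; rewrite mulr_ge0// exprn_ge0.
  - by move=> n; exact: uK.
  - by apply: is_cvg_geometric_series; rewrite ger0_norm; lra.
have ucvg : cvgn u.
  have -> : u = cst (u 0%N) + series (telescope u).
    by apply/funext => n; rewrite -[LHS]/(u n) eq_sum_telescope.
  by apply: is_cvgD => //; exact: is_cvg_cst.
exists (limn u) => // n.
have lim : `|u m - u n| @[m --> \oo] --> `|limn u - u n|.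
  by apply: cvg_norm; apply: cvgB => //; exact: cvg_cst.
rewrite distrC; apply: ler_cvg_to lim (cvg_cst _) _.
near=> m; apply: (le_trans (far n m _)); first by near: m; exact: nbhs_infty_ge.
by rewrite ler_pM ?mulr_ge0// ?lerBlDr ?lerDl ?subr_ge0 ?exprn_ge0// ler_wiXn2l//; [lra|near: m; exact: nbhs_infty_ge].
Unshelve. all: by end_near. Qed.

Lemma real_primitive (phi : R -> R) (a b : R) :
  continuous_on `[a, b] phi ->
  exists Phi : R -> R, forall t, a < t < b -> has_deriv Phi t (phi t).
Proof.
move=> cphi.
exists (fun x => \int[lebesgue_measure]_(t in [set` `[a, x]]) phi t)%R => t /andP[at_ tb].
have int : lebesgue_measure.-integrable `[a, b] (EFin \o phi).
  apply: continuous_compact_integrable; first exact: segment_compact.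
  exact/subspace_continuousP.
have ct : {for t, continuous phi}.
  apply/cvgrPdist_le => e e0.
  have tI : `[a, b]%classic t by rewrite /= in_itv /= !ltW.
  have [d d0 dP] := iffLR (continuous_on_curve _ _) cphi t tI e e0.
  near=> s; apply: dP; first by near: s; apply/near_realP; exists d.
  by rewrite /= in_itv /=; apply/andP; split; apply: ltW; near: s; [exact: lt_nbhsr|exact: lt_nbhsl].
have [|dP <-] := @continuous_FTC1 R phi (BLeft a) t b tb int _ ct.
  by rewrite /= lte_fin.
apply: is_derive_has_deriv; rewrite derive1E; exact: DeriveDef.
Unshelve. all: by end_near. Qed.

Lemma has_deriv_sum {H : normedModType R} (n : nat) (phi : 'I_n -> R -> H)
    (l : 'I_n -> H) (t : R) :
  (forall i, has_deriv (phi i) t (l i)) ->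
  has_deriv (fun s => \sum_(i < n) phi i s) t (\sum_(i < n) l i).
Proof.
elim: n phi l => [|n IHn] phi l hl.
  have -> : (fun s => \sum_(i < 0) phi i s) = fun=> 0.
    by apply/funext => s; rewrite big_ord0.
  by rewrite big_ord0; exact: has_deriv_cst.
have -> : (fun s => \sum_(i < n.+1) phi i s) =
    fun s => phi ord0 s + \sum_(i < n) phi (lift ord0 i) s.
  by apply/funext => s; rewrite big_ord_recl.
by rewrite big_ord_recl; apply: has_derivD => //; apply: IHn => i.
Qed.

Lemma has_deriv_scale {H : normedModType R} (phi : R -> R) (v : H) (t k : R) :
  has_deriv phi t k -> has_deriv (fun s => phi s *: v) t (k *: v).
Proof.
move=> hk; apply/has_derivP => e e0.
have v0 : 0 < `|v| + 1 by rewrite ltr_wpDl.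
have [d d0 dP] := iffLR (has_derivP _ _ _) hk _ (divr_gt0 e0 v0).
exists d => // s /dP ks.
have -> : phi s *: v - phi t *: v - (s - t) *: (k *: v) =
    (phi s - phi t - (s - t) * k) *: v by linear_identity R H.
rewrite normrZ; apply: le_trans (ler_wpM2r (normr_ge0 v) ks) _.
rewrite mulrAC ler_wpM2r// mulrAC ler_pdivrMr// ler_wpM2l ?lerDl//; exact: ltW.
Qed.

(** A continuous curve on a compact interval is uniformly close to a curve with
   a primitive: average its values over a fine net, with continuous real
   weights; the real weights have primitives. *)
Lemma approximate_primitive {H : normedModType R} (c : R -> H) (a b e : R) :
  a <= b -> continuous c -> 0 < e ->
  exists C d : R -> H, (forall t, a <= t <= b -> {for t, continuous d}) /\
    forall t, a < t < b -> has_deriv C t (d t) /\ `|d t - c t| <= e.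
Proof.
move=> ab cc e0.
have [d0 d0_gt unif] : exists2 d, 0 < d & forall t s, a <= t <= b ->
    `|s - t| < d -> `|c s - c t| <= e.
  have /near_covering_withinP cover := iffLR (compact_near_coveringP _) (@segment_compact R a b).
  have cov : \forall d \near (0 : R)^'+, `[a, b]%classic `<=`
      (fun t => forall s, `|s - t| < d -> `|c s - c t| <= e).
    apply: cover => t tI.
    have e20 : 0 < e / 2 by rewrite divr_gt0.
    have /cvgrPdist_le/(_ _ e20)/near_realP[d dgt dP] := cc t.
    exists ([set u | `|u - t| < d / 2], [set r | r < d / 2]).
      split=> /=; first by apply/near_realP; exists (d / 2); rewrite ?divr_gt0.
      by near=> r; near: r; apply: nbhs_right_lt; rewrite divr_gt0.
    move=> [u r] /= [ut rd] _ s su.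
    have {}ut : `|u - t| < d / 2 := ut.
    have {}rd : r < d / 2 := rd.
    have {}su : `|s - u| < r := su.
    have -> : c s - c u = (c t - c u) - (c t - c s) by linear_identity R H.
    have A : `|c t - c u| <= e / 2 by apply: dP; lra.
    have B : `|c t - c s| <= e / 2.
      apply: dP; have : `|s - t| <= `|s - u| + `|u - t| := ler_distD u s t.
      lra.
    by rewrite (le_trans (ler_normB _ _))// [e]splitr lerD.
  have [d [dgt dP]] := filter_ex (filterI (nbhs_right_gt (0 : R)) cov).
  by exists d => // t s tI; apply: dP; rewrite /= in_itv /=.
pose N := (Num.truncn ((b - a) / (d0 / 2))).+1.
pose p (i : 'I_N.+1) := a + (i : nat)%:R * (d0 / 2).
(* Twice the positive part of [d0 - `|t - p i|]: tents around nodes at distance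
   [d0 / 2], so that at every time some weight is positive. *)
pose w i t : R := (d0 - `|t - p i|) + `|d0 - `|t - p i| |.
pose S t := \sum_(i < N.+1) w i t.
have w_ge0 i t : 0 <= w i t.
  by rewrite /w; have := ler_norm (- (d0 - `|t - p i|)); rewrite normrN; lra.
have w0 i t : d0 <= `|t - p i| -> w i t = 0.
  by move=> ?; rewrite /w (@ler0_norm _ (d0 - _)); lra.
have S0 t : a <= t <= b -> 0 < S t.
  move=> /andP[at_ tb]; pose x := (t - a) / (d0 / 2).
  have d20 : 0 < d0 / 2 by rewrite divr_gt0.
  have x0 : 0 <= x by apply: divr_ge0; lra.
  have kN : (Num.truncn x < N.+1)%N.
    by rewrite ltnS leqW// le_truncn// /x ler_pM2r ?invr_gt0// lerB.
  have /andP[lx xl] := truncn_itv x0.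
  have tp : t = a + x * (d0 / 2) by rewrite /x divfK ?gt_eqF//; ring.
  rewrite /S (bigD1 (Ordinal kN))//= ltr_pwDl ?sumr_ge0//.
  have : `|t - p (Ordinal kN)| < d0.
    rewrite /p /= {1}tp opprD addrACA subrr add0r -mulrBl ger0_norm; last first.
      by rewrite mulr_ge0 ?subr_ge0// ltW.
    have : (x - (Num.truncn x)%:R) * (d0 / 2) <= 1 * (d0 / 2).
      by rewrite ler_pM2r//; move: xl; rewrite -addn1 natrD; lra.
    lra.
  by rewrite /w => ?; rewrite (@ger0_norm _ (d0 - _)); lra.
have cw i : continuous (w i).
  have cd : continuous (fun t => d0 - `|t - p i|).
    move=> t; apply: cvgB; first exact: cvg_cst.
    by apply: cvg_norm; apply: cvgB; [exact: cvg_id|exact: cvg_cst].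
  by move=> t; apply: cvgD; [exact: cd|apply: cvg_norm; exact: cd].
have cS : continuous S.
  by move=> t; apply: cvg_big => [|i _]; [exact: add_continuous|exact: cw].
pose k i t := w i t / S t.
have ck i t : a <= t <= b -> {for t, continuous (k i)}.
  by move=> tI; apply: cvgM; [exact: cw|apply: cvgV; [rewrite gt_eqF// S0|exact: cS]].
have [Phi PhiP] : exists Phi : 'I_N.+1 -> R -> R, forall i t, a < t < b ->
    has_deriv (Phi i) t (k i t).
  have /choice[Phi PhiP] i : exists Phi, forall t, a < t < b -> has_deriv Phi t (k i t).
    apply: real_primitive => t; rewrite /= in_itv /= => tI.
    exact: cvg_within_filter (ck i t tI).
  by exists Phi.
exists (fun t => \sum_(i < N.+1) Phi i t *: c (p i)).
exists (fun t => \sum_(i < N.+1) k i t *: c (p i)); split.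
  by move=> t tI; apply: cvg_big => [|i _];
    [exact: add_continuous|apply: cvgZ; [exact: ck|exact: cvg_cst]].
move=> t tI; split.
  by apply: has_deriv_sum => i; apply: has_deriv_scale; exact: PhiP.
have tI' : a <= t <= b by move: tI => /andP[? ?]; rewrite !ltW.
have k1 : \sum_(i < N.+1) k i t = 1.
  by rewrite -mulr_suml divff// gt_eqF// S0.
have -> : \sum_(i < N.+1) k i t *: c (p i) - c t =
    \sum_(i < N.+1) k i t *: (c (p i) - c t).
  rewrite -[c t in LHS]scale1r -k1 scaler_suml -sumrB.
  by apply: eq_bigr => i _; rewrite scalerBr.
apply: le_trans (ler_norm_sum _ _ _) _.
rewrite -[e]mul1r -k1 mulr_suml; apply: ler_sum => i _.
have k0 : 0 <= k i t by rewrite divr_ge0// ltW// S0.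
rewrite normrZ ger0_norm//.
have [far|close] := leP d0 `|t - p i|.
  by rewrite /k w0// mul0r !mul0r.
by rewrite ler_wpM2l// unif// distrC.
Unshelve. all: by end_near. Qed.

End Primitive.

(** * Global solutions of Lipschitz equations, by Picard iteration *)

Section Existence.
Context {R : realType} {E : completeNormedModType R}.

(** Primitives of better and better approximations of [c], normalised at [t0],
   converge by the mean value inequality. This replaces a vector-valued integral. *)
Lemma exists_primitive (c : R -> E) (a b t0 : R) :
  a < t0 < b -> continuous c ->
  exists2 C : R -> E, C t0 = 0 & forall t, a < t < b -> has_deriv C t (c t).
Proof.
move=> /andP[at0 t0b] cc; have ab : a <= b by lra.
have /choice[Cd CdP] : forall n : nat, exists Cd : (R -> E) * (R -> E),
    (forall t, a <= t <= b -> {for t, continuous Cd.2}) /\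
    forall t, a < t < b -> has_deriv Cd.1 t (Cd.2 t) /\
      `|Cd.2 t - c t| <= 2^-1 ^+ n.
  move=> n; have n0 : 0 < (2^-1 : R) ^+ n by rewrite exprn_gt0.
  have [C [d [cd dP]]] := approximate_primitive ab cc n0.
  by exists (C, d).
pose y n t := (Cd n).1 t - (Cd n).1 t0.
have dy n t : a < t < b -> has_deriv (y n) t ((Cd n).2 t).
  move=> tI; rewrite -[X in has_deriv _ _ X]subr0; apply: has_derivB.
    exact: ((CdP n).2 t tI).1.
  exact: has_deriv_cst.
have y_step n t : a < t < b -> `|y n.+1 t - y n t| <= 2 * (b - a) * 2^-1 ^+ n.
  move=> /andP[at_ tb].
  have n0 : 0 <= (2^-1 : R) ^+ n by rewrite exprn_ge0.
  have : `|(y n.+1 t - y n t) - (y n.+1 t0 - y n t0) - (t - t0) *: 0| <=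
      2 * 2^-1 ^+ n * `|t - t0|.
    apply: (@mean_value_segment _ _ (fun s => y n.+1 s - y n s)
      (fun s => (Cd n.+1).2 s - (Cd n).2 s)) => u uI.
    have {}uI : a < u < b by have [/andP[? ?]|/andP[? ?]] := orP uI; lra.
    split; first by apply: has_derivB; exact: dy.
    have -> : (Cd n.+1).2 u - (Cd n).2 u - 0 =
        ((Cd n.+1).2 u - c u) - ((Cd n).2 u - c u) by linear_identity R E.
    apply: le_trans (ler_normB _ _) _.
    have := ((CdP n).2 u uI).2; have := ((CdP n.+1).2 u uI).2.
    by rewrite exprS; lra.
  rewrite {3 4}/y !subrr scaler0 !subr0 => /le_trans; apply.
  have tt0 : `|t - t0| <= b - a by rewrite ler_norml; lra.
  by have := ler_wpM2l n0 tt0; lra.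
have lim t : exists l : E, a < t < b -> y n t @[n --> \oo] --> l.
  have [tI|ntI] := boolP (a < t < b); last by exists 0.
  by have [l yl _] := geometric_cvg (fun n => y_step n t tI); exists l.
have [C CP] := choice lim.
have dC t : a < t < b -> has_deriv C t (c t).
  move=> tI; apply: (@has_deriv_uniform_limit _ _ [set` `]a, b[] _ _ y (fun n => (Cd n).2)).
  - exact: interval_open.
  - by move=> n s; rewrite /= in_itv /= => /dy.
  - move=> n s; rewrite /= in_itv /= => /andP[? ?]; apply: (CdP n).1.
    by rewrite !ltW.
  - move=> e e0; near=> n => s; rewrite /= in_itv /= => sI.
    apply: le_trans ((CdP n).2 s sI).2 _.
    near: n; have /cvgrPdist_le/(_ _ e0) : (2^-1 : R) ^+ n @[n --> \oo] --> 0.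
      by apply: cvg_expr; rewrite ger0_norm; lra.
    by apply: filterS => n; rewrite sub0r normrN; apply: le_trans; exact: ler_norm.
  - by move=> s; rewrite /= in_itv /= => /CP.
  - by rewrite /= in_itv.
exists (fun t => C t - C t0); first by rewrite subrr.
move=> t tI; rewrite -[X in has_deriv _ _ X]subr0; apply: has_derivB.
  exact: dC.
exact: has_deriv_cst.
Unshelve. all: by end_near. Qed.

(** The mean value inequality away from [t0], for a majorant that depends on the
   distance to [t0] only, as the exponential weight of the Picard iteration does. *)
Lemma mean_value_sym (D dD : R -> E) (m dm : R -> R) (t0 t : R) :
  (forall s, (t0 <= s <= t) || (t <= s <= t0) ->
    [/\ has_deriv D s (dD s), has_deriv m `|s - t0| (dm `|s - t0|) &
        `|dD s| <= dm `|s - t0| ]) ->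
  `|D t - D t0| <= m `|t - t0| - m 0.
Proof.
move=> hD; have [t0t|tt0] := leP t0 t.
- pose F s := D (t0 + s).
  have P s : 0 <= s <= t - t0 -> [/\ has_deriv F s (dD (t0 + s)),
      has_deriv m s (dm s) & `|dD (t0 + s)| <= dm s].
    move=> /andP[s0 st]; have [] := hD (t0 + s).
      by apply/orP; left; lra.
    rewrite addrAC subrr add0r ger0_norm// => dDs dms le_m; split=> //.
    exact: has_deriv_shift.
  have -> : `|t - t0| = t - t0 by rewrite ger0_norm ?subr_ge0.
  have -> : D t - D t0 = F (t - t0) - F 0 by rewrite /F; congr (D _ - D _); ring.
  apply: (@mean_value_le _ _ F m (fun s => dD (t0 + s)) dm).
  + by rewrite subr_ge0.
  + apply: (@has_deriv_continuous_on _ _ _ _ (fun s => dD (t0 + s))) => s /=.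
    by rewrite in_itv /= => /P[].
  + apply: (@has_deriv_continuous_on _ _ _ _ dm) => s /=.
    by rewrite in_itv /= => /P[].
  + by move=> s /andP[s0 st]; apply: P; rewrite !ltW.
- pose F s := D (t0 - s).
  have P s : 0 <= s <= t0 - t -> [/\ has_deriv F s (- dD (t0 - s)),
      has_deriv m s (dm s) & `|- dD (t0 - s)| <= dm s].
    move=> /andP[s0 st]; have [] := hD (t0 - s).
      by apply/orP; right; lra.
    rewrite addrAC subrr add0r normrN ger0_norm// normrN => dDs dms le_m; split=> //.
    exact: has_deriv_flip.
  have -> : `|t - t0| = t0 - t by rewrite ltr0_norm ?subr_lt0// opprB.
  have -> : D t - D t0 = F (t0 - t) - F 0 by rewrite /F; congr (D _ - D _); ring.
  apply: (@mean_value_le _ _ F m (fun s => - dD (t0 - s)) dm).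
  + by rewrite subr_ge0 ltW.
  + apply: (@has_deriv_continuous_on _ _ _ _ (fun s => - dD (t0 - s))) => s /=.
    by rewrite in_itv /= => /P[].
  + apply: (@has_deriv_continuous_on _ _ _ _ dm) => s /=.
    by rewrite in_itv /= => /P[].
  + by move=> s /andP[s0 st]; apply: P; rewrite !ltW.
Qed.

(** The retraction of the line to [[a, b]]; it extends data given on the interval
   to a neighbourhood, so that derivatives at the end points are two-sided. *)
Definition clamp (a b t : R) : R := Num.max a (Num.min b t).

Lemma clamp_id a b t : a <= t <= b -> clamp a b t = t.
Proof. by move=> /andP[at_ tb]; rewrite /clamp min_r// max_r. Qed.

Lemma clamp_itv a b t : a <= b -> a <= clamp a b t <= b.
Proof. by move=> ab; rewrite /clamp le_max lexx ge_max ab ge_min lexx. Qed.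

Lemma clamp_dist a b s t : `|clamp a b s - clamp a b t| <= `|s - t|.
Proof.
have X := ler_norm (s - t); have Y := ler_norm (t - s); rewrite (distrC t s) in Y.
by rewrite /clamp; case: (ltP b s) => ?; case: (ltP b t) => ?;
  try case: (ltP a b) => ?; try case: (ltP a s) => ?; try case: (ltP a t) => ?;
  rewrite ?subrr ?normr0 //; rewrite ler_norml; lra.
Qed.

Lemma clamp_continuous a b : continuous (clamp a b).
Proof.
move=> t; apply/cvgrPdist_le => e e0; apply/near_realP; exists e => // s st.
by rewrite distrC (le_trans (clamp_dist _ _ _ _))// ltW.
Qed.

(** Global existence for a globally Lipschitz equation (Picard iteration). The
   weight [expR (2 * (L + 1) * `|t - t0|)] makes the iteration a contraction with
   factor 1/2 on the whole interval at once. *)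
Theorem lipschitz_ode_exists (g : R -> E -> E) (L a b t0 : R) (y0 : E) :
  a <= t0 <= b -> 0 <= L -> continuous (fun p : R * E => g p.1 p.2) ->
  (forall t x y, `|g t x - g t y| <= L * `|x - y|) ->
  exists2 y : R -> E, y t0 = y0 &
    forall t, a <= t <= b -> has_deriv y t (g t (y t)).
Proof.
move=> /andP[at0 t0b] L0 cg lip; have ab : a <= b by lra.
(* On a larger interval the derivatives at [a] and [b] are two-sided. *)
pose a' := a - 1; pose b' := b + 1.
have t0I : a' < t0 < b' by rewrite /a' /b'; lra.
pose tau := clamp a b.
pose c (y : R -> E) t := g t (y (tau t)).
have cc (y : R -> E) : (forall t, a <= t <= b -> {for t, continuous y}) ->
    continuous (c y).
  move=> cy t; apply: (@continuous_comp _ _ _ (fun s => (s, y (tau s)))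
    (fun p : R * E => g p.1 p.2)); last exact: cg.
  apply: cvg_to_pair; first exact: cvg_id.
  apply: (@continuous_comp _ _ _ tau y); first exact: clamp_continuous.
  by apply: cy; exact: clamp_itv.
have /choice[step stepP] (y : R -> E) : exists y' : R -> E,
    (forall t, a <= t <= b -> {for t, continuous y}) ->
    y' t0 = y0 /\ forall t, a' < t < b' -> has_deriv y' t (c y t).
  have [/cc cy|ncy] := pselect (forall t, a <= t <= b -> {for t, continuous y}).
    have [C C0 CP] := exists_primitive t0I cy.
    exists (fun t => y0 + C t) => _; split; first by rewrite C0 addr0.
    move=> t tI; rewrite -[c y t]add0r; apply: has_derivD; last exact: CP.
    exact: has_deriv_cst.
  by exists y.
pose y n := iter n step (fun=> y0).
have cy n t : a <= t <= b -> {for t, continuous (y n)}.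
  case: n t => [|n] t tI; first exact: cvg_cst.
  have {}IH : forall m s, a <= s <= b -> {for s, continuous (y m)}.
    elim=> [|m IHm] s sI; first exact: cvg_cst.
    apply: has_deriv_continuous; apply: (stepP (y m) IHm).2.
    by rewrite /a' /b'; lra.
  exact: IH.
have yt0 n : y n t0 = y0 by case: n => // n; exact: (stepP (y n) (cy n)).1.
have dy n t : a' < t < b' -> has_deriv (y n.+1) t (c (y n) t).
  exact: (stepP (y n) (cy n)).2.
have [K K0 KP] : exists2 K, 0 <= K & forall t, a' <= t <= b' -> `|g t y0| <= K.
  have [||k _ kP] := @EVT_max R (fun t => `|g t y0|) a' b'.
  - by rewrite /a' /b'; lra.
  - apply: continuous_subspaceT => t; apply: cvg_norm.
    apply: (@continuous_comp _ _ _ (fun s => (s, y0)) (fun p : R * E => g p.1 p.2)).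
      by apply: cvg_to_pair; [exact: cvg_id|exact: cvg_cst].
    exact: cg.
  - exists `|g k y0| => // t tI; apply: kP; by rewrite in_itv.
pose L' := L + 1; have L'0 : 0 < L' by rewrite /L'; lra.
pose m (n : nat) (s : R) := K * (b' - a') * 2^-1 ^+ n * expR (2 * L' * s).
have m0 n s : 0 <= m n s.
  by rewrite !mulr_ge0 ?expR_ge0 ?exprn_ge0// /a' /b'; lra.
have dm n s : has_deriv (m n.+1) s (L' * m n s : R).
  have := has_deriv_expR (K * (b' - a') * 2^-1 ^+ n.+1) (2 * L') s.
  by congr has_deriv; rewrite /m exprS; field.
have y_step n t : a' < t < b' -> `|y n.+1 t - y n t| <= m n `|t - t0|.
  elim: n t => [|n IHn] t tI.
    have : `|(y 1%N t - y 0%N t) - (y 1%N t0 - y 0%N t0) - (t - t0) *: 0| <=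
        K * `|t - t0|.
      apply: (@mean_value_segment _ _ (fun s => y 1%N s - y 0%N s) (fun s => c (y 0%N) s - 0)) => u uI.
      have {}uI : a' < u < b' by have [/andP[? ?]|/andP[? ?]] := orP uI; lra.
      split; first by apply: has_derivB; [exact: dy|exact: has_deriv_cst].
      by rewrite !subr0; apply: KP; move: uI => /andP[? ?]; rewrite !ltW.
    rewrite !yt0 !subrr scaler0 !subr0 => /le_trans; apply.
    rewrite /m expr0 mulr1 -mulrA ler_wpM2l//.
    have tt0 : `|t - t0| <= b' - a' by rewrite ler_norml /a' /b' in t0I tI *; lra.
    apply: le_trans tt0 _; rewrite ler_peMr//; first by rewrite /a' /b'; lra.
    by rewrite -expR0 ler_expR mulr_ge0// mulr_ge0// ltW.
  have : `|(y n.+2 t - y n.+1 t) - (y n.+2 t0 - y n.+1 t0)| <=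
      m n.+1 `|t - t0| - m n.+1 0.
    apply: (@mean_value_sym (fun s => y n.+2 s - y n.+1 s)
      (fun s => c (y n.+1) s - c (y n) s) _ (fun s => L' * m n s)) => s sI.
    have {}sI : a' < s < b' by have [/andP[? ?]|/andP[? ?]] := orP sI; lra.
    split=> //; first by apply: has_derivB; exact: dy.
    apply: le_trans (lip _ _ _) _; apply: (@ler_pM _ L L') => //.
      by rewrite /L'; lra.
    have tsI : a' < tau s < b'.
      by have /andP[? ?] := clamp_itv s ab; rewrite /a' /b' /tau; lra.
    apply: le_trans (IHn _ tsI) _.
    rewrite /m ler_wpM2l//; first by rewrite !mulr_ge0 ?exprn_ge0// /a' /b'; lra.
    rewrite ler_expR ler_wpM2l//; first by rewrite mulr_ge0// ltW.
    by have := clamp_dist a b s t0; rewrite (@clamp_id a b t0) ?at0.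
  by rewrite !yt0 subrr subr0; have := m0 n.+1 0; lra.
pose C := K * (b' - a') * expR (2 * L' * (b' - a')).
have y_step' n t : a' < t < b' -> `|y n.+1 t - y n t| <= C * 2^-1 ^+ n.
  move=> tI; apply: le_trans (y_step n t tI) _.
  rewrite /m /C [leRHS]mulrAC ler_wpM2l//.
    by rewrite !mulr_ge0 ?exprn_ge0// /a' /b'; lra.
  rewrite ler_expR ler_wpM2l//; first by rewrite mulr_ge0// ltW.
  by rewrite ler_norml; move: t0I tI; lra.
have lim t : exists l : E, a' < t < b' -> y n t @[n --> \oo] --> l /\
    forall n, `|y n t - l| <= 2 * C * 2^-1 ^+ n.
  have [tI|ntI] := boolP (a' < t < b'); last by exists 0.
  by have [l yl ylP] := geometric_cvg (fun n => y_step' n t tI); exists l.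
have [z zP] := choice lim.
have dz t : a' < t < b' -> has_deriv z t (c z t).
  move=> tI; apply: (@has_deriv_uniform_limit _ _ [set` `]a', b'[] _ _
    (fun n => y n.+1) (fun n => c (y n))).
  - exact: interval_open.
  - by move=> n s; rewrite /= in_itv /=; exact: dy.
  - by move=> n s _; apply: cc => u; exact: cy.
  - move=> e e0.
    have C0 : 0 <= C by rewrite !mulr_ge0 ?expR_ge0// /a' /b'; lra.
    have q0 : 0 < L * (2 * C) + 1 by have := mulr_ge0 L0 C0; lra.
    have e'0 : 0 < e / (L * (2 * C) + 1) by exact: divr_gt0.
    near=> n => s _.
    apply: le_trans (lip _ _ _) _.
    have /andP[? ?] := clamp_itv s ab.
    have [|_ zn] := zP (tau s); first by rewrite /tau /a' /b'; lra.
    apply: le_trans (ler_wpM2l L0 (zn n)) _.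
    have : (2^-1 : R) ^+ n <= e / (L * (2 * C) + 1).
      near: n; have /cvgrPdist_le/(_ _ e'0) : (2^-1 : R) ^+ n @[n --> \oo] --> 0.
        by apply: cvg_expr; rewrite ger0_norm; lra.
      by apply: filterS => n; rewrite sub0r normrN; apply: le_trans; exact: ler_norm.
    rewrite ler_pdivlMr//.
    have : 0 <= (2^-1 : R) ^+ n by rewrite exprn_ge0.
    lra.
  - by move=> s; rewrite /= in_itv /= => /zP[zl _]; rewrite (cvg_shiftS (fun n => y n s)).
  - by rewrite /= in_itv.
exists z.
  have [zl _] := zP t0 t0I; apply: cvg_unique zl _ => //.
  by have -> : (fun n => y n t0) = fun=> y0; [apply/funext|exact: cvg_cst].
move=> t tI; have := dz t _; rewrite /c /tau clamp_id//; apply.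
by rewrite /a' /b'; lra.
Unshelve. all: by end_near. Qed.

End Existence.

(** * Continuity on subsets *)

Section ContinuousOn.
Context {T U V : topologicalType}.
Implicit Types (A : set T) (B : set U).

Lemma continuous_onW A (f : T -> U) : continuous f -> continuous_on A f.
Proof. by move=> cf x _; apply: cvg_within_filter; exact: cf. Qed.

Lemma continuous_onT (f : T -> U) : continuous_on setT f -> continuous f.
Proof.
move=> cf x P nP.
have fP : \forall y \near x, setT y -> P (f y) := cf x I P nP.
suff : \forall y \near x, P (f y) by [].
by apply: filterS fP => y; apply.
Qed.

Lemma continuous_on_sub A A' (f : T -> U) :
  A' `<=` A -> continuous_on A f -> continuous_on A' f.
Proof.
move=> AA' cf x Ax; apply: cvg_trans (cf x (AA' x Ax)).
by apply: cvg_app; exact: within_subset.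
Qed.

Lemma continuous_on_comp A B (f : T -> U) (g : U -> V) :
  continuous_on A f -> continuous_on B g -> (forall x, A x -> B (f x)) ->
  continuous_on A (fun x => g (f x)).
Proof.
move=> cf cg AB x Ax P /(cg _ (AB _ Ax)) gP.
have fP : \forall y \near x, A y -> B (f y) -> P (g (f y)) := cf x Ax _ gP.
suff : \forall y \near x, A y -> P (g (f y)) by [].
by apply: filterS fP => y fP Ay; apply: (fP Ay); exact: AB.
Qed.

Lemma continuous_on_pair A (f : T -> U) (g : T -> V) :
  continuous_on A f -> continuous_on A g ->
  continuous_on A (fun x => (f x, g x)).
Proof. by move=> cf cg x Ax; exact: cvg_to_pair (cf x Ax) (cg x Ax). Qed.

Lemma continuous_on_eq A (f g : T -> U) :
  (forall x, A x -> f x = g x) -> continuous_on A f -> continuous_on A g.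
Proof.
move=> fg cf x Ax; rewrite -fg//; apply: cvg_trans (cf x Ax).
by apply: fmap_within_eq => y; rewrite inE => /fg.
Qed.

End ContinuousOn.

Lemma continuous_on_fst {T U V : topologicalType} (A : set T) (f : T -> U * V) :
  continuous_on A f -> continuous_on A (fun x => (f x).1).
Proof.
by move=> cf; apply: (@continuous_on_comp _ _ _ A setT f fst) => // -[x y] _;
  apply: cvg_within_filter; exact: cvg_fst.
Qed.

Lemma continuous_on_snd {T U V : topologicalType} (A : set T) (f : T -> U * V) :
  continuous_on A f -> continuous_on A (fun x => (f x).2).
Proof.
by move=> cf; apply: (@continuous_on_comp _ _ _ A setT f snd) => // -[x y] _;
  apply: cvg_within_filter; exact: cvg_snd.
Qed.

Lemma continuous_on_id {T : topologicalType} (A : set T) : continuous_on A id.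
Proof. by apply: continuous_onW => x; exact: cvg_id. Qed.

Lemma continuous_on_cst {T U : topologicalType} (A : set T) (a : U) :
  continuous_on A (fun=> a).
Proof. by apply: continuous_onW => x; exact: cvg_cst. Qed.

Lemma continuous_onD {R : realType} {T : topologicalType} {Z : tvsType R}
    (A : set T) (f g : T -> Z) :
  continuous_on A f -> continuous_on A g -> continuous_on A (fun x => f x + g x).
Proof.
move=> cf cg; apply: (@continuous_on_comp _ _ _ A setT (fun x => (f x, g x))
  (fun p => p.1 + p.2)) => //; first exact: continuous_on_pair.
by apply: continuous_onW; exact: add_continuous.
Qed.

Lemma continuous_onZ {R : realType} {T : topologicalType} {Z : tvsType R}
    (A : set T) (k : T -> R) (f : T -> Z) :
  continuous_on A k -> continuous_on A f -> continuous_on A (fun x => k x *: f x).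
Proof.
move=> ck cf; apply: (@continuous_on_comp _ _ _ A setT (fun x => (k x, f x))
  (fun p : R^o * Z => p.1 *: p.2)) => //; first exact: continuous_on_pair.
by apply: continuous_onW; exact: scale_continuous.
Qed.

Lemma open_prod {T U : topologicalType} (A : set T) (B : set U) :
  open A -> open B -> open (A `*` B).
Proof.
move=> oA oB; rewrite openE => -[x y] [Ax By]; exists (A, B) => //.
by split; exact: open_nbhs_nbhs.
Qed.

Ltac continuity := repeat first
  [ assumption | exact: continuous_on_id | exact: continuous_on_cst
  | apply: continuous_on_pair | apply: continuous_on_fst
  | apply: continuous_on_snd | apply: continuous_onD | apply: continuous_onZ ].

Lemma line_cvg {R : realType} {Z : tvsType R} (z v : Z) :
  z + h *: v @[h --> (0 : R)] --> z.
Proof.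
have c : continuous_on setT (fun h : R => z + h *: v) by continuity.
by have := continuous_onT c (x := 0); rewrite /continuous_at scale0r addr0.
Qed.

(** * Directional derivatives with parameters *)

Section DirectionalDerivative.
Context {R : realType} {Z : tvsType R} {H : normedModType R}.

Definition has_dirderiv (g : Z -> H) (z v : Z) (l : H) :=
  has_deriv (fun h => g (z + h *: v)) 0 l.

Lemma has_dirderivP (g : Z -> H) z v l : has_dirderiv g z v l <->
  forall e, 0 < e -> \forall h \near (0 : R),
    `|g (z + h *: v) - g z - h *: l| <= e * `|h|.
Proof.
split=> gl e e0; have := gl e e0; apply: filterS => h;
  by rewrite add0r scale0r addr0.
Qed.

Lemma has_dirderiv_shift (g : Z -> H) z v (s : R) l :
  has_dirderiv g (z + s *: v) v l -> has_deriv (fun h => g (z + h *: v)) s l.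
Proof.
move=> /has_dirderivP gl e /gl; apply: filterS => h.
by rewrite scalerDl addrA.
Qed.

Lemma has_dirderivZ (g : Z -> H) z v l (k : R) :
  has_dirderiv g z v l -> has_dirderiv g z (k *: v) (k *: l).
Proof.
move=> gl; apply/has_dirderivP => e e0.
have k0 : 0 < `|k| + 1 by rewrite ltr_wpDl.
have /has_dirderivP/(_ _ (divr_gt0 e0 k0))/near_realP[d d0 dP] := gl.
near=> h.
have -> : g (z + h *: (k *: v)) - g z - h *: (k *: l) =
   g (z + (h * k) *: v) - g z - (h * k) *: l by rewrite !scalerA.
have hk : `|h * k| < d.
  rewrite normrM (@le_lt_trans _ _ (`|h| * (`|k| + 1)))//.
    by rewrite ler_wpM2l// lerDl.
  rewrite -ltr_pdivlMr//; near: h; apply/near_realP.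
  by exists (d / (`|k| + 1)) => [|h]; rewrite ?divr_gt0// subr0.
apply: le_trans (dP _ _) _; first by rewrite subr0.
have -> : e * `|h| = e / (`|k| + 1) * (`|h| * (`|k| + 1)).
  by field; rewrite gt_eqF.
rewrite normrM; apply: ler_wpM2l; first by rewrite divr_ge0// ltW.
by apply: ler_wpM2l => //; rewrite lerDl.
Unshelve. all: by end_near. Qed.

Lemma has_dirderiv_unique (g : Z -> H) z v l m :
  has_dirderiv g z v l -> has_dirderiv g z v m -> l = m.
Proof. exact: has_deriv_unique. Qed.

Lemma has_dirderiv_near (g1 g2 : Z -> H) z v l :
  (\forall y \near z, g1 y = g2 y) -> has_dirderiv g1 z v l -> has_dirderiv g2 z v l.
Proof.
by move=> E; apply: has_deriv_near; exact: line_cvg v _ E.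
Qed.

End DirectionalDerivative.

(** Intervals around 0 are balanced: a property near 0 holds on the whole segment
   between 0 and [p.2], where a mean value inequality needs it. *)
Lemma near_scaled {R : realType} {T : topologicalType} (x : T) (P : T -> R -> Prop) :
  (\forall p \near (x, (0 : R)), P p.1 p.2) ->
  \forall p \near (x, (0 : R)), forall s, `|s| <= `|p.2| -> P p.1 s.
Proof.
move=> [[A B] /= [nA /near_realP[d d0 dB]] AB].
exists (A, [set h | `|h| < d]).
  by split=> //=; apply/near_realP; exists d => // h; rewrite subr0.
move=> [y h] /= [Ay hd] s sh; apply: (AB (y, s)); split=> //=.
by apply: dB; rewrite subr0 (le_lt_trans sh).
Qed.

Section StrictDerivative.
Context {R : realType} {Q : topologicalType} {Z : tvsType R} {H : normedModType R}.
Implicit Types (S : set Q) (W : set Z) (g : Q -> Z -> H) (dg : Q -> Z * Z -> H).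

(** The pair of base point and direction is a single argument of [dg], so that [dg]
   is again a function of the kind of [g], with the space [Z * Z]. *)
Definition is_tangent S W g dg :=
  forall q z v, S q -> W z -> has_dirderiv (g q) z v (dg q (z, v)).

(** A continuous directional derivative is a strict one: the first order
   approximation is uniform in nearby parameters, base points and directions.
   The parameters at which the derivative is known to exist may form a proper
   subset [S'], such as the interior of a time interval. *)
Lemma strict_dirderiv S' S W g dg q0 z0 v0 :
  S' `<=` S -> open W -> is_tangent S' W g dg ->
  continuous_on (S `*` (W `*` setT)) (fun p => dg p.1 p.2) ->
  S q0 -> W z0 -> forall e, 0 < e ->
  \forall p \near ((q0, (z0, v0)), (0 : R)), S' p.1.1 ->
    `|g p.1.1 (p.1.2.1 + p.2 *: p.1.2.2) - g p.1.1 p.1.2.1 - p.2 *: dg q0 (z0, v0)|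
      <= e * `|p.2|.
Proof.
move=> SS' oW tg cdg Sq0 Wz0 e e0.
have near_dg : \forall p \near (q0, (z0, v0)), (S `*` (W `*` setT)) p ->
    `|dg q0 (z0, v0) - dg p.1 p.2| <= e.
  by have /cvgrPdist_le/(_ _ e0) := cdg (q0, (z0, v0)) (conj Sq0 (conj Wz0 I)).
have near_W : \forall z \near z0, W z by exact: open_nbhs_nbhs.
have shift : (fun p : (Q * (Z * Z)) * R => p.1.2.1 + p.2 *: p.1.2.2) p
    @[p --> ((q0, (z0, v0)), (0 : R))] --> z0.
  have c : continuous_on setT
    (fun p : (Q * (Z * Z)) * R => p.1.2.1 + p.2 *: p.1.2.2) by continuity.
  by have := continuous_onT c (x := ((q0, (z0, v0)), 0)); rewrite /continuous_at /= scale0r addr0.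
have shift2 : (fun p : (Q * (Z * Z)) * R =>
      (p.1.1, (p.1.2.1 + p.2 *: p.1.2.2, p.1.2.2))) p
    @[p --> ((q0, (z0, v0)), (0 : R))] --> (q0, (z0, v0)).
  have c : continuous_on setT (fun p : (Q * (Z * Z)) * R =>
      (p.1.1, (p.1.2.1 + p.2 *: p.1.2.2, p.1.2.2))) by continuity.
  by have := continuous_onT c (x := ((q0, (z0, v0)), 0)); rewrite /continuous_at /= scale0r addr0.
have near_all : \forall p \near ((q0, (z0, v0)), (0 : R)), S' p.1.1 ->
    W (p.1.2.1 + p.2 *: p.1.2.2) /\
    `|dg p.1.1 (p.1.2.1 + p.2 *: p.1.2.2, p.1.2.2) - dg q0 (z0, v0)| <= e.
  have A : \forall p \near ((q0, (z0, v0)), (0 : R)),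
    W (p.1.2.1 + p.2 *: p.1.2.2) := shift _ near_W.
  have B : \forall p \near ((q0, (z0, v0)), (0 : R)),
    (S `*` (W `*` setT)) (p.1.1, (p.1.2.1 + p.2 *: p.1.2.2, p.1.2.2)) ->
    `|dg q0 (z0, v0) - dg p.1.1 (p.1.2.1 + p.2 *: p.1.2.2, p.1.2.2)| <= e :=
    shift2 _ near_dg.
  apply: filterS (filterI A B) => -[[q [z v]] h] /= [Wz dgz] Sq.
  by split=> //; rewrite distrC; apply: dgz; split=> //; exact: SS'.
have := @near_scaled R _ _ (fun x h => S' x.1 -> W (x.2.1 + h *: x.2.2) /\
  `|dg x.1 (x.2.1 + h *: x.2.2, x.2.2) - dg q0 (z0, v0)| <= e) near_all.
apply: filterS => -[[q [z v]] h] /= near_h Sq.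
have := @mean_value_line R H (fun s => g q (z + s *: v))
  (fun s => dg q (z + s *: v, v)) (dg q0 (z0, v0)) e 0 h.
rewrite scale0r addr0 !subr0; apply => s; rewrite subr0 => sh.
have [Wz dgz] := near_h s sh Sq; split=> //.
by apply: has_dirderiv_shift; exact: tg.
Qed.

(** The first order estimate of [strict_dirderiv] is uniform in the parameter, so it
   passes to the limit. *)
Lemma is_tangent_closure S' S W g dg :
  S' `<=` S -> open W -> is_tangent S' W g dg ->
  (forall q, S q -> closure S' q) ->
  continuous_on (S `*` W) (fun p => g p.1 p.2) ->
  continuous_on (S `*` (W `*` setT)) (fun p => dg p.1 p.2) ->
  is_tangent S W g dg.
Proof.
move=> SS' oW tg clS cg cdg q0 z0 v0 Sq0 Wz0.
apply/has_dirderivP => e e0.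
have [[A B] /= [[[A1 A2] /= [nA1 nA2] A12] nB] AB] :=
  strict_dirderiv v0 SS' oW tg cdg Sq0 Wz0 e0.
have near_W : \forall h \near (0 : R), W (z0 + h *: v0).
  by apply: line_cvg; exact: open_nbhs_nbhs.
near=> h; apply/ler_addgt0Pr => eta eta0.
have Wh : W (z0 + h *: v0) by near: h.
have eta20 : 0 < eta / 2 by rewrite divr_gt0.
have cont z : W z -> \forall q \near q0, S q -> `|g q0 z - g q z| <= eta / 2.
  move=> Wz.
  have c : continuous_on S (fun q => g q z).
    apply: (@continuous_on_comp _ _ _ S (S `*` W) (fun q => (q, z))
      (fun p => g p.1 p.2)) => //; by continuity.
  by have /cvgrPdist_le/(_ _ eta20) := c q0 Sq0.
have [q [Sq [[nq1 nq2] A1q]]] := clS _ Sq0 _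
  (filterI (filterI (cont _ Wz0) (cont _ Wh)) nA1).
have A2z : A2 (z0, v0) by exact: nbhs_singleton.
have Bh : B h by near: h.
have bound : `|g q (z0 + h *: v0) - g q z0 - h *: dg q0 (z0, v0)| <= e * `|h|.
  by have := AB ((q, (z0, v0)), h); apply=> //; split=> //=; exact: A12.
have -> : g q0 (z0 + h *: v0) - g q0 z0 - h *: dg q0 (z0, v0) =
   (g q (z0 + h *: v0) - g q z0 - h *: dg q0 (z0, v0)) +
   ((g q0 (z0 + h *: v0) - g q (z0 + h *: v0)) - (g q0 z0 - g q z0)).
  by linear_identity R H.
apply: le_trans (ler_normD _ _) _; rewrite lerD//.
have := nq1 (SS' _ Sq); have := nq2 (SS' _ Sq).
have := ler_normB (g q0 (z0 + h *: v0) - g q (z0 + h *: v0)) (g q0 z0 - g q z0).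
lra.
Unshelve. all: by end_near. Qed.

Lemma is_tangentZ S W g dg q z v (k : R) : is_tangent S W g dg ->
  S q -> W z -> dg q (z, k *: v) = k *: dg q (z, v).
Proof.
move=> tg Sq Wz; apply: has_dirderiv_unique (tg q z _ Sq Wz) _.
exact: has_dirderivZ (tg q z v Sq Wz).
Qed.

(** The first order term is additive in the direction: compare the increments
   over the two sides of a small parallelogram. *)
Lemma is_tangentD S W g dg q z u v : open W -> is_tangent S W g dg ->
  continuous_on (S `*` (W `*` setT)) (fun p => dg p.1 p.2) ->
  S q -> W z -> dg q (z, u + v) = dg q (z, u) + dg q (z, v).
Proof.
move=> oW tg cdg Sq Wz; apply: has_dirderiv_unique (tg q z _ Sq Wz) _.
apply/has_dirderivP => e e0; have e20 : 0 < e / 2 by rewrite divr_gt0.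
have A := strict_dirderiv v (@subset_refl _ S) oW tg cdg Sq Wz e20.
have c : continuous_on setT (fun h : R => ((q, (z + h *: u, v)), h)) by continuity.
have {}c : ((q, (z + h *: u, v)), h) @[h --> (0 : R)] --> ((q, (z, v)), (0 : R)).
  by have := continuous_onT c (x := 0); rewrite /continuous_at scale0r addr0.
have {}A : \forall h \near (0 : R), S q ->
  `|g q (z + h *: u + h *: v) - g q (z + h *: u) - h *: dg q (z, v)| <= e / 2 * `|h| :=
  c _ A.
have /has_dirderivP/(_ _ e20) B := tg q z u Sq Wz.
near=> h.
have A' : `|g q (z + h *: u + h *: v) - g q (z + h *: u) - h *: dg q (z, v)|
    <= e / 2 * `|h| by move: Sq; near: h.
have B' : `|g q (z + h *: u) - g q z - h *: dg q (z, u)| <= e / 2 * `|h|.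
  by near: h.
have -> : z + h *: (u + v) = z + h *: u + h *: v by linear_identity R Z.
have -> : g q (z + h *: u + h *: v) - g q z - h *: (dg q (z, u) + dg q (z, v)) =
  (g q (z + h *: u + h *: v) - g q (z + h *: u) - h *: dg q (z, v)) +
  (g q (z + h *: u) - g q z - h *: dg q (z, u)) by linear_identity R H.
by apply: le_trans (ler_normD _ _) _; lra.
Unshelve. all: by end_near. Qed.

End StrictDerivative.

(** * Iterated tangents *)

(** Regularity by iterated tangents: the base point and the direction are
   differentiated together at the next step. The class is stable under the
   operations that the tangent of a differential equation involves. [Q] is a
   space of parameters, in the applications an interval of times. *)
Fixpoint tangent_smooth {R : realType} {Q : topologicalType} {H : normedModType R}
    (n : nat) {Z : tvsType R} (S : set Q) (W : set Z) (g : Q -> Z -> H) : Prop :=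
  continuous_on (S `*` W) (fun p => g p.1 p.2) /\
  if n is m.+1 then
    exists2 dg : Q -> Z * Z -> H, is_tangent S W g dg &
      tangent_smooth m S (W `*` setT) dg
  else True.

(** Regularity by iterated derivatives in frozen directions: a direction that has
   been used joins the parameters, and the base point alone is differentiated
   further. This is the form in which C^(r,s)-maps are given. *)
Fixpoint dir_smooth {R : realType} {Z : tvsType R} {H : normedModType R}
    (n : nat) {Q : topologicalType} (S : set Q) (W : set Z) (g : Q -> Z -> H) : Prop :=
  continuous_on (S `*` W) (fun p => g p.1 p.2) /\
  if n is m.+1 then
    exists2 dg : Q * Z -> Z -> H,
      is_tangent S W g (fun q p => dg (q, p.2) p.1) &
      dir_smooth m (S `*` setT) W dg
  else True.

Lemma tangent_smooth_continuous {R : realType} {Q : topologicalType}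
    {H : normedModType R} (n : nat) {Z : tvsType R} (S : set Q) (W : set Z)
    (g : Q -> Z -> H) :
  tangent_smooth n S W g -> continuous_on (S `*` W) (fun p => g p.1 p.2).
Proof. by case: n => [|n] []. Qed.

Lemma dir_smooth_continuous {R : realType} {Q : topologicalType}
    {H : normedModType R} (n : nat) {Z : tvsType R} (S : set Q) (W : set Z)
    (g : Q -> Z -> H) :
  dir_smooth n S W g -> continuous_on (S `*` W) (fun p => g p.1 p.2).
Proof. by case: n => [|n] []. Qed.

Lemma tangent_smooth_pred {R : realType} {Q : topologicalType}
    {H : normedModType R} (n : nat) {Z : tvsType R} (S : set Q) (W : set Z)
    (g : Q -> Z -> H) : tangent_smooth n.+1 S W g -> tangent_smooth n S W g.
Proof.
elim: n Z W g => [|n IHn] Z W g [cg [dg tg sdg]]; first by split.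
by split=> //; exists dg => //; exact: IHn.
Qed.

Lemma has_derivD_dir {R : realType} {Z : tvsType R} {H : normedModType R}
    (f g : Z -> H) z v l m : has_dirderiv f z v l -> has_dirderiv g z v m ->
  has_dirderiv (fun y => f y + g y) z v (l + m).
Proof. exact: has_derivD. Qed.

Lemma tangent_smoothD {R : realType} {Q : topologicalType}
    {H : normedModType R} (n : nat) {Z : tvsType R} (S : set Q) (W : set Z)
    (f g : Q -> Z -> H) : tangent_smooth n S W f -> tangent_smooth n S W g ->
  tangent_smooth n S W (fun q z => f q z + g q z).
Proof.
elim: n Z W f g => [|n IHn] Z W f g.
  by move=> [cf _] [cg _]; split=> //; apply: continuous_onD.
move=> [cf [df tf sdf]] [cg [dg tg sdg]]; split; first exact: continuous_onD.
exists (fun q z => df q z + dg q z); last exact: IHn.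
by move=> q z v Sq Wz; apply: has_derivD_dir; [exact: tf|exact: tg].
Qed.

Record continuous_linear {R : realType} {Z' Z : tvsType R} (l : Z' -> Z) : Prop :=
  ContinuousLinear {
    continuous_linear_continuous : continuous l;
    continuous_linear_line : forall z v (h : R), l (z + h *: v) = l z + h *: l v
  }.

Lemma continuous_linear_tangent {R : realType} {Z' Z : tvsType R} (l : Z' -> Z) :
  continuous_linear l ->
  continuous_linear (fun p : Z' * Z' => (l p.1, l p.2)).
Proof.
move=> [cl ll]; split; last by move=> z v h; rewrite /= !ll.
apply: continuous_onT; apply: continuous_on_pair.
  apply: (@continuous_on_comp _ _ _ _ setT fst l) => //.
    by continuity.
  exact: continuous_onW.
apply: (@continuous_on_comp _ _ _ _ setT snd l) => //.
  by continuity.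
exact: continuous_onW.
Qed.

(** The chain rule for an inner function that is linear in space and merely
   continuous in the parameter; the tangent of a linear map is linear again. *)
Lemma tangent_smooth_pullback {R : realType} {Q' Q : topologicalType}
    {H : normedModType R} (n : nat) {Z' Z : tvsType R} (S' : set Q') (S : set Q)
    (W' : set Z') (W : set Z) (k : Q' -> Q) (l : Z' -> Z) (g : Q -> Z -> H) :
  continuous_on S' k -> (forall q, S' q -> S (k q)) ->
  continuous_linear l -> (forall z, W' z -> W (l z)) ->
  tangent_smooth n S W g -> tangent_smooth n S' W' (fun q z => g (k q) (l z)).
Proof.
move=> ck kS; elim: n Z' Z W' W l g => [|n IHn] Z' Z W' W l g cl lW.
all: have cont : continuous_on (S `*` W) (fun p => g p.1 p.2) ->
    continuous_on (S' `*` W') (fun p => g (k p.1) (l p.2)).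
1,3: move=> cg; apply: (@continuous_on_comp _ _ _ _ (S `*` W)
    (fun p => (k p.1, l p.2)) (fun p => g p.1 p.2)) => //;
  [apply: continuous_on_pair;
    [apply: (@continuous_on_comp _ _ _ _ S' fst k) => //; [continuity|by move=> p []]
    |apply: (@continuous_on_comp _ _ _ _ setT snd l) => //; [continuity|]]
  |by move=> p [/kS Sp /lW Wp]]; by apply: continuous_onW; case: cl.
  by move=> [/cont].
move=> [/cont {}cont [dg tg sdg]]; split=> //.
exists (fun q p => dg (k q) (l p.1, l p.2)); last first.
  apply: IHn sdg; first exact: continuous_linear_tangent.
  by move=> p [/lW].
move=> q z v S'q W'z; have := tg (k q) (l z) (l v) (kS q S'q) (lW z W'z).
by rewrite /has_dirderiv /=; congr has_deriv; apply/funext => h; case: cl => _ ->.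
Qed.

Lemma norm_pair_le {R : realType} {H1 H2 : normedModType R} (x : H1) (y : H2) (K : R) :
  `|x| <= K -> `|y| <= K -> `|(x, y)| <= K.
Proof. by move=> xK yK; rewrite /Num.norm /= ge_max xK. Qed.

Lemma has_deriv_pair {R : realType} {H1 H2 : normedModType R} (f : R -> H1)
    (g : R -> H2) t l m : has_deriv f t l -> has_deriv g t m ->
  has_deriv (fun s => (f s, g s)) t (l, m).
Proof.
move=> hf hg e e0; near=> h; apply: norm_pair_le; near: h; [exact: hf|exact: hg].
Unshelve. all: by end_near. Qed.

Lemma tangent_smooth_pair {R : realType} {Q : topologicalType}
    {H1 H2 : normedModType R} (n : nat) {Z : tvsType R} (S : set Q) (W : set Z)
    (f : Q -> Z -> H1) (g : Q -> Z -> H2) :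
  tangent_smooth n S W f -> tangent_smooth n S W g ->
  tangent_smooth n S W (fun q z => (f q z, g q z)).
Proof.
elim: n Z W f g => [|n IHn] Z W f g.
  by move=> [cf _] [cg _]; split=> //; exact: continuous_on_pair.
move=> [cf [df tf sdf]] [cg [dg tg sdg]]; split; first exact: continuous_on_pair.
exists (fun q z => (df q z, dg q z)); last exact: IHn.
by move=> q z v Sq Wz; apply: has_deriv_pair; [exact: tf|exact: tg].
Qed.

Section Linearize.
Context {R : realType} {H : normedModType R} {Z' : tvsType R}.

(** A function that is smooth in [z] with a parameter [z'] on which it depends
   linearly is smooth in the pair [(z, z')]: its tangent is the sum of the tangent in [z] and
   the function itself in the direction of [z']. *)
Lemma tangent_smooth_linear_param (n : nat) {Q : topologicalType} {Z : tvsType R}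
    (S : set Q) (W : set Z) (e : Q * Z' -> Z -> H) :
  tangent_smooth n (S `*` setT) W e ->
  (forall q z u v, S q -> W z -> e (q, u + v) z = e (q, u) z + e (q, v) z) ->
  (forall q z (k : R) v, S q -> W z -> e (q, k *: v) z = k *: e (q, v) z) ->
  open W ->
  tangent_smooth n S (W `*` setT) (fun q (p : Z * Z') => e (q, p.2) p.1).
Proof.
elim: n Z W e => [|n IHn] Z W e.
all: have cont : continuous_on ((S `*` setT) `*` W) (fun p => e p.1 p.2) ->
    continuous_on (S `*` (W `*` setT)) (fun p => e (p.1, p.2.2) p.2.1).
1,3: move=> ce; apply: (@continuous_on_comp _ _ _ _ ((S `*` setT) `*` W)
    (fun p => ((p.1, p.2.2), p.2.1)) (fun p => e p.1 p.2)) => //;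
  [continuity|by move=> p [Sp [Wp _]]].
  by move=> [/cont].
move=> se eD eZ oW; have [ce [de te sde]] := se; split; first exact: cont.
have deD q z w u v : S q -> W z -> de (q, u + v) (z, w) = de (q, u) (z, w) + de (q, v) (z, w).
  move=> Sq Wz; apply: has_dirderiv_unique (te (q, u + v) z w _ Wz) _ => //.
  apply: has_dirderiv_near (has_derivD_dir (te (q, u) z w _ Wz) (te (q, v) z w _ Wz)) => //.
  by near=> y; rewrite eD//; near: y; exact: open_nbhs_nbhs.
have deZ q z w (k : R) v : S q -> W z -> de (q, k *: v) (z, w) = k *: de (q, v) (z, w).
  move=> Sq Wz; apply: has_dirderiv_unique (te (q, k *: v) z w _ Wz) _ => //.
  apply: has_dirderiv_near (has_derivZ k (te (q, v) z w _ Wz)) => //.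
  by near=> y; rewrite eZ//; near: y; exact: open_nbhs_nbhs.
exists (fun q p => de (q, p.1.2) (p.1.1, p.2.1) + e (q, p.2.2) p.1.1); last first.
  apply: tangent_smoothD.
    apply: (@tangent_smooth_pullback _ _ _ _ _ _ _ S S _ ((W `*` setT) `*` setT)
      id (fun p : (Z * Z') * (Z * Z') => ((p.1.1, p.2.1), p.1.2))
      (fun q p => de (q, p.2) p.1)) => //.
    - exact: continuous_on_id.
    - by split=> //; apply: continuous_onT; continuity.
    - apply: IHn => //.
      + by move=> q [z w] u v Sq [Wz _]; exact: deD.
      + by move=> q [z w] k v Sq [Wz _]; exact: deZ.
      + by apply: open_prod => //; exact: openT.
  apply: (@tangent_smooth_pullback _ _ _ _ _ _ _ S S _ (W `*` setT)
    id (fun p : (Z * Z') * (Z * Z') => (p.1.1, p.2.2))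
    (fun q p => e (q, p.2) p.1)) => //.
  - exact: continuous_on_id.
  - by split=> //; apply: continuous_onT; continuity.
  - by move=> p [[]].
  - by apply: IHn => //; exact: tangent_smooth_pred.
move=> q [z z'] [w w'] Sq [Wz _]; apply/has_dirderivP => eps eps0 /=.
have e20 : 0 < eps / 2 by rewrite divr_gt0.
have /has_dirderivP/(_ _ e20) A := te (q, z') z w (conj Sq I) Wz.
have near_W : \forall h \near (0 : R), W (z + h *: w).
  by apply: line_cvg; exact: open_nbhs_nbhs.
have B : \forall h \near (0 : R), W (z + h *: w) ->
    `|e (q, w') z - e (q, w') (z + h *: w)| <= eps / 2.
  have c : continuous_on W (fun y => e (q, w') y).
    apply: (@continuous_on_comp _ _ _ W ((S `*` setT) `*` W) (fun y => ((q, w'), y))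
      (fun p => e p.1 p.2)) => //; by continuity.
  have /cvgrPdist_le/(_ _ e20) C := c z Wz.
  have {}C : \forall y \near z, W y -> `|e (q, w') z - e (q, w') y| <= eps / 2 := C.
  exact: (@line_cvg _ _ z w _ C).
near=> h.
have Wh : W (z + h *: w) by near: h.
rewrite eD// eZ//.
have -> : e (q, z') (z + h *: w) + h *: e (q, w') (z + h *: w) - e (q, z') z -
    h *: (de (q, z') (z, w) + e (q, w') z) =
  (e (q, z') (z + h *: w) - e (q, z') z - h *: de (q, z') (z, w)) -
  h *: (e (q, w') z - e (q, w') (z + h *: w)) by linear_identity R H.
apply: le_trans (ler_normB _ _) _; rewrite normrZ [eps]splitr mulrDl lerD//.
  by near: h.
rewrite mulrC ler_wpM2r//; move: Wh; by near: h.
Unshelve. all: by end_near. Qed.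

End Linearize.

(** Iterating the directional derivative with frozen directions gives functions
   that are linear in each direction, so the directions can be freed one by one. *)
Lemma dir_smooth_tangent_smooth {R : realType} {Z : tvsType R} {H : normedModType R}
    (n : nat) {Q : topologicalType} (S : set Q) (W : set Z) (g : Q -> Z -> H) :
  open W -> dir_smooth n S W g -> tangent_smooth n S W g.
Proof.
move=> oW; elim: n Q S g => [|n IHn] Q S g; first by case.
move=> [cg [dg tg sdg]]; split=> //; exists (fun q p => dg (q, p.2) p.1) => //.
have cdg : continuous_on (S `*` (W `*` setT)) (fun p => dg (p.1, p.2.2) p.2.1).
  apply: (@continuous_on_comp _ _ _ _ ((S `*` setT) `*` W)
    (fun p => ((p.1, p.2.2), p.2.1)) (fun p => dg p.1 p.2)) => //.
  - by continuity.
  - exact: dir_smooth_continuous sdg.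
  - by move=> p [Sp [Wp _]].
apply: tangent_smooth_linear_param => //; first exact: IHn.
- by move=> q z u v Sq Wz; exact: (is_tangentD u v oW tg cdg Sq Wz).
- by move=> q z k v Sq Wz; exact: (is_tangentZ v k tg Sq Wz).
Qed.

(** * Joint regularity in time and space *)

(** Differentiability in time is confined to the interior: at an end point of [J] a
   C^(r,s)-map only has continuous extensions of its derivatives. *)
Definition is_time_derivative {R : realType} {Z : Type} {H : normedModType R}
    (J : set R) (W : set Z) (g dg : R -> Z -> H) :=
  forall t z, J° t -> W z -> has_deriv (g^~ z) t (dg t z).

Fixpoint time_smooth {R : realType} {Z : topologicalType} {H : normedModType R}
    (r : nat) (J : set R) (W : set Z) (g : R -> Z -> H) : Prop :=
  continuous_on (J `*` W) (fun p => g p.1 p.2) /\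
  if r is r'.+1 then
    exists2 g', is_time_derivative J W g g' & time_smooth r' J W g'
  else True.

(** The regularity of a right-hand side: time derivatives first, with iterated
   tangents of each of them. *)
Fixpoint mixed_smooth {R : realType} {Z : tvsType R} {H : normedModType R}
    (r k : nat) (J : set R) (W : set Z) (g : R -> Z -> H) : Prop :=
  tangent_smooth k J W g /\
  if r is r'.+1 then
    exists2 g', is_time_derivative J W g g' & mixed_smooth r' k J W g'
  else True.

(** The regularity of a flow: iterated tangents first, with time derivatives of
   each of them. Space derivatives come first because they are the solutions of
   differential equations, from which their time derivatives are read off. *)
Fixpoint flow_smooth {R : realType} {H : normedModType R} (r s : nat)
    {Z : tvsType R} (J : set R) (W : set Z) (g : R -> Z -> H) : Prop :=
  time_smooth r J W g /\
  if s is s'.+1 then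
    exists2 dg, is_tangent J W g dg & flow_smooth r s' J (W `*` setT) dg
  else True.

Lemma time_smooth_continuous {R : realType} {Z : topologicalType}
    {H : normedModType R} (r : nat) (J : set R) (W : set Z) (g : R -> Z -> H) :
  time_smooth r J W g -> continuous_on (J `*` W) (fun p => g p.1 p.2).
Proof. by case: r => [|r] []. Qed.

Lemma time_smooth_pred {R : realType} {Z : topologicalType}
    {H : normedModType R} (r : nat) (J : set R) (W : set Z) (g : R -> Z -> H) :
  time_smooth r.+1 J W g -> time_smooth r J W g.
Proof.
elim: r g => [|r IHr] g [cg [g' dg sg']]; first by split.
by split=> //; exists g' => //; exact: IHr.
Qed.

Lemma mixed_smooth_tangent {R : realType} {Z : tvsType R} {H : normedModType R}
    (r k : nat) (J : set R) (W : set Z) (g : R -> Z -> H) :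
  mixed_smooth r k J W g -> tangent_smooth k J W g.
Proof. by case: r => [|r] []. Qed.

Lemma mixed_smooth_pred {R : realType} {Z : tvsType R} {H : normedModType R}
    (r k : nat) (J : set R) (W : set Z) (g : R -> Z -> H) :
  mixed_smooth r.+1 k J W g -> mixed_smooth r k J W g.
Proof.
elim: r g => [|r IHr] g [cg [g' dg sg']]; first by split.
by split=> //; exists g' => //; exact: IHr.
Qed.

Lemma time_smoothD {R : realType} {Z : topologicalType} {H : normedModType R}
    (r : nat) (J : set R) (W : set Z) (f g : R -> Z -> H) :
  time_smooth r J W f -> time_smooth r J W g ->
  time_smooth r J W (fun t z => f t z + g t z).
Proof.
elim: r f g => [|r IHr] f g.
  by move=> [cf _] [cg _]; split=> //; exact: continuous_onD.
move=> [cf [f' df sf]] [cg [g' dg sg]]; split; first exact: continuous_onD.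
exists (fun t z => f' t z + g' t z); last exact: IHr.
by move=> t z Jt Wz; apply: has_derivD; [exact: df|exact: dg].
Qed.

Lemma time_smooth_pair {R : realType} {Z : topologicalType}
    {H1 H2 : normedModType R} (r : nat) (J : set R) (W : set Z)
    (f : R -> Z -> H1) (g : R -> Z -> H2) :
  time_smooth r J W f -> time_smooth r J W g ->
  time_smooth r J W (fun t z => (f t z, g t z)).
Proof.
elim: r f g => [|r IHr] f g.
  by move=> [cf _] [cg _]; split=> //; exact: continuous_on_pair.
move=> [cf [f' df sf]] [cg [g' dg sg]]; split; first exact: continuous_on_pair.
exists (fun t z => (f' t z, g' t z)); last exact: IHr.
by move=> t z Jt Wz; apply: has_deriv_pair; [exact: df|exact: dg].
Qed.

Lemma mixed_smooth_pair {R : realType} {Z : tvsType R}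
    {H1 H2 : normedModType R} (r k : nat) (J : set R) (W : set Z)
    (f : R -> Z -> H1) (g : R -> Z -> H2) :
  mixed_smooth r k J W f -> mixed_smooth r k J W g ->
  mixed_smooth r k J W (fun t z => (f t z, g t z)).
Proof.
elim: r f g => [|r IHr] f g.
  by move=> [cf _] [cg _]; split=> //; exact: tangent_smooth_pair.
move=> [cf [f' df sf]] [cg [g' dg sg]]; split; first exact: tangent_smooth_pair.
exists (fun t z => (f' t z, g' t z)); last exact: IHr.
by move=> t z Jt Wz; apply: has_deriv_pair; [exact: df|exact: dg].
Qed.

Lemma mixed_smooth_pullback {R : realType} {H : normedModType R} (r k : nat)
    {Z' Z : tvsType R} (J' J : set R) (W' : set Z') (W : set Z) (l : Z' -> Z)
    (g : R -> Z -> H) :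
  J' `<=` J -> continuous_linear l -> (forall z, W' z -> W (l z)) ->
  mixed_smooth r k J W g -> mixed_smooth r k J' W' (fun t z => g t (l z)).
Proof.
move=> J'J cl lW.
have pull (h : R -> Z -> H) : tangent_smooth k J W h ->
    tangent_smooth k J' W' (fun t z => h t (l z)).
  move=> sh; exact (@tangent_smooth_pullback _ _ _ _ _ _ _ J' J W' W id l h
    (@continuous_on_id _ J') J'J cl lW sh).
elim: r g => [|r IHr] g; first by move=> [/pull ? _]; split.
move=> [/pull sg [g' dg sg']]; split=> //.
exists (fun t z => g' t (l z)); last exact: IHr.
by move=> t z Jt Wz; apply: dg; [exact: interiorS Jt|exact: lW].
Qed.

(** The time derivatives of the tangent are the tangents of the time
   derivatives, by the equality of mixed partial derivatives. *)
Lemma mixed_smooth_has_tangent {R : realType} {Z : tvsType R} {H : normedModType R}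
    (r k : nat) (J : set R) (W : set Z) (g : R -> Z -> H) :
  open W -> mixed_smooth r k.+1 J W g ->
  exists2 dg, is_tangent J W g dg & mixed_smooth r k J (W `*` setT) dg.
Proof.
move=> oW; elim: r g => [|r IHr] g.
  by move=> [[_ [dg tg sdg]] _]; exists dg => //; split.
move=> [[_ [dg tg sdg]] [g' g'P /IHr[dg' tg' sdg']]].
exists dg => //; split=> //; exists dg' => //.
move=> t [z v] Jt [Wz _].
have cdg' := tangent_smooth_continuous (mixed_smooth_tangent sdg').
have near_JW : \forall p \near (t, 0 : R), J° p.1 /\ W (z + p.2 *: v).
  exists (J°, [set h | W (z + h *: v)]) => //=; split=> /=.
    by apply: open_nbhs_nbhs; split=> //; exact: open_interior.
  by apply: line_cvg; exact: open_nbhs_nbhs.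
have := @schwarz R H (fun s h => g s (z + h *: v)) (fun s h => g' s (z + h *: v))
  (fun s h => dg' s (z + h *: v, v)) (fun s => dg s (z, v)) t 0.
rewrite scale0r addr0; apply.
- apply: filterS near_JW => -[s h] /= [Js Wh]; split; first exact: g'P.
  by apply: has_dirderiv_shift; apply: tg' => //; exact: interior_subset Js.
- pose A := [set p : R * R | J p.1 /\ W (z + p.2 *: v)].
  have c : continuous_on A (fun p => dg' p.1 (z + p.2 *: v, v)).
    apply: (@continuous_on_comp _ _ _ A (J `*` (W `*` setT))
      (fun p => (p.1, (z + p.2 *: v, v))) (fun p => dg' p.1 p.2)) => //.
    by continuity.
    by move=> p [].
  move=> P nP.
  have At : A (t, 0) by split; [exact: interior_subset Jt|rewrite scale0r addr0].
  have : \forall p \near (t, 0 : R), A p -> P (dg' p.1 (z + p.2 *: v, v)) := c _ At P nP.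
  apply: filter_app; apply: filterS near_JW => p [Jp Wp]; apply; split=> //.
  exact: interior_subset Jp.
- near=> s; have := tg s z v _ Wz; apply; near: s.
  exact: Jt.
Unshelve. all: by end_near. Qed.

Section ChainRule.
Context {R : realType} {E' H : normedModType R} {Z' : tvsType R}.

(** The chain rule along a curve. The difference quotients of [c] are used as
   directions in [strict_dirderiv], which is uniform in them. *)
Lemma has_deriv_along (J : set R) (W : set (E' * Z')) (h h' : R -> E' * Z' -> H) dh
    (c : R -> E') (c' : E') (y : Z') (t : R) :
  open W -> is_time_derivative J W h h' -> is_tangent J W h dh ->
  continuous_on (J `*` (W `*` setT)) (fun p => dh p.1 p.2) ->
  J° t -> W (c t, y) -> has_deriv c t c' ->
  has_deriv (fun s => h s (c s, y)) t (h' t (c t, y) + dh t ((c t, y), (c', 0))).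
Proof.
move=> oW dht tg cdh Jt Wt dc; apply/has_derivP => e e0.
have e20 : 0 < e / 2 by rewrite divr_gt0.
have Jt' : J t by exact: interior_subset Jt.
have strict := strict_dirderiv (c', 0 : Z') (@subset_refl _ J) oW tg cdh Jt' Wt e20.
pose v s := if s == t then c' else (s - t)^-1 *: (c s - c t).
have cv s : c s = c t + (s - t) *: v s.
  rewrite /v; case: eqVneq => [->|st]; first by rewrite subrr scale0r addr0.
  by rewrite scalerA divff ?subr_eq0// scale1r addrC subrK.
have v_lim : v s @[s --> t] --> c'.
  apply/cvgrPdist_le => eps eps0; have /has_derivP/(_ _ eps0)[d d0 dP] := dc.
  apply/near_realP; exists d => // s sd; rewrite /v.
  case: eqVneq => [_|st]; first by rewrite subrr normr0 ltW.
  have st0 : 0 < `|s - t| by rewrite normr_gt0 subr_eq0.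
  rewrite -(ler_pM2l st0) -normrZ scalerBr scalerA divff ?subr_eq0// scale1r.
  by rewrite -normrN opprB mulrC; exact: dP.
have strict_t : \forall s \near t, J s ->
   `|h s (c s, y) - h s (c t, y) - (s - t) *: dh t ((c t, y), (c', 0))|
     <= e / 2 * `|s - t|.
  have lim : ((s, ((c t, y), (v s, 0 : Z'))), s - t) @[s --> t] -->
      ((t, ((c t, y), (c', 0 : Z'))), (0 : R)).
    apply: cvg_to_pair; last first.
      apply/cvgrPdist_le => eps eps0; apply/near_realP; exists eps => // s /ltW.
      by rewrite sub0r normrN.
    apply: cvg_to_pair; first exact: cvg_id.
    apply: cvg_to_pair; first exact: cvg_cst.
    by apply: cvg_to_pair; [exact: v_lim|exact: cvg_cst].
  have {}strict : \forall s \near t, J s ->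
    `|h s ((c t, y) + (s - t) *: (v s, 0 : Z')) - h s (c t, y) -
      (s - t) *: dh t ((c t, y), (c', 0))| <= e / 2 * `|s - t| := lim _ strict.
  apply: filterS strict => s /[apply].
  have -> : (c t, y) + (s - t) *: (v s, 0 : Z') = (c s, y) :> E' * Z' => //.
  by rewrite (cv s); congr (_, _); rewrite /= scaler0 addr0.
have near_J : \forall s \near t, J s by exact: Jt.
have {near_J}strict_t : \forall s \near t,
   `|h s (c s, y) - h s (c t, y) - (s - t) *: dh t ((c t, y), (c', 0))|
     <= e / 2 * `|s - t| by apply: filterS2 near_J strict_t => s Js; exact.
have /has_derivP/(_ _ e20)[d d0 dP] := dht t (c t, y) Jt Wt.
have /near_realP[d' d'0 d'P] := strict_t.
exists (Num.min d d'); first by rewrite lt_min d0.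
move=> s; rewrite lt_min => /andP[/dP A /d'P B].
have -> : h s (c s, y) - h t (c t, y) -
    (s - t) *: (h' t (c t, y) + dh t ((c t, y), (c', 0))) =
  (h s (c t, y) - h t (c t, y) - (s - t) *: h' t (c t, y)) +
  (h s (c s, y) - h s (c t, y) - (s - t) *: dh t ((c t, y), (c', 0))).
  by linear_identity R H.
by apply: le_trans (ler_normD _ _) _; lra.
Qed.

Lemma continuous_linear_lift_zero :
  continuous_linear (fun p : (E' * E') * Z' => ((p.1.1, p.2), (p.1.2, 0 : Z'))).
Proof.
split; first by apply: continuous_onT; continuity.
by move=> [[x y] z] [[x' y'] z'] s; congr ((_, _), (_, _)); rewrite /= scaler0 addr0.
Qed.

End ChainRule.

(** Composition with a curve: each time derivative of [h t (c t z, z)] costs one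
   time derivative of [h] or one tangent of [h] and one time derivative of the
   curve, which is why only the total order of [h] matters. *)
Lemma time_smooth_comp {R : realType} {E' H : normedModType R} {Z0 : topologicalType}
    {Z' : tvsType R} (r k : nat) (J : set R) (W : set (E' * Z')) (N : set Z0)
    (h : R -> E' * Z' -> H) (c : R -> Z0 -> E') (l : Z0 -> Z') :
  (r <= k)%N -> open W -> mixed_smooth r k J W h -> time_smooth r J N c ->
  continuous l -> (forall t z, J t -> N z -> W (c t z, l z)) ->
  time_smooth r J N (fun t z => h t (c t z, l z)).
Proof.
elim: r k E' W h c => [|r IHr] k E' W h c rk oW sh sc cl cW.
all: have ch := tangent_smooth_continuous (mixed_smooth_tangent sh).
all: have cont : continuous_on (J `*` N) (fun p => h p.1 (c p.1 p.2, l p.2)).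
1,3: apply: (@continuous_on_comp _ _ _ _ (J `*` W) (fun p => (p.1, (c p.1 p.2, l p.2)))
    (fun p => h p.1 p.2)) => //; last by move=> p [Jp Np]; split=> //; exact: cW.
1,2: have cc := time_smooth_continuous sc.
1,2: apply: continuous_on_pair; first by continuity.
1,2: apply: continuous_on_pair; first by [].
1,2: apply: (@continuous_on_comp _ _ _ _ setT snd l) => //; first by continuity.
1,2: exact: continuous_onW.
  by split.
case: k rk sh => // k; rewrite ltnS => rk sh.
have [dh tg sdh] := mixed_smooth_has_tangent oW sh.
have [_ [h' dht sh']] := sh; have [_ [c' dct sc']] := sc.
split=> //.
exists (fun t z => h' t (c t z, l z) + dh t ((c t z, l z), (c' t z, 0))).
  move=> t z Jt Nz; apply: (has_deriv_along oW dht tg) => //.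
  - exact: tangent_smooth_continuous (mixed_smooth_tangent sdh).
  - by apply: cW => //; exact: interior_subset Jt.
  - exact: dct.
apply: time_smoothD.
  by apply: (IHr k.+1 _ W h' c) => //; [exact: leqW|exact: time_smooth_pred].
apply: (IHr k _ ([set p | W (p.1.1, p.2)])
  (fun t (p : (E' * E') * Z') => dh t ((p.1.1, p.2), (p.1.2, 0)))
  (fun t z => (c t z, c' t z))) => //.
- have cp : continuous (fun p : (E' * E') * Z' => (p.1.1, p.2)).
    by apply: continuous_onT; continuity.
  by apply: open_comp => // p _; exact: cp.
- apply: (mixed_smooth_pullback (@subset_refl _ J) continuous_linear_lift_zero).
    2: exact: mixed_smooth_pred sdh.
  by move=> p Wp; split.
- by apply: time_smooth_pair => //; exact: time_smooth_pred.
Qed.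

Section Projection.
Context {R : realType} {H1 H2 : normedModType R}.

Lemma has_deriv_snd (f : R -> H1 * H2) t l :
  has_deriv f t l -> has_deriv (fun s => (f s).2) t l.2.
Proof.
move=> hf e e0; near=> h.
have : `|f (t + h) - f t - h *: l| <= e * `|h| by near: h; exact: hf.
by apply: le_trans; rewrite {2}/Num.norm /= le_max lexx orbT.
Unshelve. all: by end_near. Qed.

Lemma time_smooth_snd {Z : topologicalType} (r : nat) (J : set R) (W : set Z)
    (g : R -> Z -> H1 * H2) :
  time_smooth r J W g -> time_smooth r J W (fun t z => (g t z).2).
Proof.
elim: r g => [|r IHr] g; first by move=> [cg _]; split=> //; continuity.
move=> [cg [g' dg sg']]; split; first by continuity.
exists (fun t z => (g' t z).2); last exact: IHr.
by move=> t z Jt Wz; apply: (@has_deriv_snd (g^~ z)); exact: dg.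
Qed.

Lemma flow_smooth_snd {Z : tvsType R} (r s : nat) (J : set R) (W : set Z)
    (g : R -> Z -> H1 * H2) :
  flow_smooth r s J W g -> flow_smooth r s J W (fun t z => (g t z).2).
Proof.
elim: s Z W g => [|s IHs] Z W g; first by move=> [/time_smooth_snd ? _]; split.
move=> [/time_smooth_snd sg [dg tg sdg]]; split=> //.
exists (fun t p => (dg t p).2); last exact: IHs.
by move=> t z v Jt Wz; apply: (@has_deriv_snd (fun h => g t (z + h *: v))); exact: tg.
Qed.

End Projection.

(** * Completeness of products *)

HB.saturate (prod _ _).

(** The tangent equation of an equation in [E] lives in [E * E], so Banach spaces
   have to be closed under products. *)
Lemma prod_cauchy_cvg (R : realType) (E1 E2 : completeNormedModType R)
    (F : set_system ((E1 * E2)%type : puniformType)) :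
  ProperFilter F -> cauchy F -> [cvg F in ((E1 * E2)%type : puniformType)].
Proof.
move=> FF Fc.
have c1 : [cvg (fst @ F) in E1].
  apply: cauchy_cvg => A eA.
  have [|[B1 B2] /= [FB1 FB2] B12] :=
      Fc [set p : (E1 * E2) * (E1 * E2) | A (p.1.1, p.2.1)].
    exists (A, setT) => /=; last by move=> [[x x'] [y y']] [/= Ax _]; exists ((x, y), (x', y')).
    by split=> //; exact: filterT.
  exists ([set x | exists y, B1 (x, y)], [set x | exists y, B2 (x, y)]) => /=.
    split; [apply: filterS FB1|apply: filterS FB2] => -[x y] ?; by exists y.
  by move=> [x x'] /= [[y B1x] [y' B2x]]; exact: (B12 ((x, y), (x', y'))).
have c2 : [cvg (snd @ F) in E2].
  apply: cauchy_cvg => A eA.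
  have [|[B1 B2] /= [FB1 FB2] B12] :=
      Fc [set p : (E1 * E2) * (E1 * E2) | A (p.1.2, p.2.2)].
    exists (setT, A) => /=; last by move=> [[x x'] [y y']] [_ /= Ay]; exists ((x, y), (x', y')).
    by split=> //; exact: filterT.
  exists ([set y | exists x, B1 (x, y)], [set y | exists x, B2 (x, y)]) => /=.
    split; [apply: filterS FB1|apply: filterS FB2] => -[x y] ?; by exists x.
  by move=> [y y'] /= [[x B1x] [x' B2x]]; exact: (B12 ((x, y), (x', y'))).
apply/cvg_ex; exists (lim (fst @ F), lim (snd @ F)).
have -> : F = (fun p => (p.1, p.2)) @ F.
  apply/funext => A; rewrite /fmap /=; congr F; apply/funext => -[x y] //.
exact: cvg_to_pair.
Qed.

HB.instance Definition _ (R : realType) (E1 E2 : completeNormedModType R) :=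
  Uniform_isComplete.Build (E1 * E2)%type (@prod_cauchy_cvg R E1 E2).

(** * Compactness in time and local Lipschitz conditions *)

Section Tube.
Context {R : realType}.

(** Finitely many of the neighbourhoods in time cover the compact interval; the
   corresponding neighbourhoods of the data have a common part. *)
Lemma tube {A : Type} (F : set_system A) (a b : R) (P : R -> A -> Prop) :
  Filter F ->
  (forall t, a <= t <= b -> \forall t' \near t & x \near F,
     a <= t' <= b -> P t' x) ->
  \forall x \near F, forall t, a <= t <= b -> P t x.
Proof.
move=> FF HP.
have /near_covering_withinP cover := iffLR (compact_near_coveringP _) (@segment_compact R a b).
have : \forall x \near F, `[a, b]%classic `<=` (P^~ x).
  apply: cover => t; rewrite /= in_itv /= => tI.
  by apply: filterS (HP t tI) => -[t' x] /=; rewrite in_itv.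
by apply: filterS => x xP t tI; apply: xP; rewrite /= in_itv.
Qed.

Definition locally_lipschitz {E : normedModType R} {Z : topologicalType}
    (J : set R) (W : set (E * Z)) (f : R -> E * Z -> E) :=
  forall t x z, J t -> W (x, z) -> exists L : R,
    \forall p \near (t, ((x, x), z)), J p.1 ->
      `|f p.1 (p.2.1.1, p.2.2) - f p.1 (p.2.1.2, p.2.2)| <= L * `|p.2.1.1 - p.2.1.2|.

(** Strict differentiability at the zero direction bounds the increments of [f]
   by the step length; the step is chosen proportional to the distance. *)
Lemma tangent_smooth_lipschitz {E : normedModType R} {Z : tvsType R}
    (J : set R) (W : set (E * Z)) (f : R -> E * Z -> E) :
  open W -> tangent_smooth 1 J W f -> locally_lipschitz J W f.
Proof.
move=> oW [cf [df tg [cdf _]]] t x z Jt Wxz.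
have strict := strict_dirderiv ((0 : E), (0 : Z)) (@subset_refl _ J) oW tg cdf Jt Wxz ltr01.
have df0 : df t ((x, z), (0, 0)) = 0.
  by have := is_tangentZ 0 0 tg Jt Wxz; rewrite !scale0r.
have [[A B] /= [[[A1 A23] /= [nA1 nA23] A123] nB] AB] := strict.
have [[A2 A3] /= [nA2 nA3] A23P] := nA23.
have [[V1 V2] /= [nV1 nV2] V12] := nA3.
have /nbhs_ballP[d1 /= d10 d1P] := nV1.
have /near_realP[d2 d20 d2P] := nB.
have V20 : V2 0 by exact: nbhs_singleton.
pose d := Num.min d1 d2.
have d0 : 0 < d by rewrite lt_min d10.
have dd1 : d <= d1 by rewrite ge_min lexx.
have dd2 : d <= d2 by rewrite ge_min lexx orbT.
exists (2 / d).
have [[U1 U2] /= [nU1 nU2] U12] := nA2.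
have near_d : \forall p \near (t, ((x, x), z)), `|p.2.1.1 - p.2.1.2| < d ^+ 2 / 2.
  have c : continuous_on setT (fun p : R * ((E * E) * Z) => `|p.2.1.1 - p.2.1.2|).
    apply: (@continuous_on_comp _ _ _ setT setT
      (fun p : R * ((E * E) * Z) => p.2.1.1 - p.2.1.2) (fun y => `|y|)) => //.
      apply: continuous_onD; first by continuity.
      apply: (@continuous_on_comp _ _ _ setT setT
        (fun p : R * ((E * E) * Z) => p.2.1.2) (fun y => - y)) => //.
        by continuity.
      by apply: continuous_onW; exact: opp_continuous.
    by apply: continuous_onW; exact: norm_continuous.
  have := continuous_onT c (x := (t, ((x, x), z))).
  rewrite /continuous_at /= subrr normr0 => /cvgr_lt; apply.
  by rewrite divr_gt0// exprn_gt0.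
have near_U : \forall p \near (t, ((x, x), z)), [/\ A1 p.1, U1 p.2.1.2 & U2 p.2.2].
  exists (A1, [set q | U1 q.1.2 /\ U2 q.2]) => /=; last by move=> [t' [[x1 x2] z']] [? []].
  split=> //; exists (setT `*` U1, U2) => /=; last by move=> [[x1 x2] z'] [[]].
  split=> //; exists (setT, U1) => //; split=> //; exact: filterT.
apply: filterS (filterI near_d near_U) => -[t' [[x1 x2] z']] /= [x12 [At' Ux Uz]] Jt'.
have [->|x1x2] := eqVneq x1 x2; first by rewrite !subrr !normr0 mulr0.
have n0 : 0 < `|x1 - x2| by rewrite normr_gt0 subr_eq0.
(* The direction then has norm [d / 2], and the step is proportional to the
   distance of the two points. *)
pose h := 2 * `|x1 - x2| / d.
have h0 : 0 < h by rewrite divr_gt0// mulr_gt0.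
have hd : h < d by rewrite /h ltr_pdivrMr//; move: x12; rewrite expr2; lra.
pose v : E * Z := (h^-1 *: (x1 - x2), 0).
have V1v : V1 v.1.
  apply: d1P; rewrite -ball_normE /= sub0r normrN normrZ gtr0_norm ?invr_gt0//.
  have -> : h^-1 * `|x1 - x2| = d / 2.
    by rewrite /h; field; rewrite ?gt_eqF.
  lra.
have Bh : B h by apply: d2P; rewrite subr0 gtr0_norm//; lra.
have V2v : V2 v.2 by exact: V20.
have {}AB := AB ((t', ((x2, z'), v)), h) (conj (A123 (t', ((x2, z'), v))
  (conj At' (A23P ((x2, z'), v) (conj (U12 (x2, z') (conj Ux Uz))
    (V12 v (conj V1v V2v)))))) Bh) Jt'.
have E12 : (x2, z') + h *: v = (x1, z') :> E * Z.
  rewrite /v; congr (_, _) => /=; last by rewrite scaler0 addr0.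
  by rewrite scalerA divff ?gt_eqF// scale1r addrC subrK.
have {AB} : `|f t' ((x2, z') + h *: v) - f t' (x2, z') - h *: df t ((x, z), (0, 0))|
    <= 1 * `|h| := AB.
by rewrite E12 df0 scaler0 subr0 mul1r gtr0_norm// /h mulrAC.
Qed.

End Tube.

(** * Stability and uniqueness of solutions *)

Section SolutionEstimates.
Context {R : realType} {E : normedModType R} {Z : topologicalType}.
Variables (a b : R) (W : set (E * Z)) (f : R -> E * Z -> E).
Hypotheses (oW : open W)
  (cf : continuous_on (`[a, b] `*` W) (fun p => f p.1 p.2)).

(** The derivative is two-sided and asked at inner times only; at the end points
   continuity suffices. *)
Definition solves (z : Z) (x : R -> E) :=
  [/\ continuous_on `[a, b] x, forall t, a <= t <= b -> W (x t, z) &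
      forall t, a < t < b -> has_deriv x t (f t (x t, z))].

Let near_graph (x : R -> E) (z : Z) : continuous_on `[a, b] x ->
  (forall t, a <= t <= b -> W (x t, z)) ->
  forall t, a <= t <= b ->
    \forall p \near (t, ((0 : E), z)), a <= p.1 <= b -> W (x p.1 + p.2.1, p.2.2).
Proof.
move=> cx Wx t tI.
have c : continuous_on (`[a, b] `*` setT)
    (fun p : R * (E * Z) => (x p.1 + p.2.1, p.2.2)).
  apply: continuous_on_pair; last by continuity.
  apply: continuous_onD; last by continuity.
  apply: (@continuous_on_comp _ _ _ _ `[a, b] fst x) => //; first by continuity.
  by move=> p [].
have tI' : (`[a, b] `*` setT) (t, ((0 : E), z)) by split; rewrite //= in_itv.
have WN : nbhs (x t + 0, z) W by apply: open_nbhs_nbhs; split=> //; rewrite addr0; exact: Wx.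
have {WN} : \forall p \near (t, ((0 : E), z)), (`[a, b] `*` setT) p -> W (x p.1 + p.2.1, p.2.2) := c _ tI' W WN.
apply: filterS => p pW pI; apply: pW.
by split; rewrite //= in_itv.
Qed.

(** Here [Z] has no norm: uniformity in time comes from the compactness of
   [[a, b]]. *)
Lemma near_solution (x : R -> E) (z : Z) : continuous_on `[a, b] x ->
  (forall t, a <= t <= b -> W (x t, z)) -> forall e, 0 < e ->
  \forall y \near z, forall t, a <= t <= b ->
    W (x t, y) /\ `|f t (x t, y) - f t (x t, z)| <= e.
Proof.
move=> cx Wx e e0; apply: tube => t tI.
pose A := [set p : R * Z | a <= p.1 <= b /\ W (x p.1, p.2)].
have near_A : \forall p \near (t, z), a <= p.1 <= b -> W (x p.1, p.2).
  have c : continuous_on setT (fun p : R * Z => (p.1, ((0 : E), p.2))) by continuity.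
  have : \forall p \near (t, z), a <= p.1 <= b -> W (x p.1 + 0, p.2) :=
    @continuous_onT _ _ _ c (t, z) _ (near_graph cx Wx tI).
  by apply: filterS => p; rewrite addr0.
have cxA (g : R * Z -> Z) : continuous_on A g ->
    (forall p, A p -> W (x p.1, g p)) ->
    continuous_on A (fun p => f p.1 (x p.1, g p)).
  move=> cg Wg; apply: (@continuous_on_comp _ _ _ A (`[a, b] `*` W)
    (fun p => (p.1, (x p.1, g p))) (fun p => f p.1 p.2)) => //.
    apply: continuous_on_pair; first by continuity.
    apply: continuous_on_pair => //.
    apply: (@continuous_on_comp _ _ _ A `[a, b] fst x) => //; first by continuity.
    by move=> p []; rewrite /= in_itv.
  by move=> p Ap; split; [case: Ap; rewrite /= in_itv|exact: Wg].
have c1 : continuous_on A (fun p => f p.1 (x p.1, p.2)).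
  by apply: cxA; [continuity|move=> p []].
have c2 : continuous_on A (fun p => f p.1 (x p.1, z)).
  by apply: cxA; [continuity|move=> p [/Wx]].
have At : A (t, z) by split=> //; exact: Wx.
have e20 : 0 < e / 2 by rewrite divr_gt0.
have n1 : \forall p \near (t, z), A p ->
    `|f t (x t, z) - f p.1 (x p.1, p.2)| <= e / 2.
  by have /cvgrPdist_le/(_ _ e20) := c1 _ At.
have n2 : \forall p \near (t, z), A p ->
    `|f t (x t, z) - f p.1 (x p.1, z)| <= e / 2.
  by have /cvgrPdist_le/(_ _ e20) := c2 _ At.
suff : \forall p \near (t, z), a <= p.1 <= b ->
   W (x p.1, p.2) /\ `|f p.1 (x p.1, p.2) - f p.1 (x p.1, z)| <= e by [].
apply: filterS (filterI near_A (filterI n1 n2)) => p [Ap [p1 p2]] pI.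
have {}Ap := Ap pI; split=> //.
have -> : f p.1 (x p.1, p.2) - f p.1 (x p.1, z) =
   (f t (x t, z) - f p.1 (x p.1, z)) - (f t (x t, z) - f p.1 (x p.1, p.2)).
  by linear_identity R E.
apply: le_trans (ler_normB _ _) _.
by rewrite [e]splitr lerD; [|exact: p2|exact: p1].
Qed.

(** The local Lipschitz constants along a compact curve have a common bound. *)
Lemma lipschitz_tube (x : R -> E) (z : Z) : locally_lipschitz `[a, b] W f ->
  continuous_on `[a, b] x -> (forall t, a <= t <= b -> W (x t, z)) ->
  exists L rho : R, [/\ 0 <= L, 0 < rho & \forall y \near z, forall t e e',
    a <= t <= b -> `|e| <= rho -> `|e'| <= rho ->
    W (x t + e, y) /\
    `|f t (x t + e, y) - f t (x t + e', y)| <= L * `|e - e'| ].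
Proof.
move=> lip cx Wx.
pose P (t : R) (q : R * ((E * E) * Z)) := W (x t + q.2.1.1, q.2.2) /\
  `|f t (x t + q.2.1.1, q.2.2) - f t (x t + q.2.1.2, q.2.2)|
    <= q.1 * `|q.2.1.1 - q.2.1.2|.
have : \forall q \near filter_prod (pinfty_nbhs R) (nbhs (((0 : E), (0 : E)), z)),
    forall t, a <= t <= b -> P t q.
  apply: tube => t tI.
  have tI' : `[a, b]%classic t by rewrite /= in_itv.
  have [L LP] := lip t (x t) z tI' (Wx t tI).
  have c : continuous_on (`[a, b] `*` setT) (fun p : R * ((E * E) * Z) =>
      (p.1, ((x p.1 + p.2.1.1, x p.1 + p.2.1.2), p.2.2))).
    have cx1 : continuous_on (`[a, b] `*` setT) (fun p : R * ((E * E) * Z) => x p.1).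
      apply: (@continuous_on_comp _ _ _ _ `[a, b] fst x) => //; first by continuity.
      by move=> p [].
    by continuity.
  have n1 : \forall p \near (t, (((0 : E), (0 : E)), z)), a <= p.1 <= b ->
    `|f p.1 (x p.1 + p.2.1.1, p.2.2) - f p.1 (x p.1 + p.2.1.2, p.2.2)| <=
     L * `|p.2.1.1 - p.2.1.2|.
    have tI2 : (`[a, b] `*` setT) (t, (((0 : E), (0 : E)), z)) by [].
    have := c _ tI2; rewrite /= !addr0 => /(_ _ LP) LP'.
    have {LP'} : \forall p \near (t, (((0 : E), (0 : E)), z)), (`[a, b] `*` setT) p ->
      `[a, b]%classic p.1 -> `|f p.1 (x p.1 + p.2.1.1, p.2.2) -
        f p.1 (x p.1 + p.2.1.2, p.2.2)| <=
       L * `|(x p.1 + p.2.1.1) - (x p.1 + p.2.1.2)| := LP'.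
    apply: filterS => p pP pI.
    have pI' : `[a, b]%classic p.1 by rewrite /= in_itv.
    have := pP (conj pI' I) pI'; rewrite opprD addrACA subrr add0r; exact.
  have n2 : \forall p \near (t, (((0 : E), (0 : E)), z)), a <= p.1 <= b ->
      W (x p.1 + p.2.1.1, p.2.2).
    have c2 : continuous_on setT (fun p : R * ((E * E) * Z) => (p.1, (p.2.1.1, p.2.2))).
      by continuity.
    exact: (@continuous_onT _ _ _ c2 (t, (((0 : E), (0 : E)), z)) _ (near_graph cx Wx tI)).
  have [[A B] /= [nA nB] AB] := filterI n1 n2.
  exists (A, [set q : R * ((E * E) * Z) | L <= q.1 /\ B q.2]) => /=.
    split=> //; exists ([set k | L <= k], B) => //; split=> //=.
    exact: nbhs_pinfty_ge (num_real _).
  move=> [t' [k q]] /= [At' [Lk Bq]] t'I.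
  have [/(_ t'I) p1 /(_ t'I) p2] := AB (t', q) (conj At' Bq).
  by split=> //; apply: le_trans p1 _; rewrite ler_wpM2r.
move=> [[K B] /= [nK nB] KB].
have [L [LK L0]] : exists L, K L /\ 0 <= L.
  have [L [KL L0]] := filter_ex (filterI nK (nbhs_pinfty_ge (num_real (0 : R)))).
  by exists L.
have [[B12 B3] /= [[[B1 B2] /= [nB1 nB2] B1212] nB3] B123] := nB.
have /nbhs_ballP[r1 /= r10 r1P] := nB1; have /nbhs_ballP[r2 /= r20 r2P] := nB2.
pose rho := Num.min r1 r2 / 2.
have r12 : 0 < Num.min r1 r2 by rewrite lt_min r10.
have rr1 : Num.min r1 r2 <= r1 by rewrite ge_min lexx.
have rr2 : Num.min r1 r2 <= r2 by rewrite ge_min lexx orbT.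
exists L, rho; split=> //; first by rewrite divr_gt0.
near=> y => t e e' tI er e'r.
have B1e : B1 e by apply: r1P; rewrite -ball_normE /= sub0r normrN (le_lt_trans er) /rho; lra.
have B2e : B2 e' by apply: r2P; rewrite -ball_normE /= sub0r normrN (le_lt_trans e'r) /rho; lra.
have B3y : B3 y by near: y.
have By : B ((e, e'), y) by apply: B123; split=> //; exact: (B1212 (e, e')).
exact: (KB (L, ((e, e'), y)) (conj LK By) t tI).
Unshelve. all: by end_near. Qed.

(** Gronwall's inequality for the distance to [x]: its local form keeps the curve in
   the tube in which the Lipschitz constant is valid. The equation for [u] is
   assumed only as long as [u] is close to [x]; so the lemma applies to solutions
   of a truncated equation. *)
Lemma solution_close (x : R -> E) (z : Z) (t0 : R) :
  locally_lipschitz `[a, b] W f -> solves z x -> a <= t0 <= b ->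
  exists2 rho0, 0 < rho0 & forall rho, 0 < rho <= rho0 ->
    exists2 d, 0 < d & \forall y \near z, forall u du : R -> E,
      continuous_on `[a, b] u -> `|u t0 - x t0| <= d ->
      (forall t, a < t < b -> has_deriv u t (du t)) ->
      (forall t, a < t < b -> `|u t - x t| < rho -> du t = f t (u t, y)) ->
      forall t, a <= t <= b -> W (u t, y) /\ `|u t - x t| <= rho / 2.
Proof.
move=> lip [cx Wx dx] t0I; have [L [rho0 [L0 rho00 near_lip]]] := lipschitz_tube lip cx Wx.
exists rho0 => // rho /andP[rho_gt0 le_rho].
pose M := expR ((L + 1) * (b - a)); have M0 : 0 < M by exact: expR_gt0.
(* Gronwall's bound [2 * d * M] is half the radius of the tube. *)
pose d := rho / (4 * M); have d0 : 0 < d by rewrite divr_gt0// mulr_gt0.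
have dM : 2 * d * M = rho / 2 by rewrite /d; field; rewrite gt_eqF.
exists d => //; near=> y => u du cu ut0 hu hdu t tI.
have yL : forall t e e', a <= t <= b -> `|e| <= rho0 -> `|e'| <= rho0 ->
    W (x t + e, y) /\ `|f t (x t + e, y) - f t (x t + e', y)| <= L * `|e - e'|.
  by near: y.
have xu s : x s + (u s - x s) = u s by linear_identity R E.
have n0 : `|0 : E| <= rho0 by rewrite normr0 ltW.
have yf : forall t, a <= t <= b ->
    W (x t, y) /\ `|f t (x t, y) - f t (x t, z)| <= d.
  by near: y; exact: near_solution.
have close : `|u t - x t| <= rho / 2.
  rewrite -dM; apply: (@gronwall _ _ (fun s => u s - x s)
    (fun s => du s - f s (x s, z)) a b t0 L d rho) => //.
  - by rewrite -/M dM; lra.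
  - move=> s sI; apply: (continuous_onD cu _ sI) => v vI.
    apply: (@continuous_on_comp _ _ _ _ setT x (fun v => - v)) => //.
    by apply: continuous_onW; exact: opp_continuous.
  - move=> s sI; split; first by apply: has_derivB; [exact: hu|exact: dx].
    move=> us; rewrite hdu//.
    have sI' : a <= s <= b by move: sI => /andP[? ?]; rewrite !ltW.
    have us0 : `|u s - x s| <= rho0 by rewrite ltW// (lt_le_trans us).
    have [_ l1] := yL s (u s - x s) 0 sI' us0 n0.
    have [_ l2] := yf s sI'.
    have -> : f s (u s, y) - f s (x s, z) =
        (f s (u s, y) - f s (x s, y)) + (f s (x s, y) - f s (x s, z)).
      by linear_identity R E.
    apply: le_trans (ler_normD _ _) _; rewrite lerD//.
    by move: l1; rewrite xu addr0 subr0.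
split=> //; have le0 : `|u t - x t| <= rho0 by apply: le_trans close _; lra.
by have [] := yL t (u t - x t) 0 tI le0 n0; rewrite xu.
Unshelve. all: by end_near. Qed.

Lemma solution_unique (x u : R -> E) (z : Z) (t0 : R) :
  locally_lipschitz `[a, b] W f -> solves z x -> solves z u -> a <= t0 <= b ->
  x t0 = u t0 -> forall t, a <= t <= b -> x t = u t.
Proof.
move=> lip sx [cu Wu du] t0I xu t tI.
have [rho0 rho00 close] := solution_close lip sx t0I.
apply/eqP; rewrite -subr_eq0 -normr_le0 distrC; apply/ler_addgt0Pr => e e0; rewrite add0r.
pose rho := Num.min rho0 e.
have rho_gt0 : 0 < rho by rewrite lt_min rho00.
have [|d d0 /nbhs_singleton dP] := close rho; first by rewrite rho_gt0 ge_min lexx.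
have ut0 : `|u t0 - x t0| <= d by rewrite xu subrr normr0 ltW.
have [_ xt] := dP u (fun t => f t (u t, z)) cu ut0 du (fun _ _ _ => erefl) t tI.
apply: le_trans xt _; have : rho <= e by rewrite ge_min lexx orbT.
lra.
Qed.

End SolutionEstimates.

(** * Solutions with nearby data *)

Section Retraction.
Context {R : realType} {E : normedModType R}.

(** The retraction to the ball of radius [r]; in a normed space its Lipschitz
   constant is 2. *)
Definition radial (r : R) (v : E) : E := (r / Num.max r `|v|) *: v.

Lemma radial_id r v : 0 < r -> `|v| <= r -> radial r v = v.
Proof. by move=> r0 vr; rewrite /radial max_l// divff ?gt_eqF// scale1r. Qed.

Lemma norm_radial r v : 0 < r -> `|radial r v| <= r.
Proof.
move=> r0; have m0 : 0 < Num.max r `|v| by rewrite lt_max r0.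
rewrite normrZ ger0_norm; last by rewrite divr_ge0 ?ltW.
by rewrite mulrAC ler_pdivrMr// ler_wpM2l ?(ltW r0)// le_max lexx orbT.
Qed.

Lemma radial_lipschitz r u v : 0 < r -> `|radial r u - radial r v| <= 2 * `|u - v|.
Proof.
move=> r0; wlog uv : u v / `|v| <= `|u|.
  move=> H; have [|/ltW uv] := leP `|v| `|u|; first exact: H.
  by rewrite distrC (distrC u); exact: H.
pose m (w : E) := Num.max r `|w|.
have m0 w : 0 < m w by rewrite lt_max r0.
have mr w : r <= m w by rewrite le_max lexx.
have m_le w : `|w| <= m w by rewrite le_max lexx orbT.
have mvu : m v <= m u by rewrite ge_max mr (le_trans uv (m_le u)).
have muv : m u - m v <= `|u - v|.
  have := lerB_dist u v; rewrite /m.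
  by case: (leP r `|u|) => ?; case: (leP r `|v|) => ?; have := normr_ge0 (u - v); lra.
have -> : radial r u - radial r v =
    (r / m u) *: (u - v) - (r * (m u - m v) / (m u * m v)) *: v.
  rewrite /radial -!/(m _).
  have -> : r * (m u - m v) / (m u * m v) = r / m v - r / m u.
    by field; rewrite !gt_eqF.
  by linear_identity R E.
apply: le_trans (ler_normB _ _) _.
rewrite (normrZ (r / m u)) (normrZ (r * (m u - m v) / (m u * m v))).
have A : `|r / m u| * `|u - v| <= `|u - v|.
  rewrite ger0_norm; last by rewrite divr_ge0// ltW.
  by apply: ler_piMl => //; rewrite ler_pdivrMr// mul1r.
have B : `|r * (m u - m v) / (m u * m v)| * `|v| <= `|u - v|.
  rewrite ger0_norm; last first.
    by rewrite divr_ge0 ?mulr_ge0 ?subr_ge0 ?(ltW (m0 _))// ltW.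
  rewrite mulrAC ler_pdivrMr ?mulr_gt0//.
  have muv0 : 0 <= m u - m v by rewrite subr_ge0.
  have X1 : (m u - m v) * `|v| <= `|u - v| * m v by apply: ler_pM.
  have X2 : r * ((m u - m v) * `|v|) <= m u * (`|u - v| * m v).
    by apply: ler_pM => //; [exact: ltW|exact: mulr_ge0].
  lra.
have -> : 2 * `|u - v| = `|u - v| + `|u - v| by ring.
exact: lerD.
Qed.

Lemma radial_continuous r : 0 < r -> continuous (radial r).
Proof.
move=> r0 v; apply/cvgrPdist_le => e e0.
have e20 : 0 < e / 2 by rewrite divr_gt0.
near=> u; apply: le_trans (radial_lipschitz _ _ r0) _.
have : `|v - u| <= e / 2 by near: u; exact: cvgr_dist_le.
lra.
Unshelve. all: by end_near. Qed.

End Retraction.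

Section ExistenceNearby.
Context {R : realType} {E : completeNormedModType R} {Z : topologicalType}.
Variables (a b t0 : R) (W : set (E * Z)) (f : R -> E * Z -> E) (c : Z -> E).
Hypotheses (t0I : a <= t0 <= b) (oW : open W)
  (cf : continuous_on (`[a, b] `*` W) (fun p => f p.1 p.2))
  (lip : locally_lipschitz `[a, b] W f).

(** The right-hand side is made globally Lipschitz by retracting the state to a
   tube around the given curve; the solution of the modified equation exists on
   the whole interval and satisfies the original one wherever it stays in the
   tube. *)
Lemma truncated_solution (x : R -> E) (z : Z) :
  continuous_on `[a, b] x -> (forall t, a <= t <= b -> W (x t, z)) ->
  exists2 rho1, 0 < rho1 & forall rho, 0 < rho <= rho1 ->
    \forall y \near z, forall u0 : E, exists u du : R -> E,
      [/\ u t0 = u0, continuous_on `[a, b] u,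
          forall t, a <= t <= b -> has_deriv u t (du t) &
          forall t, a <= t <= b -> `|u t - x t| < rho ->
            du t = f t (u t, y) /\ W (u t, y)].
Proof.
move=> cx Wx; have ab : a <= b by move: t0I => /andP[]; exact: le_trans.
have [L [rho1 [L0 rho10 near_lip]]] := lipschitz_tube oW lip cx Wx.
exists rho1 => // rho /andP[rho0 rho_le]; apply: filterS near_lip => y yL u0.
pose tau := clamp a b.
have tauI t : a <= tau t <= b by exact: clamp_itv.
have xu (v w : E) : v + (w - v) = w by linear_identity R E.
pose m t (v : E) := x (tau t) + radial rho (v - x (tau t)).
pose g t v := f (tau t) (m t v, y).
have rad_le (v : E) : `|radial rho v| <= rho1.
  exact: le_trans (norm_radial _ rho0) rho_le.
have zero_le : `|0 : E| <= rho1 by rewrite normr0 (le_trans _ rho_le)// ltW.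
have cxt : continuous_on setT (fun p : R * E => x (tau p.1)).
  apply: (@continuous_on_comp _ _ _ _ `[a, b] (fun p => tau p.1) x) => //.
    apply: (@continuous_on_comp _ _ _ _ setT fst tau) => //; first by continuity.
    by apply: continuous_onW; exact: clamp_continuous.
  by move=> p _; rewrite /= in_itv /=; exact: tauI.
have cg : continuous (fun p : R * E => g p.1 p.2).
  apply: continuous_onT.
  apply: (@continuous_on_comp _ _ _ _ (`[a, b] `*` W)
    (fun p : R * E => (tau p.1, (m p.1 p.2, y))) (fun p => f p.1 p.2)) => //.
    apply: continuous_on_pair.
      apply: (@continuous_on_comp _ _ _ _ setT fst tau) => //; first by continuity.
      by apply: continuous_onW; exact: clamp_continuous.
    apply: continuous_on_pair; last by continuity.
    apply: continuous_onD => //.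
    apply: (@continuous_on_comp _ _ _ _ setT (fun p : R * E => p.2 - x (tau p.1))
      (radial rho)) => //; last first.
      by apply: continuous_onW; exact: radial_continuous.
    apply: continuous_onD; first by continuity.
    apply: (@continuous_on_comp _ _ _ _ setT (fun p : R * E => x (tau p.1))
      (fun v => - v)) => //.
    by apply: continuous_onW; exact: opp_continuous.
  move=> p _; split; first by rewrite /= in_itv /=; exact: tauI.
  by have [] := yL (tau p.1) (radial rho (p.2 - x (tau p.1))) 0 (tauI _) (rad_le _)
    zero_le.
have lip_g t v w : `|g t v - g t w| <= L * 2 * `|v - w|.
  have [_] := yL (tau t) (radial rho (v - x (tau t))) (radial rho (w - x (tau t)))
    (tauI t) (rad_le _) (rad_le _).
  move=> /le_trans; apply; rewrite -mulrA ler_wpM2l//.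
  apply: le_trans (radial_lipschitz _ _ rho0) _.
  by have -> : v - x (tau t) - (w - x (tau t)) = v - w by linear_identity R E.
have [|u ut0 du] := lipschitz_ode_exists u0 t0I _ cg lip_g; first by rewrite mulr_ge0.
exists u, (fun t => g t (u t)); split=> //.
  by apply: (@has_deriv_continuous_on _ _ _ _ (fun t => g t (u t))) => t; rewrite /= in_itv /=; exact: du.
move=> t tI ux; have tt : tau t = t by rewrite /tau clamp_id.
have rid : radial rho (u t - x t) = u t - x t by rewrite radial_id// ltW.
rewrite /g /m tt rid xu; split=> //.
have ux1 : `|u t - x t| <= rho1 by rewrite (le_trans (ltW ux)).
by have [] := yL t (u t - x t) 0 tI ux1 zero_le; rewrite xu.
Qed.

(** Solutions of the truncated equation never leave the tube when the data are
   close enough, hence they solve the original equation. *)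
Lemma solutions_exist_near (x : R -> E) (z : Z) :
  solves a b W f z x -> x t0 = c z -> {for z, continuous c} ->
  \forall y \near z, exists2 u, solves a b W f y u & u t0 = c y.
Proof.
move=> sx xt0 cc; have [cx Wx dx] := sx.
have [rho0 rho00 close] := solution_close oW cf lip sx t0I.
have [rho1 rho10 trunc] := truncated_solution cx Wx.
pose rho := Num.min rho0 rho1; have rho_gt0 : 0 < rho by rewrite lt_min rho00.
have [|d d0 near_close] := close rho; first by rewrite rho_gt0 ge_min lexx.
have near_trunc := trunc rho; rewrite rho_gt0 ge_min lexx orbT in near_trunc.
have {}near_trunc := near_trunc erefl.
have near_c : \forall y \near z, `|c z - c y| <= d by exact: cvgr_dist_le.
apply: filterS (filterI near_close (filterI near_trunc near_c)) => y [ycl [ytr yc]].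
have [u [du [ut0 cu hu huf]]] := ytr (c y).
exists u => //.
have lt_le t : a < t < b -> a <= t <= b by move=> /andP[? ?]; rewrite !ltW.
have P t : a <= t <= b -> W (u t, y) /\ `|u t - x t| <= rho / 2.
  apply: (ycl u du) => //; first by rewrite ut0 xt0 distrC.
    by move=> s /lt_le; exact: hu.
  by move=> s /lt_le sI us; exact: (huf s sI us).1.
split=> //; first by move=> t /P[].
move=> t /lt_le tI; have [_ ut] := P t tI.
by have [|<- _] := huf t tI; [lra|exact: hu].
Qed.

End ExistenceNearby.

Section FlowContinuity.
Context {R : realType} {E : normedModType R} {Z : topologicalType}.

Lemma flow_continuous (a b t0 : R) (W : set (E * Z)) (f : R -> E * Z -> E)
    (N : set Z) (c : Z -> E) (Phi : R -> Z -> E) :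
  a <= t0 <= b -> open W -> continuous_on (`[a, b] `*` W) (fun p => f p.1 p.2) ->
  locally_lipschitz `[a, b] W f -> open N -> continuous_on N c ->
  (forall z, N z -> solves a b W f z (Phi^~ z) /\ Phi t0 z = c z) ->
  continuous_on (`[a, b] `*` N) (fun p => Phi p.1 p.2).
Proof.
move=> t0I oW cf lip oN cc sPhi [t z] [tI Nz]; have [sx xt0] := sPhi z Nz.
apply/cvgrPdist_le => e e0.
have [rho0 rho00 close] := solution_close oW cf lip sx t0I.
pose rho := Num.min rho0 e; have rho_gt0 : 0 < rho by rewrite lt_min rho00.
have rho_e : rho <= e by rewrite ge_min lexx orbT.
have [|d d0 near_close] := close rho; first by rewrite rho_gt0 ge_min lexx.
have near_c : \forall y \near z, N y -> `|c z - c y| <= d.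
  by have /cvgrPdist_le/(_ _ d0) := cc z Nz.
have near_z : \forall y \near z, N y ->
    forall s, a <= s <= b -> `|Phi s y - Phi s z| <= rho / 2.
  apply: filterS (filterI near_close near_c) => y [ycl yc] Ny s sI.
  have [[cu Wu du] ut0] := sPhi y Ny.
  have Phi_t0 : `|Phi t0 y - Phi t0 z| <= d by rewrite ut0 xt0 distrC yc.
  by have [] := ycl (Phi^~ y) (fun t => f t (Phi t y, y)) cu Phi_t0 du
    (fun _ _ _ => erefl) s sI.
have [cx _ _] := sx; have e20 : 0 < e / 2 by rewrite divr_gt0.
have near_t : \forall s \near t, `[a, b]%classic s -> `|Phi t z - Phi s z| <= e / 2.
  by have /cvgrPdist_le/(_ _ e20) := cx t tI.
suff : \forall p \near (t, z), (`[a, b] `*` N) p -> `|Phi t z - Phi p.1 p.2| <= e by [].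
exists ([set s | `[a, b]%classic s -> `|Phi t z - Phi s z| <= e / 2],
  [set y | N y -> forall s, a <= s <= b -> `|Phi s y - Phi s z| <= rho / 2]).
  by split.
move=> [s y] /= [ts ys] [sI Ny].
have sI' : a <= s <= b by move: sI; rewrite in_itv.
have -> : Phi t z - Phi s y = (Phi t z - Phi s z) - (Phi s y - Phi s z).
  by linear_identity R E.
apply: le_trans (ler_normB _ _) _; have := ts sI; have := ys Ny s sI'; lra.
Qed.

End FlowContinuity.

(** * The variational equation *)

Lemma interior_segment {R : realType} (a b t : R) :
  (`[a, b]%classic)° t <-> a < t < b.
Proof.
split=> [/near_realP[d d0 dP]|/andP[at_ tb]].
  have d2 : 0 < d / 2 by rewrite divr_gt0.
  have := dP (t - d / 2); have := dP (t + d / 2); rewrite /= !in_itv /=.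
  have -> : t + d / 2 - t = d / 2 by ring.
  have -> : t - d / 2 - t = - (d / 2) by ring.
  rewrite normrN gtr0_norm// => /(_ _)A /(_ _)B.
  have /andP[? ?] : a <= t + d / 2 <= b by apply: A; lra.
  have /andP[? ?] : a <= t - d / 2 <= b by apply: B; lra.
  lra.
have : nbhs t `]a, b[%classic.
  by apply: open_nbhs_nbhs; split; [exact: interval_open|rewrite /= in_itv /= at_].
by apply: filterS => s; rewrite /= !in_itv /= => /andP[? ?]; rewrite !ltW.
Qed.

Section LinearBounds.
Context {R : realType} {E H : normedModType R}.

(** A family of homogeneous maps that is jointly continuous at 0 is bounded on a
   ball, uniformly for nearby parameters; homogeneity spreads the bound to all
   vectors. *)
Lemma homogeneous_local_bound {Q : topologicalType} (S : set Q) (l : Q -> E -> H) :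
  continuous_on (S `*` setT) (fun p => l p.1 p.2) ->
  (forall q (k : R) e, S q -> l q (k *: e) = k *: l q e) ->
  forall q0, S q0 -> exists2 L : R, 0 <= L &
    \forall q \near q0, S q -> forall e, `|l q e| <= L * `|e|.
Proof.
move=> cl hl q0 Sq0.
have l0 : l q0 0 = 0 by have := hl q0 0 0 Sq0; rewrite !scale0r.
have : \forall p \near (q0, (0 : E)), (S `*` setT) p -> `|l p.1 p.2| <= 1.
  have /cvgrPdist_le/(_ _ ltr01) := cl (q0, 0) (conj Sq0 I).
  by apply: filterS => p; rewrite /= l0 sub0r normrN.
move=> [[A B] /= [nA nB] AB]; have /nbhs_ballP[d /= d0 dP] := nB.
exists (2 / d); first by rewrite divr_ge0// ltW.
apply: filterS nA => q Aq Sq e.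
have [->|e0] := eqVneq e 0.
  by have := hl q 0 0 Sq; rewrite !scale0r => ->; rewrite !normr0 mulr0.
have n0 : 0 < `|e| by rewrite normr_gt0.
pose k := 2 / d * `|e|; have k0 : 0 < k by rewrite mulr_gt0// divr_gt0.
have Be : B (k^-1 *: e).
  apply: dP; rewrite -ball_normE /= sub0r normrN normrZ gtr0_norm ?invr_gt0//.
  have -> : k^-1 * `|e| = d / 2 by rewrite /k; field; rewrite ?gt_eqF.
  lra.
have := AB (q, k^-1 *: e) (conj Aq Be) (conj Sq I); rewrite /= hl// normrZ.
by rewrite gtr0_norm ?invr_gt0// ler_pdivrMl// mulr1.
Qed.

Lemma homogeneous_bound (a b : R) (l : R -> E -> H) :
  continuous_on (`[a, b] `*` setT) (fun p => l p.1 p.2) ->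
  (forall t (k : R) e, a <= t <= b -> l t (k *: e) = k *: l t e) ->
  exists2 L : R, 0 <= L & forall t e, a <= t <= b -> `|l t e| <= L * `|e|.
Proof.
move=> cl hl.
have hl' t (k : R) e : `[a, b]%classic t -> l t (k *: e) = k *: l t e.
  by rewrite /= in_itv; exact: hl.
have : \forall L \near +oo, forall t, a <= t <= b -> forall e, `|l t e| <= L * `|e|.
  apply: tube => t tI.
  have [|L L0 LP] := homogeneous_local_bound cl hl' (q0 := t); first by rewrite /= in_itv.
  exists ([set s | `[a, b]%classic s -> forall e, `|l s e| <= L * `|e|], [set K | L <= K]).
    by split=> //=; exact: nbhs_pinfty_ge (num_real _).
  move=> [s K] /= [sP LK] sI e; apply: le_trans (sP _ e) _.
    by rewrite in_itv.
  by rewrite ler_wpM2r.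
move=> LP; have [L [L0 {}LP]] := filter_ex (filterI (nbhs_pinfty_ge (num_real (0 : R))) LP).
by exists L => // t e tI; exact: LP.
Qed.

End LinearBounds.

Section Variational.
Context {R : realType} {E : completeNormedModType R} {Z : tvsType R}.
Variables (a b t0 : R) (W : set (E * Z)) (f : R -> E * Z -> E)
  (df : R -> (E * Z) * (E * Z) -> E).
Hypotheses (t0I : a <= t0 <= b) (oW : open W)
  (cf : continuous_on (`[a, b] `*` W) (fun p => f p.1 p.2))
  (tf : is_tangent `[a, b] W f df)
  (cdf : continuous_on (`[a, b] `*` (W `*` setT)) (fun p => df p.1 p.2)).

Let tangent_sub t x z y y' v : a <= t <= b -> W (x, z) ->
  df t ((x, z), (y, v)) - df t ((x, z), (y', v)) = df t ((x, z), (y - y', 0)).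
Proof.
move=> tI Wxz; have tI' : `[a, b]%classic t by rewrite /= in_itv.
have -> : (y, v) = (y - y', 0) + (y', v) :> E * Z.
  by congr (_, _); rewrite /= ?subrK// add0r.
by rewrite (is_tangentD _ _ oW tf cdf tI' Wxz) addrK.
Qed.

Let tangent_homogeneous t x z y (k : R) : a <= t <= b -> W (x, z) ->
  df t ((x, z), (k *: y, 0)) = k *: df t ((x, z), (y, 0)).
Proof.
move=> tI Wxz; have tI' : `[a, b]%classic t by rewrite /= in_itv.
rewrite -(is_tangentZ _ _ tf tI' Wxz); congr (df t (_, _)).
by congr (_, _); rewrite /= scaler0.
Qed.

Let continuous_along (S : set (R * E)) (x : R -> E) (y : R * E -> E) z v :
  continuous_on `[a, b] x -> (forall t, a <= t <= b -> W (x t, z)) ->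
  (forall p, S p -> a <= p.1 <= b) -> continuous_on S y ->
  continuous_on S (fun p => df p.1 ((x p.1, z), (y p, v))).
Proof.
move=> cx Wx SI cy.
apply: (@continuous_on_comp _ _ _ S (`[a, b] `*` (W `*` setT))
  (fun p => (p.1, ((x p.1, z), (y p, v)))) (fun p => df p.1 p.2)) => //.
  have cx1 : continuous_on S (fun p => x p.1).
    apply: (@continuous_on_comp _ _ _ S `[a, b] fst x) => //; first by continuity.
  by continuity.
by move=> p /SI pI; split; rewrite /= ?in_itv//; split=> //; exact: Wx.
Qed.

(** The linearised equation along [x] has a continuous, hence bounded, linear
   part, so it is globally Lipschitz and its solutions exist on all of [[a, b]]. *)
Lemma variational_solution (x : R -> E) (z v : Z) (w : E) :
  continuous_on `[a, b] x -> (forall t, a <= t <= b -> W (x t, z)) ->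
  exists psi : R -> E, [/\ psi t0 = w, continuous_on `[a, b] psi &
    forall t, a < t < b -> has_deriv psi t (df t ((x t, z), (psi t, v)))].
Proof.
move=> cx Wx; have ab : a <= b by move: t0I => /andP[]; exact: le_trans.
have [L L0 LP] : exists2 L : R, 0 <= L & forall t e, a <= t <= b ->
    `|df t ((x t, z), (e, 0))| <= L * `|e|.
  apply: homogeneous_bound.
    apply: continuous_along => //; last by continuity.
    by move=> p [pI _]; move: pI; rewrite /= in_itv.
  by move=> t k e tI; exact: tangent_homogeneous (Wx t tI).
pose tau := clamp a b; have tauI t : a <= tau t <= b by exact: clamp_itv.
pose g t y := df (tau t) ((x (tau t), z), (y, v)).
have cg : continuous (fun p : R * E => g p.1 p.2).
  apply: continuous_onT.
  apply: (@continuous_on_comp _ _ _ setT [set p : R * E | a <= p.1 <= b]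
    (fun p : R * E => (tau p.1, p.2)) (fun p => df p.1 ((x p.1, z), (p.2, v)))).
  - apply: continuous_on_pair; last by continuity.
    apply: (@continuous_on_comp _ _ _ _ setT fst tau) => //; first by continuity.
    by apply: continuous_onW; exact: clamp_continuous.
  - by apply: continuous_along => //; continuity.
  - by move=> p _; exact: tauI.
have lip_g t y y' : `|g t y - g t y'| <= L * `|y - y'|.
  by rewrite /g tangent_sub//; [exact: LP|exact: Wx].
have [psi psi0 dpsi] := lipschitz_ode_exists w t0I L0 cg lip_g.
exists psi; split=> //.
  apply: (@has_deriv_continuous_on _ _ _ _ (fun t => g t (psi t))) => t.
  by rewrite /= in_itv; exact: dpsi.
move=> t /andP[at_ tb]; have tI : a <= t <= b by rewrite !ltW.
by have := dpsi t tI; rewrite /g /tau clamp_id.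
Qed.

(** The increment [Phi t (z + h v) - Phi t z - h psi t] satisfies a linear
   differential inequality with right-hand side o(h); Gronwall's inequality makes
   it o(h) as well. *)
Lemma flow_has_dirderiv (N : set Z) (c : Z -> E) (Phi : R -> Z -> E) (psi : R -> E)
    (z v : Z) :
  open N -> (forall y, N y -> solves a b W f y (Phi^~ y)) ->
  (forall y, N y -> Phi t0 y = c y) -> continuous_linear c -> N z ->
  psi t0 = c v -> continuous_on `[a, b] psi ->
  (forall t, a < t < b -> has_deriv psi t (df t ((Phi t z, z), (psi t, v)))) ->
  forall t, a <= t <= b -> has_dirderiv (Phi t) z v (psi t).
Proof.
move=> oN sPhi Phi0 cl Nz psi0 cpsi dpsi t tI.
have [cx Wx dx] := sPhi z Nz; set x := Phi^~ z in cx Wx dx.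
have lip : locally_lipschitz `[a, b] W f.
  by apply: tangent_smooth_lipschitz => //; split=> //; exists df.
have [L [rho [L0 rho0 near_lip]]] := lipschitz_tube oW lip cx Wx.
have rho20 : 0 < rho / 2 by rewrite divr_gt0.
pose M := expR ((L + 1) * (b - a)); have M0 : 0 < M by exact: expR_gt0.
apply/has_dirderivP => e e0.
pose e' := e / (2 * M); have e'0 : 0 < e' by rewrite divr_gt0// mulr_gt0.
have e'M : 2 * e' * M = e by rewrite /e'; field; rewrite gt_eqF.
have e'2 : 0 < e' / 2 by rewrite divr_gt0.
(* Strict differentiability gives the linear equation up to o(h), uniformly in
   time. *)
have near_strict : \forall h \near (0 : R), forall s, a <= s <= b ->
    `|h *: psi s| <= rho / 2 /\
    `|f s (x s + h *: psi s, z + h *: v) - f s (x s, z) -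
       h *: df s ((x s, z), (psi s, v))| <= e' * `|h|.
  apply: (@tube R R (nbhs (0 : R)) a b (fun s h => `|h *: psi s| <= rho / 2 /\
    `|f s (x s + h *: psi s, z + h *: v) - f s (x s, z) -
       h *: df s ((x s, z), (psi s, v))| <= e' * `|h|)) => s sI.
  have sI' : `[a, b]%classic s by rewrite /= in_itv.
  have s0I : (`[a, b] `*` setT) (s, (0 : R)) by [].
  have cpsi1 : continuous_on (`[a, b] `*` setT) (fun p : R * R => psi p.1).
    apply: (@continuous_on_comp _ _ _ _ `[a, b] fst psi) => //; first by continuity.
    by move=> p [].
  have cx1 : continuous_on (`[a, b] `*` setT) (fun p : R * R => x p.1).
    apply: (@continuous_on_comp _ _ _ _ `[a, b] fst x) => //; first by continuity.
    by move=> p [].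
  have n1 : \forall p \near (s, (0 : R)), (`[a, b] `*` setT) p ->
      `|p.2 *: psi p.1| <= rho / 2.
    have c1 : continuous_on (`[a, b] `*` setT) (fun p : R * R => p.2 *: psi p.1).
      by continuity.
    have /cvgrPdist_le/(_ _ rho20) := c1 _ s0I.
    by apply: filterS => p; rewrite /= scale0r sub0r normrN.
  have strict := strict_dirderiv (psi s, v) (@subset_refl _ _) oW tf cdf sI' (Wx s sI) e'2.
  have n2 : \forall p \near (s, (0 : R)), (`[a, b] `*` setT) p ->
      `[a, b]%classic p.1 -> `|f p.1 ((x p.1, z) + p.2 *: (psi p.1, v)) - f p.1 (x p.1, z) -
       p.2 *: df s ((x s, z), (psi s, v))| <= e' / 2 * `|p.2|.
    have c2 : continuous_on (`[a, b] `*` setT) (fun p : R * R =>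
        ((p.1, ((x p.1, z), (psi p.1, v))), p.2)) by continuity.
    exact: (c2 _ s0I _ strict).
  have n3 : \forall p \near (s, (0 : R)), (`[a, b] `*` setT) p ->
      `|df s ((x s, z), (psi s, v)) - df p.1 ((x p.1, z), (psi p.1, v))| <= e' / 2.
    have c3 : continuous_on (`[a, b] `*` setT) (fun p : R * R =>
        df p.1 ((x p.1, z), (psi p.1, v))).
      apply: (@continuous_on_comp _ _ _ _ (`[a, b] `*` (W `*` setT)) (fun p : R * R =>
        (p.1, ((x p.1, z), (psi p.1, v)))) (fun p => df p.1 p.2)) => //.
        by continuity.
      by move=> p [pI _]; split=> //; split=> //; apply: Wx; move: pI; rewrite /= in_itv.
    by have /cvgrPdist_le/(_ _ e'2) := c3 _ s0I.
  suff : \forall p \near (s, (0 : R)), a <= p.1 <= b -> `|p.2 *: psi p.1| <= rho / 2 /\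
    `|f p.1 (x p.1 + p.2 *: psi p.1, z + p.2 *: v) - f p.1 (x p.1, z) -
       p.2 *: df p.1 ((x p.1, z), (psi p.1, v))| <= e' * `|p.2| by [].
  apply: filterS (filterI n1 (filterI n2 n3)) => -[u h] /= [p1 [p2 p3]] uI.
  have uI' : (`[a, b] `*` setT) (u, h) by split; rewrite //= in_itv.
  split; first exact: p1.
  have {}p2 : `|f u (x u + h *: psi u, z + h *: v) - f u (x u, z) -
      h *: df s ((x s, z), (psi s, v))| <= e' / 2 * `|h| := p2 uI' uI'.1.
  have -> : f u (x u + h *: psi u, z + h *: v) - f u (x u, z) -
      h *: df u ((x u, z), (psi u, v)) =
    (f u (x u + h *: psi u, z + h *: v) - f u (x u, z) -
      h *: df s ((x s, z), (psi s, v))) +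
    h *: (df s ((x s, z), (psi s, v)) - df u ((x u, z), (psi u, v))).
    by linear_identity R E.
  apply: le_trans (ler_normD _ _) _; rewrite normrZ [e']splitr mulrDl lerD//.
  by rewrite mulrC ler_wpM2r//; exact: p3.
have near_lip0 := @line_cvg _ _ z v _ near_lip; rewrite /= in near_lip0.
have near_N : \forall h \near (0 : R), N (z + h *: v).
  by apply: line_cvg; exact: open_nbhs_nbhs.
near=> h.
have [->|h0] := eqVneq h 0.
  by rewrite !scale0r addr0 subrr subr0 !normr0 mulr0.
have Nh : N (z + h *: v) by near: h.
have he : e * `|h| <= rho / 2.
  rewrite mulrC -ler_pdivlMr//; near: h; apply/near_realP.
  exists (rho / 2 / e); first by rewrite divr_gt0.
  by move=> h; rewrite subr0 => /ltW.
have yL : forall s w w', a <= s <= b -> `|w| <= rho -> `|w'| <= rho ->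
    W (x s + w, z + h *: v) /\
    `|f s (x s + w, z + h *: v) - f s (x s + w', z + h *: v)| <= L * `|w - w'|.
  near: h; exact: near_lip0.
have strict : forall s, a <= s <= b -> `|h *: psi s| <= rho / 2 /\
    `|f s (x s + h *: psi s, z + h *: v) - f s (x s, z) -
       h *: df s ((x s, z), (psi s, v))| <= e' * `|h|.
  by near: h; exact: near_strict.
have [cu Wu du] := sPhi _ Nh.
have hn : 0 < `|h| by rewrite normr_gt0.
have eh : 2 * (e' * `|h|) * expR ((L + 1) * (b - a)) = e * `|h|.
  by rewrite -/M -e'M; ring.
rewrite -eh; apply: (@gronwall _ _ (fun s => Phi s (z + h *: v) - Phi s z - h *: psi s)
  (fun s => f s (Phi s (z + h *: v), z + h *: v) - f s (x s, z) -
    h *: df s ((x s, z), (psi s, v))) a b t0 L (e' * `|h|) (rho / 2)) => //.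
- by rewrite mulr_gt0.
- by rewrite eh.
- have cN (q : R -> E) : continuous_on `[a, b] q -> continuous_on `[a, b] (fun s => - q s).
    move=> cq; apply: (@continuous_on_comp _ _ _ _ setT q (fun w => - w)) => //.
    by apply: continuous_onW; exact: opp_continuous.
  apply: continuous_onD; first by apply: continuous_onD => //; exact: cN.
  by apply: cN; apply: continuous_onZ => //; continuity.
- rewrite !Phi0// psi0; case: cl => _ ->.
  have -> : c z + h *: c v - c z - h *: c v = 0 by linear_identity R E.
  by rewrite normr0 mulr_ge0// ltW.
- move=> s sI; split.
    apply: has_derivB; last by apply: has_derivZ; exact: dpsi.
    by apply: has_derivB; [exact: du|exact: dx].
  move=> Dlt; have sI' : a <= s <= b by move: sI => /andP[? ?]; rewrite !ltW.
  have [hpsi str] := strict s sI'.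
  set D := Phi s (z + h *: v) - Phi s z - h *: psi s in Dlt *.
  have Phi_D : Phi s (z + h *: v) = x s + (h *: psi s + D).
    by rewrite /D /x; linear_identity R E.
  have le1 : `|h *: psi s + D| <= rho.
    by apply: le_trans (ler_normD _ _) _; lra.
  have le2 : `|h *: psi s| <= rho by lra.
  have [_ lipD] := yL s _ _ sI' le1 le2.
  have -> : f s (Phi s (z + h *: v), z + h *: v) - f s (x s, z) -
      h *: df s ((x s, z), (psi s, v)) =
    (f s (Phi s (z + h *: v), z + h *: v) - f s (x s + h *: psi s, z + h *: v)) +
    (f s (x s + h *: psi s, z + h *: v) - f s (x s, z) -
      h *: df s ((x s, z), (psi s, v))) by linear_identity R E.
  apply: le_trans (ler_normD _ _) _; apply: lerD => //.
  by move: lipD; rewrite -Phi_D addrAC subrr add0r.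
Unshelve. all: by end_near. Qed.

End Variational.

(** * Smoothness of flows on a compact interval *)

Section MixedSmoothMonotone.
Context {R : realType} {Z : tvsType R} {H : normedModType R}.

Lemma mixed_smooth_le (m r k : nat) (J : set R) (W : set Z) (g : R -> Z -> H) :
  (m <= r)%N -> mixed_smooth r k J W g -> mixed_smooth m k J W g.
Proof.
elim: r => [|r IHr]; first by rewrite leqn0 => /eqP ->.
rewrite leq_eqVlt => /predU1P[->//|]; rewrite ltnS => /IHr mr.
by move=> /mixed_smooth_pred.
Qed.

Lemma mixed_smooth_pred_space (r k : nat) (J : set R) (W : set Z) (g : R -> Z -> H) :
  mixed_smooth r k.+1 J W g -> mixed_smooth r k J W g.
Proof.
elim: r g => [|r IHr] g; first by move=> [/tangent_smooth_pred].
by move=> [/tangent_smooth_pred ? [g' ? /IHr]]; split=> //; exists g'.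
Qed.

End MixedSmoothMonotone.

Section FlowSmoothness.
Context {R : realType}.
Variables (a b t0 : R).
Hypothesis t0I : a <= t0 <= b.

Let segmentP t : `[a, b]%classic t <-> a <= t <= b.
Proof. by rewrite /= in_itv. Qed.

(** The time derivative of the flow is the right-hand side along the flow; so each
   time derivative already obtained gives the next one by the chain rule. *)
Lemma flow_time_smooth {E : normedModType R} {Z : tvsType R} (r k : nat)
    (W : set (E * Z)) (N : set Z) (f : R -> E * Z -> E) (Phi : R -> Z -> E) :
  (r <= k)%N -> open W -> mixed_smooth r k `[a, b] W f ->
  continuous_on (`[a, b] `*` N) (fun p => Phi p.1 p.2) ->
  (forall z, N z -> solves a b W f z (Phi^~ z)) ->
  time_smooth r.+1 `[a, b] N Phi.
Proof.
move=> rk oW sf cPhi sPhi.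
have dPhi : is_time_derivative `[a, b] N Phi (fun t z => f t (Phi t z, z)).
  by move=> t z /interior_segment tI /sPhi[_ _]; exact.
suff smooth m : (m <= r.+1)%N -> time_smooth m `[a, b] N Phi by exact: smooth.
elim: m => [_|m IHm]; first by split.
rewrite ltnS => mr; split=> //; exists (fun t z => f t (Phi t z, z)) => //.
have sfm := mixed_smooth_le mr sf.
apply: (@time_smooth_comp _ _ _ _ _ m k `[a, b] W N f Phi id) => //.
- exact: leq_trans mr rk.
- by apply: IHm; exact: leqW.
- by move=> z; exact: cvg_id.
- by move=> t z /segmentP tI /sPhi[_ /(_ t tI)].
Qed.

Lemma continuous_linear_swap {Z1 Z2 : tvsType R} :
  continuous_linear (fun p : (Z1 * Z1) * (Z2 * Z2) => ((p.1.1, p.2.1), (p.1.2, p.2.2))).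
Proof. by split=> //; apply: continuous_onT; continuity. Qed.

Lemma continuous_linear_fst_fst {Z1 Z2 : tvsType R} :
  continuous_linear (fun p : (Z1 * Z1) * (Z2 * Z2) => (p.1.1, p.2.1)).
Proof. by split=> //; apply: continuous_onT; continuity. Qed.

(** The pair of a flow and its derivative in the initial data is the flow of the
   tangent equation, whose right-hand side has one space derivative less; so the
   space regularity of the flow follows by induction. Continuity of the flow is
   an assumption here because the tangent equation is merely continuous, not
   Lipschitz, in the last step. *)
Theorem flow_smooth_of_continuous {E : completeNormedModType R} {Z : tvsType R}
    (r s k : nat) (W : set (E * Z)) (N : set Z) (c : Z -> E)
    (f : R -> E * Z -> E) (Phi : R -> Z -> E) :
  (r + s <= k)%N -> open W -> open N -> continuous_linear c ->
  mixed_smooth r k `[a, b] W f ->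
  continuous_on (`[a, b] `*` N) (fun p => Phi p.1 p.2) ->
  (forall z, N z -> solves a b W f z (Phi^~ z)) ->
  (forall z, N z -> Phi t0 z = c z) ->
  flow_smooth r.+1 s `[a, b] N Phi.
Proof.
elim: s E Z k W N c f Phi => [|s IHs] E Z k W N c f Phi rsk oW oN lc sf cPhi sPhi Phi0.
all: have tPhi := flow_time_smooth (leq_trans (leq_addr _ _) rsk) oW sf cPhi sPhi.
  by split.
case: k rsk sf => [|k]; first by rewrite addnS.
rewrite addnS ltnS => rsk sf; split=> //.
have [df tf sdf] := mixed_smooth_has_tangent oW sf.
have cf := tangent_smooth_continuous (mixed_smooth_tangent sf).
have cdf := tangent_smooth_continuous (mixed_smooth_tangent sdf).
have /choice[psi psiP] (p : Z * Z) : exists psi : R -> E, N p.1 ->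
    [/\ psi t0 = c p.2, continuous_on `[a, b] psi &
      forall t, a < t < b -> has_deriv psi t (df t ((Phi t p.1, p.1), (psi t, p.2)))].
  have [Np|nNp] := pselect (N p.1); last by exists (fun=> 0).
  have [cx Wx _] := sPhi p.1 Np.
  have [psi psiP] := variational_solution t0I oW tf cdf p.2 (c p.2) cx Wx.
  by exists psi.
pose Psi t p := psi p t.
have tPsi : is_tangent `[a, b] N Phi Psi.
  move=> t z v /segmentP tI Nz; have [psi0 cpsi dpsi] := psiP (z, v) Nz.
  exact: (flow_has_dirderiv t0I oW cf tf cdf oN sPhi Phi0 lc Nz psi0 cpsi dpsi tI).
exists Psi => //.
pose NT := N `*` [set: Z]; have oNT : open NT by apply: open_prod => //; exact: openT.
(* Continuity of the derivative: for fixed initial data its equation is linear. *)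
have cPsi : continuous_on (`[a, b] `*` NT) (fun p => Psi p.1 p.2).
  pose g t (q : E * (Z * Z)) := df t ((Phi t q.2.1, q.2.1), (q.1, q.2.2)).
  pose Wg := [set q : E * (Z * Z) | N q.2.1].
  have oWg : open Wg.
    have cq : continuous (fun q : E * (Z * Z) => q.2.1).
      by apply: continuous_onT; continuity.
    by apply: open_comp => // q _; exact: cq.
  have cPhi_comp (T : topologicalType) (S : set T) (u : T -> R) (y : T -> Z) :
      continuous_on S u -> continuous_on S y ->
      (forall x, S x -> `[a, b]%classic (u x) /\ N (y x)) ->
      continuous_on S (fun x => Phi (u x) (y x)).
    move=> cu cy Suy; apply: (@continuous_on_comp _ _ _ S (`[a, b] `*` N)
      (fun x => (u x, y x)) (fun p => Phi p.1 p.2)) => //.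
    exact: continuous_on_pair.
  have Wdf t z y v : `[a, b]%classic t -> N z ->
      (`[a, b] `*` (W `*` setT)) (t, ((Phi t z, z), (y, v) : E * Z)).
    move=> tI Nz; split=> //; split=> //.
    by have [_ Wz _] := sPhi z Nz; apply: Wz; exact/segmentP.
  have cg : continuous_on (`[a, b] `*` Wg) (fun p => g p.1 p.2).
    apply: (@continuous_on_comp _ _ _ _ (`[a, b] `*` (W `*` setT))
      (fun p : R * (E * (Z * Z)) =>
        (p.1, ((Phi p.1 p.2.2.1, p.2.2.1), (p.2.1, p.2.2.2)))) (fun p => df p.1 p.2)) => //.
      apply: continuous_on_pair; first by continuity.
      apply: continuous_on_pair; last by continuity.
      apply: continuous_on_pair; last by continuity.
      by apply: cPhi_comp; [continuity|continuity|].
    by move=> p [pI Np]; exact: Wdf.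
  have lip_g : locally_lipschitz `[a, b] Wg g.
    move=> t y [z v] tI Nz.
    have [||L L0 LP] := @homogeneous_local_bound _ E E _ (`[a, b] `*` N)
      (fun q e => df q.1 ((Phi q.1 q.2, q.2), (e, 0))) _ _ (t, z) (conj tI Nz).
    - apply: (@continuous_on_comp _ _ _ _ (`[a, b] `*` (W `*` setT))
        (fun p : (R * Z) * E => (p.1.1, ((Phi p.1.1 p.1.2, p.1.2), (p.2, 0 : Z))))
        (fun p => df p.1 p.2)) => //.
        apply: continuous_on_pair; first by continuity.
        apply: continuous_on_pair; last by continuity.
        apply: continuous_on_pair; last by continuity.
        by apply: cPhi_comp; [continuity|continuity|move=> p []].
      by move=> p [[pI Np] _]; exact: Wdf.
    - move=> [u y'] l e [/= uI Ny].
      have [_ [Wuy _]] := Wdf u y' 0 0 uI Ny.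
      rewrite -(is_tangentZ _ _ tf uI Wuy); congr (df u (_, _)).
      by congr (_, _); rewrite /= scaler0.
    exists L.
    have near_N : \forall y' \near z, N y' by exact: open_nbhs_nbhs.
    have [[A B] /= [nA nB] AB] := LP.
    exists (A, [set q : (E * E) * (Z * Z) | B q.2.1 /\ N q.2.1]) => /=.
      split=> //; exists (setT, (B `&` N) `*` setT) => /=.
        split; first exact: filterT.
        exists (B `&` N, setT) => //; split; last exact: filterT.
        exact: filterI.
      by move=> [[y1 y2] [z1 z2]] [_ [[]]].
    move=> [u [[y1 y2] [z1 v1]]] /= [Au [Bz Nz1]] uI.
    have -> : g u (y1, (z1, v1)) - g u (y2, (z1, v1)) = df u ((Phi u z1, z1), (y1 - y2, 0)).
      have [_ [Wuz _]] := Wdf u z1 0 0 uI Nz1.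
      rewrite /g /=.
      have -> : (y1, v1) = (y1 - y2, 0) + (y2, v1) :> E * Z.
        by congr (_, _); rewrite /= ?subrK// add0r.
      by rewrite (is_tangentD _ _ oW tf cdf uI Wuz) addrK.
    exact: (AB (u, z1) (conj Au Bz) (conj uI Nz1)).
  apply: (@flow_continuous _ _ _ a b t0 Wg g NT (fun p => c p.2)) => //.
    apply: (@continuous_on_comp _ _ _ _ setT (fun p : Z * Z => p.2) c) => //.
      by continuity.
    by apply: continuous_onW; case: lc.
  move=> [z v] [Nz _]; have [psi0 cpsi dpsi] := psiP (z, v) Nz.
  by split=> //; split.
pose f2 t (q : (E * E) * (Z * Z)) :=
  (f t (q.1.1, q.2.1), df t ((q.1.1, q.2.1), (q.1.2, q.2.2))).
pose W2 := [set q : (E * E) * (Z * Z) | W (q.1.1, q.2.1)].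
have oW2 : open W2.
  by apply: open_comp => // q _; case: (@continuous_linear_fst_fst E Z) => /(_ q).
have sf2 : mixed_smooth r k `[a, b] W2 f2.
  apply: mixed_smooth_pair.
    apply: (mixed_smooth_pullback (@subset_refl _ _) continuous_linear_fst_fst (W := W)) => //.
    exact: mixed_smooth_pred_space.
  apply: (mixed_smooth_pullback (@subset_refl _ _) continuous_linear_swap (W := W `*` setT)) => //.
pose Phi2 t (p : Z * Z) := (Phi t p.1, Psi t p).
suff sPhi2 : flow_smooth r.+1 s `[a, b] NT Phi2 by exact: (flow_smooth_snd sPhi2).
apply: (@IHs _ _ k W2 NT (fun p => (c p.1, c p.2)) f2 Phi2 rsk oW2 oNT
  (continuous_linear_tangent lc) sf2).
- apply: continuous_on_pair => //.
  apply: (@continuous_on_comp _ _ _ _ (`[a, b] `*` N) (fun p : R * (Z * Z) => (p.1, p.2.1))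
    (fun p => Phi p.1 p.2)) => //; first by continuity.
  by move=> p [? []].
- move=> [z v] [Nz _]; have [psi0 cpsi dpsi] := psiP (z, v) Nz.
  have [cx Wx dx] := sPhi z Nz.
  split; first exact: continuous_on_pair.
    by move=> t; exact: Wx.
  by move=> t tI; apply: has_deriv_pair; [exact: dx|exact: dpsi].
- move=> [z v] [Nz _]; have [psi0 _ _] := psiP (z, v) Nz.
  by rewrite /Phi2 /Psi psi0 Phi0.
Qed.

End FlowSmoothness.

(** * Iterated directional derivatives *)

Section Rows.
Context {T : topologicalType}.

Lemma row_coord_continuous (n : nat) (l : 'I_n) :
  continuous (fun v : 'rV[T]_n => v ord0 l).
Proof.
move=> v A nA; exists (fun i j => if j == l then A else setT).
  move=> i j /=; case: eqVneq => [->|_]; last exact: filterT.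
  by rewrite (ord1 i).
by move=> w /(_ ord0 l); rewrite /= eqxx.
Qed.

Lemma continuous_on_row {Q : topologicalType} (A : set Q) (n : nat)
    (f : 'I_n -> Q -> T) :
  (forall l, continuous_on A (f l)) -> continuous_on A (fun q => \row_l f l q).
Proof.
move=> cf q Aq P [B /= nB BP].
have nearB : \forall p \near q, forall l : 'I_n, A p -> B ord0 l (f l p).
  apply: filter_forall => l; have := nB ord0 l; rewrite mxE => nBl.
  exact: (cf l q Aq _ nBl).
suff : \forall p \near q, A p -> P (\row_l f l p) by [].
apply: filterS nearB => p pB Ap; apply: BP => i l.
by rewrite (ord1 i) mxE; exact: pB.
Qed.

End Rows.

Section IteratedDerivatives.
Context {R : realType} {X : tvsType R} {H : normedModType R}.
Implicit Types (f : X -> H) (p h : X).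

Lemma has_dirderiv_quotientP f p h (l : H) : has_dirderiv f p h l <->
  dir_quotient f p h t @[t --> 0^'] --> l.
Proof.
split=> [/has_dirderivP fl|fl].
  apply/cvgrPdist_le => e /fl; rewrite near_withinE; apply: filterS => t tl t0.
  have nt0 : 0 < `|t| by rewrite normr_gt0.
  rewrite /dir_quotient -(ler_pM2l nt0) -normrZ scalerBr scalerA divff// scale1r.
  by rewrite -normrN opprB mulrC.
apply/has_dirderivP => e e0; have /cvgrPdist_le/(_ _ e0) := fl.
rewrite near_withinE; apply: filterS => t tl.
have [->|t0] := eqVneq t 0; first by rewrite !scale0r addr0 subrr subr0 !normr0 mulr0.
have := tl t0; have nt0 : 0 < `|t| by rewrite normr_gt0.
rewrite /dir_quotient -(ler_pM2l nt0) -normrZ scalerBr scalerA divff// scale1r.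
by rewrite -normrN opprB mulrC.
Qed.

Lemma has_dirderiv_dir_derive f p h (l : H) : has_dirderiv f p h l ->
  dir_derivable f p h /\ dir_derive h f p = l.
Proof.
move=> fl; split; first by exists l; exact/has_dirderiv_quotientP.
have ql : [set m : H | dir_quotient f p h t @[t --> 0^'] --> m] l.
  exact/has_dirderiv_quotientP.
have /has_dirderiv_quotientP := xgetI 0 ql.
by move/has_dirderiv_unique; apply.
Qed.

Lemma dir_derivable_has_dirderiv f p h : dir_derivable f p h ->
  has_dirderiv f p h (dir_derive h f p).
Proof.
move=> [l /has_dirderiv_quotientP fl]; have [_ ->] := has_dirderiv_dir_derive fl.
exact: fl.
Qed.

Lemma dir_quotient_near f1 f2 p h : (\forall y \near p, f1 y = f2 y) ->
  (fun l : H => dir_quotient f1 p h t @[t --> 0^'] --> l) =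
  (fun l : H => dir_quotient f2 p h t @[t --> 0^'] --> l).
Proof.
move=> E; apply/funext => l; apply/propext.
split=> /has_dirderiv_quotientP fl; apply/has_dirderiv_quotientP;
  apply: has_dirderiv_near fl => //; by apply: filterS E => y.
Qed.

Lemma dir_derive_near f1 f2 p h : (\forall y \near p, f1 y = f2 y) ->
  dir_derive h f1 p = dir_derive h f2 p /\
  (dir_derivable f1 p h <-> dir_derivable f2 p h).
Proof.
move=> E; have := dir_quotient_near h E.
by rewrite /dir_derive /dir_derivable => ->.
Qed.

(** Iterated derivatives at a point depend on the function near the point only. *)
Lemma iter_derive_open (O : set X) f1 f2 (hs : seq X) p : open O ->
  (forall y, O y -> f1 y = f2 y) -> O p ->
  iter_derive f1 hs p = iter_derive f2 hs p /\
  (iter_derivable f1 hs p <-> iter_derivable f2 hs p).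
Proof.
move=> oO; elim: hs f1 f2 => [|h hs IHhs] f1 f2 E Op /=; first by split=> //; exact: E.
have nearE y : O y -> \forall y' \near y, f1 y' = f2 y'.
  move=> Oy; have : nbhs y O by exact: open_nbhs_nbhs.
  by apply: filterS => y'; exact: E.
have dE y : O y -> dir_derive h f1 y = dir_derive h f2 y.
  by move=> Oy; exact: (dir_derive_near h (nearE y Oy)).1.
have [-> i1] := IHhs _ _ dE Op.
split=> //; have [_ d1] := dir_derive_near h (nearE p Op).
by rewrite d1 i1.
Qed.

Lemma iter_derive_cat f (hs ks : seq X) :
  iter_derive f (hs ++ ks) = iter_derive (iter_derive f hs) ks.
Proof. by elim: hs f => [|h hs IHhs] f //=. Qed.

Lemma iter_derivable_cat f (hs ks : seq X) p :
  iter_derivable f (hs ++ ks) p <->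
  iter_derivable f hs p /\ iter_derivable (iter_derive f hs) ks p.
Proof.
elim: hs f => [|h hs IHhs] f /=; first by split=> [|[]].
by rewrite IHhs; split=> [[? []]|[[]]].
Qed.

(** Derivatives of a composite with an affine map: the directions are transformed
   by the linear part [i]. *)
Lemma iter_derive_affine {Y : tvsType R} (f : Y -> H) (k : X -> Y) (i : X -> Y)
    (hs : seq X) p :
  (forall y (t : R) h, k (y + t *: h) = k y + t *: i h) ->
  iter_derive (fun y => f (k y)) hs p = iter_derive f (map i hs) (k p) /\
  (iter_derivable (fun y => f (k y)) hs p <-> iter_derivable f (map i hs) (k p)).
Proof.
move=> ki; elim: hs f => [|h hs IHhs] f //=.
have E y : dir_quotient (fun y => f (k y)) y h = dir_quotient f (k y) (i h).
  by apply/funext => t; rewrite /dir_quotient ki.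
have -> : dir_derive h (fun y => f (k y)) = (fun y => dir_derive (i h) f (k y)).
  by apply/funext => y; rewrite /dir_derive E.
have [-> i1] := IHhs (dir_derive (i h) f).
by split=> //; rewrite i1 /dir_derivable E.
Qed.

End IteratedDerivatives.

(** * From iterated tangents to the C^(r,s) property *)

Lemma time_smooth_pullback {R : realType} {H : normedModType R} (r : nat)
    {Z' Z : topologicalType} (J : set R) (W' : set Z') (W : set Z) (l : Z' -> Z)
    (g : R -> Z -> H) :
  continuous l -> (forall z, W' z -> W (l z)) ->
  time_smooth r J W g -> time_smooth r J W' (fun t z => g t (l z)).
Proof.
move=> cl lW; elim: r g => [|r IHr] g.
all: have cont : continuous_on (J `*` W) (fun p => g p.1 p.2) ->
    continuous_on (J `*` W') (fun p => g p.1 (l p.2)).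
1,3: move=> cg; apply: (@continuous_on_comp _ _ _ _ (J `*` W)
    (fun p => (p.1, l p.2)) (fun p => g p.1 p.2)) => //;
  [apply: continuous_on_pair; [continuity|];
   apply: (@continuous_on_comp _ _ _ _ setT snd l) => //; [continuity|];
   exact: continuous_onW
  |by move=> p [Jp /lW]].
  by move=> [/cont].
move=> [/cont cg [g' dg sg']]; split=> //.
exists (fun t z => g' t (l z)); last exact: IHr.
by move=> t z Jt /lW Wz; exact: dg.
Qed.

Section SpaceDerivatives.
Context {R : realType} {H : normedModType R}.

(** The first direction is absorbed in the base point: the derivative of [g] in a
   fixed direction is its tangent composed with an affine map, and the remaining
   directions become directions of [Z * Z] with second component 0. *)
Lemma flow_smooth_iter_space (r j : nat) {Z : tvsType R} (J : set R) (N : set Z)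
    (g : R -> Z -> H) : open N -> flow_smooth r j J N g ->
  exists2 G : R -> Z * 'rV[Z]_j -> H, time_smooth r J (N `*` setT) G &
    forall t z (v : 'rV[Z]_j), J° t -> N z ->
      let hs := [seq (0, v ord0 l) : R * Z | l <- enum 'I_j] in
      iter_derivable (fun p : R * Z => g p.1 p.2) hs (t, z) /\
      iter_derive (fun p : R * Z => g p.1 p.2) hs (t, z) = G t (z, v).
Proof.
elim: j Z N g => [|j IHj] Z N g oN.
  move=> [sg _]; exists (fun t p => g t p.1).
    apply: (@time_smooth_pullback _ _ _ _ _ J _ N fst) sg => //; last by move=> p [].
    by apply: continuous_onT; continuity.
  by move=> t z v Jt Nz; rewrite enum_ord0.
move=> [sg [dg tg sdg]].
have [|G' sG' G'P] := IHj _ (N `*` [set: Z]) dg _ sdg.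
  by apply: open_prod => //; exact: openT.
pose tail (v : 'rV[Z]_j.+1) : 'rV[Z * Z]_j := \row_l (v ord0 (lift ord0 l), 0).
exists (fun t (p : Z * 'rV[Z]_j.+1) => G' t ((p.1, p.2 ord0 ord0), tail p.2)).
  apply: (@time_smooth_pullback _ _ _ _ _ J (N `*` setT) ((N `*` setT) `*` setT)
    (fun p : Z * 'rV[Z]_j.+1 => ((p.1, p.2 ord0 ord0), tail p.2))) sG'; last first.
    by move=> p [].
  have coord (l : 'I_j.+1) : continuous_on setT (fun p : Z * 'rV[Z]_j.+1 => p.2 ord0 l).
    apply: (@continuous_on_comp _ _ _ _ setT snd (fun v : 'rV[Z]_j.+1 => v ord0 l)) => //.
      by continuity.
    by apply: continuous_onW; exact: row_coord_continuous.
  apply: continuous_onT; apply: continuous_on_pair.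
    by apply: continuous_on_pair; [continuity|exact: coord].
  apply: continuous_on_row => l; apply: continuous_on_pair; first exact: coord.
  by continuity.
move=> t z v Jt Nz hs; rewrite /hs enum_ordSl /= -map_comp /=.
set f := fun p : R * Z => g p.1 p.2; set v0 := v ord0 ord0.
pose O : set (R * Z) := J° `*` N.
have oO : open O by apply: open_prod => //; exact: open_interior.
have dgP y : O y -> has_dirderiv f y (0, v0) (dg y.1 (y.2, v0)).
  case: y => s y [/= Js Ny].
  have := tg s y v0 (interior_subset Js) Ny; rewrite /has_dirderiv /f /=.
  by congr has_deriv; apply/funext => h /=; rewrite scaler0 addr0.
have dfE y : O y -> dir_derive (0, v0) f y = dg y.1 (y.2, v0).
  by move=> /dgP/has_dirderiv_dir_derive[].
have Otz : O (t, z) by [].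
pose ks := [seq (0, v ord0 (lift ord0 l)) : R * Z | l <- enum 'I_j].
have -> : [seq ((fun l => (0, v ord0 l) : R * Z) \o lift ord0) i | i <- enum 'I_j] = ks by [].
have [E1 D1] := iter_derive_open ks oO dfE Otz.
have affine y (s : R) h : (fun p : R * Z => (p.1, (p.2, v0))) (y + s *: h) =
    (y.1, (y.2, v0)) + s *: (h.1, (h.2, 0)) :> R * (Z * Z).
  by congr (_, (_, _)); rewrite /= scaler0 addr0.
have [E2 D2] := @iter_derive_affine _ _ _ _ (fun p : R * (Z * Z) => dg p.1 p.2)
  (fun p : R * Z => (p.1, (p.2, v0))) (fun h => (h.1, (h.2, 0))) ks (t, z) affine.
have ksE : [seq (h.1, (h.2, 0)) : R * (Z * Z) | h <- ks] =
    [seq (0, tail v ord0 l) : R * (Z * Z) | l <- enum 'I_j].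
  by rewrite -map_comp; apply: eq_map => l; rewrite /= mxE.
have [] := G'P t (z, v0) (tail v) Jt (conj Nz I); rewrite -ksE => D3 E3.
split; last by rewrite E1 E2 E3.
split; first by have [] := has_dirderiv_dir_derive (dgP _ Otz).
by apply/D1/D2.
Qed.

(** A time direction is a real number, so a derivative in directions
   [w_1, .., w_i] is the product of the [w_l] times the pure time derivative. The
   factor [k] and the affine substitution [y] are there for the induction, which
   turns [f] into a multiple of its time derivative. *)
Lemma time_smooth_iter_time (i : nat) {Y : topologicalType} (J : set R)
    (M : set Y) (G : R -> Y -> H) : time_smooth i J M G ->
  exists2 Gi : R -> Y -> H, continuous_on (J `*` M) (fun p => Gi p.1 p.2) &
    forall (Z : tvsType R) (N : set Z) (y : Z -> Y) (k : R) (f : R * Z -> H)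
        (w : 'rV[R]_i) t z,
      open N -> (forall z, N z -> M (y z)) ->
      (forall t z, J° t -> N z -> f (t, z) = k *: G t (y z)) -> J° t -> N z ->
      let hs := [seq (w ord0 l, 0) : R * Z | l <- enum 'I_i] in
      iter_derivable f hs (t, z) /\
      iter_derive f hs (t, z) = (k * \prod_(l < i) w ord0 l) *: Gi t (y z).
Proof.
elim: i G => [|i IHi] G.
  move=> [cG _]; exists G => // Z N y k f w t z _ _ fG Jt Nz.
  by rewrite enum_ord0 big_ord0 mulr1 /=; split=> //; exact: fG.
move=> [cG [G' dG /IHi[Gi cGi GiP]]]; exists Gi => //.
move=> Z N y k f w t z oN yM fG Jt Nz hs; rewrite /hs enum_ordSl /= -map_comp /=.
pose O : set (R * Z) := J° `*` N; set w0 := w ord0 ord0.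
have oO : open O by apply: open_prod => //; exact: open_interior.
have dfP s u : J° s -> N u -> has_dirderiv f (s, u) (w0, 0) ((w0 * k) *: G' s (y u)).
  move=> Js Nu.
  have -> : (w0, 0) = w0 *: (1, 0) :> R * Z.
    by congr (_, _); rewrite /= ?scaler0// /GRing.scale /= mulr1.
  rewrite -scalerA; apply: has_dirderivZ.
  have near_O : \forall p \near (s, u), O p by apply: open_nbhs_nbhs; split.
  apply: (@has_dirderiv_near _ _ _ (fun p => k *: G p.1 (y p.2))).
    by apply: filterS near_O => -[s' u'] [/= Js' Nu']; rewrite fG.
  have dG0 := dG s (y u) Js (yM u Nu); rewrite -[s]addr0 in dG0.
  have := has_derivZ k (has_deriv_shift dG0); rewrite addr0 /has_dirderiv.
  congr has_deriv; apply/funext => h /=.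
  by rewrite scaler0 addr0 /GRing.scale /= mulr1.
have dfE s u : J° s -> N u -> dir_derive (w0, 0) f (s, u) = (w0 * k) *: G' s (y u).
  by move=> Js Nu; have [] := has_dirderiv_dir_derive (dfP s u Js Nu).
pose w' : 'rV[R]_i := \row_l w ord0 (lift ord0 l).
have [] := GiP Z N y (w0 * k) (dir_derive (w0, 0) f) w' t z oN yM dfE Jt Nz.
have -> : [seq (w' ord0 l, 0) : R * Z | l <- enum 'I_i] =
    [seq ((fun l => (w ord0 l, 0) : R * Z) \o lift ord0) l | l <- enum 'I_i].
  by apply: eq_map => l; rewrite /= mxE.
move=> D E; split.
  by split=> //; have [] := has_dirderiv_dir_derive (dfP t z Jt Nz).
rewrite E big_ord_recl; congr (_ *: _).
rewrite (eq_bigr (fun l => w ord0 (lift ord0 l))) => [|l _]; last by rewrite mxE.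
by rewrite -/w0; ring.
Qed.

Lemma continuous_on_prod_coord {T : topologicalType} (A : set T) (i : nat)
    (w : T -> 'rV[R]_i) : continuous_on A w ->
  continuous_on A (fun x => \prod_(l < i) w x ord0 l).
Proof.
move=> cw x Ax; apply: cvg_big => [|l _]; first exact: mul_continuous.
apply: (@continuous_on_comp _ _ _ A setT w (fun v => v ord0 l)) => //.
by apply: continuous_onW; exact: row_coord_continuous.
Qed.

Lemma flow_smooth_Crs {Z : tvsType R} (r s : diff_order) (J : set R) (N : set Z)
    (g : R -> Z -> H) : open N ->
  (forall i j : nat, diff_order_le (Some i) r -> diff_order_le (Some j) s ->
     flow_smooth i j J N g) ->
  Crs r s J N (fun p : R * Z => g p.1 p.2).
Proof.
move=> oN sg; set f := fun p : R * Z => g p.1 p.2.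
have oN' : N° = N by apply/interior_id.
have main i j : diff_order_le (Some i) r -> diff_order_le (Some j) s ->
    exists G : (R * Z) * ('rV[R]_i * 'rV[Z]_j) -> H,
      [/\ continuous_on ((J `*` N) `*` setT) G,
          forall t z (w : 'rV[R]_i) (v : 'rV[Z]_j), J° t -> N z ->
            iter_derivable f (mixed_dirs w v) (t, z) /\
            dij f ((t, z), (w, v)) = G ((t, z), (w, v)) &
          i = 0%N -> j = 0%N -> {in (J `*` N) `*` setT, forall q, G q = f q.1}].
  move=> ir js; have sij := sg i j ir js.
  have [G sG GP] := flow_smooth_iter_space oN sij.
  have [Gi cGi GiP] := time_smooth_iter_time sG.
  pose T := ((R * Z) * ('rV[R]_i * 'rV[Z]_j))%type.
  pose fac (q : T) : R := \prod_(l < i) q.2.1 ord0 l.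
  pose Gi' (q : T) : H := Gi q.1.1 (q.1.2, q.2.2).
  have c1 : continuous_on ((J `*` N) `*` setT) (fun q : T => q.1).
    exact: continuous_on_fst (@continuous_on_id _ _).
  have c2 : continuous_on ((J `*` N) `*` setT) (fun q : T => q.2).
    exact: continuous_on_snd (@continuous_on_id _ _).
  have cfac : continuous_on ((J `*` N) `*` setT) fac.
    exact: continuous_on_prod_coord (continuous_on_fst c2).
  have cGi' : continuous_on ((J `*` N) `*` setT) Gi'.
    apply: (@continuous_on_comp _ _ _ _ (J `*` (N `*` setT))
      (fun q : T => (q.1.1, (q.1.2, q.2.2))) (fun p => Gi p.1 p.2)) => //.
      apply: continuous_on_pair (continuous_on_fst c1) _.
      exact: continuous_on_pair (continuous_on_snd c1) (continuous_on_snd c2).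
    by move=> q [[]].
  have cG : continuous_on ((J `*` N) `*` setT) (fun q => fac q *: Gi' q).
    exact: continuous_onZ cfac cGi'.
  have val t z (w : 'rV[R]_i) (v : 'rV[Z]_j) : J° t -> N z ->
      iter_derivable f (mixed_dirs w v) (t, z) /\
      dij f ((t, z), (w, v)) = (\prod_(l < i) w ord0 l) *: Gi t (z, v).
    move=> Jt Nz; rewrite /dij /mixed_dirs /= iter_derive_cat.
    set vs := [seq (0, v ord0 l) : R * Z | l <- enum 'I_j].
    have [] := GiP Z N (fun z => (z, v)) 1 (iter_derive f vs) w t z oN _ _ Jt Nz.
    - by [].
    - by move=> t' z' Jt' Nz'; rewrite scale1r; have [] := GP t' z' v Jt' Nz'.
    rewrite mul1r => D E; split=> //; apply/iter_derivable_cat; split=> //.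
    by have [] := GP t z v Jt Nz.
  have [[i0 j0]|nij] := pselect (i = 0%N /\ j = 0%N); last first.
    eexists; split; [exact: cG|exact: val|by move=> i0 j0; case: nij].
  subst i j; exists (fun q => f q.1); split=> //.
    apply: (@continuous_on_comp _ _ _ _ (J `*` N) fst f) => //.
      by case: sij => /time_smooth_continuous.
    by move=> q [].
  move=> t z w v Jt Nz; split; first by have [] := val t z w v Jt Nz.
  by rewrite /dij /mixed_dirs !enum_ord0.
split.
  move=> i j ir js; have [G [cG GP _]] := main i j ir js; split.
    by rewrite oN' => -[t z] w v [/= Jt Nz]; have [] := GP t z w v Jt Nz.
  apply/subspace_continuousP; rewrite oN'.
  apply: (@continuous_on_eq _ _ _ G).
    by move=> [[t z] [w v]] [[/= Jt Nz] _]; have [_ E] := GP t z w v Jt Nz; exact: esym E.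
  apply: continuous_on_sub cG => -[[t z] [w v]] [[/= Jt Nz] _].
  by split=> //; split=> //; exact: interior_subset.
move=> i j ir js; have [G [cG GP G00]] := main i j ir js; exists G; split=> //.
  exact/subspace_continuousP.
rewrite oN' => -[[t z] [w v]]; rewrite inE => -[[/= Jt Nz] _].
by have [_ E] := GP t z w v Jt Nz; exact: esym E.
Qed.

End SpaceDerivatives.

(** * From the C^(r,s) property to iterated tangents *)

Section Intervals.
Context {R : realType}.

Lemma interval_interior_between (J : set R) (u v s : R) : is_interval J ->
  J u -> J v -> u < s < v -> J° s.
Proof.
move=> iJ Ju Jv /andP[us sv].
have : nbhs s `]u, v[%classic.
  by apply: open_nbhs_nbhs; split; [exact: interval_open|rewrite /= in_itv /= us].
by apply: filterS => w; rewrite /= in_itv /= => /andP[uw wv]; apply: (iJ u v); rewrite ?ltW.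
Qed.

(** By density of the interior, identities between continuous extensions pass
   from inner times to the end points of [J]. *)
Lemma nondegenerate_interval_closure (J : set R) (t : R) :
  nondegenerate_interval J -> J t -> closure J° t.
Proof.
move=> [iJ [a [b [Ja Jb ab]]]] Jt U /near_realP[d d0 dU].
have [tb|bt] := ltP t b.
- pose s := t + Num.min d (b - t) / 2.
  have m0 : 0 < Num.min d (b - t) by rewrite lt_min d0 subr_gt0.
  have md : Num.min d (b - t) <= d by rewrite ge_min lexx.
  have mb : Num.min d (b - t) <= b - t by rewrite ge_min lexx orbT.
  exists s; split; first by apply: (interval_interior_between iJ Jt Jb); rewrite /s; lra.
  by apply: dU; rewrite /s addrAC subrr add0r gtr0_norm; lra.
- have at_ : a < t by lra.
  pose s := t - Num.min d (t - a) / 2.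
  have m0 : 0 < Num.min d (t - a) by rewrite lt_min d0 subr_gt0.
  have md : Num.min d (t - a) <= d by rewrite ge_min lexx.
  have mb : Num.min d (t - a) <= t - a by rewrite ge_min lexx orbT.
  exists s; split; first by apply: (interval_interior_between iJ Ja Jt); rewrite /s; lra.
  by apply: dU; rewrite /s addrAC subrr add0r normrN gtr0_norm; lra.
Qed.

End Intervals.

Section FromCrs.
Context {R : realType} {Z : tvsType R} {H : normedModType R}.

Definition rcons_row {n : nat} (v : 'rV[Z]_n) (x : Z) : 'rV[Z]_n.+1 :=
  \row_l (if unlift ord_max l is Some l' then v ord0 l' else x).

Lemma rcons_row_dirs (n : nat) (v : 'rV[Z]_n) (x : Z) :
  [seq (0, rcons_row v x ord0 l) : R * Z | l <- enum 'I_n.+1] =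
  [seq (0, v ord0 l) : R * Z | l <- enum 'I_n] ++ [:: (0, x)].
Proof.
rewrite enum_ordSr map_rcons cats1 -map_comp; congr rcons.
  apply: eq_map => l; rewrite /= mxE.
  have -> : widen_ord (leqnSn n) l = lift ord_max l.
    by apply: val_inj; rewrite /= /bump leqNgt ltn_ord.
  by rewrite liftK.
by rewrite mxE unlift_none.
Qed.

(** The family [B] lists the derivatives by the number of directions; [rcons_row]
   appends the direction that is differentiated next. *)
Lemma dir_smooth_family (k j n : nat) (J : set R) (W : set Z)
    (B : forall m, R -> 'rV[Z]_m -> Z -> H) :
  (forall m, (m <= k)%N -> continuous_on (J `*` (setT `*` W))
     (fun p : R * ('rV[Z]_m * Z) => B m p.1 p.2.1 p.2.2)) ->
  (forall m t v z x, (m < k)%N -> J t -> W z ->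
     has_dirderiv (B m t v) z x (B m.+1 t (rcons_row v x) z)) ->
  (j + n <= k)%N ->
  forall (Q : topologicalType) (S : set Q) (tau : Q -> R) (nu : Q -> 'rV[Z]_j),
  continuous_on S tau -> continuous_on S nu -> (forall q, S q -> J (tau q)) ->
  dir_smooth n S W (fun q z => B j (tau q) (nu q) z).
Proof.
move=> cB dB; elim: n j => [|n IHn] j jk Q S tau nu ctau cnu Jtau.
all: have cont : continuous_on (S `*` W) (fun p => B j (tau p.1) (nu p.1) p.2).
1,3: apply: (@continuous_on_comp _ _ _ _ (J `*` (setT `*` W))
  (fun p : Q * Z => (tau p.1, (nu p.1, p.2))) (fun p => B j p.1 p.2.1 p.2.2)) => //;
  [|by apply: cB; apply: leq_trans jk; exact: leq_addr
   |by move=> p [/Jtau]].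
1,2: apply: continuous_on_pair;
  [by apply: (@continuous_on_comp _ _ _ _ S fst tau) => //; [continuity|move=> p []]
  |apply: continuous_on_pair;
    [by apply: (@continuous_on_comp _ _ _ _ S fst nu) => //; [continuity|move=> p []]
    |by continuity]].
  by split.
split=> //; rewrite addnS in jk.
exists (fun (q : Q * Z) z => B j.+1 (tau q.1) (rcons_row (nu q.1) q.2) z).
  move=> q z v Sq Wz /=; apply: dB => //; last exact: Jtau.
  by apply: leq_trans jk; rewrite ltnS leq_addr.
apply: (IHn j.+1 _ _ (S `*` setT) (fun q => tau q.1) (fun q => rcons_row (nu q.1) q.2)).
- by rewrite addSn.
- by apply: (@continuous_on_comp _ _ _ _ S fst tau) => //; [continuity|move=> p []].
- apply: continuous_on_row => l; case: unliftP => [l' _|_]; last by continuity.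
  apply: (@continuous_on_comp _ _ _ _ S fst (fun q => nu q ord0 l')) => //.
  + by continuity.
  + apply: (@continuous_on_comp _ _ _ S setT nu (fun v => v ord0 l')) => //.
    by apply: continuous_onW; exact: row_coord_continuous.
  + by move=> p [].
- by move=> q [/Jtau].
Qed.

Lemma map_const_nseq {T U : Type} (x : U) (s : seq T) :
  [seq x | _ <- s] = nseq (size s) x.
Proof. by elim: s => //= y s ->. Qed.

(** The extension of d^(i,j) f to the end points of [J], taken with all time
   directions equal to 1, is a function [A i j t v z]. For [i = 0] the derivative of
   [A i j] in space is [A i j.+1] by definition; for larger [i] the time derivatives
   have to be moved past the space derivative, by the equality of mixed partial
   derivatives. At the end points the relation holds by continuity. *)
Lemma Crs_mixed_smooth (r k : diff_order) (r' k' : nat) (J : set R) (W : set Z)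
    (f : R * Z -> H) :
  nondegenerate_interval J -> open W ->
  diff_order_le (Some r') r -> diff_order_le (Some k') k -> Crs r k J W f ->
  exists2 F : R -> Z -> H, forall t z, J t -> W z -> F t z = f (t, z) &
    mixed_smooth r' k' J W F.
Proof.
move=> nJ oW r'r k'k [fo fe].
have oW' : W° = W by apply/interior_id.
rewrite oW' in fe.
have le_r i : (i <= r')%N -> diff_order_le (Some i) r.
  by case: r r'r {fo fe} => //= n r'n ir; exact: leq_trans ir r'n.
have le_k j : (j <= k')%N -> diff_order_le (Some j) k.
  by case: k k'k {fo fe} => //= n r'n ir; exact: leq_trans ir r'n.
(* One family of extensions for all orders; the value 0 is taken outside the
   orders of differentiability. *)
pose g i j : (R * Z) * ('rV[R]_i * 'rV[Z]_j) -> H :=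
  match pselect (diff_order_le (Some i) r /\ diff_order_le (Some j) k) with
  | left h => sval (cid (fe i j h.1 h.2))
  | right _ => fun=> 0
  end.
have gP i j : (i <= r')%N -> (j <= k')%N ->
  [/\ {within (J `*` W) `*` setT, continuous (g i j)},
      {in (J° `*` W) `*` setT, g i j =1 @dij _ _ _ _ i j f} &
      i = 0%N -> j = 0%N -> {in (J `*` W) `*` setT, forall q, g i j q = f q.1}].
  move=> /le_r ir /le_k jk; rewrite /g; case: pselect => [h|[]//].
  exact: (svalP (cid (fe i j h.1 h.2))).
pose dirs j (v : 'rV[Z]_j) := [seq (0, v ord0 l) : R * Z | l <- enum 'I_j].
pose time_dirs i : seq (R * Z) := nseq i (1, 0).
pose A i j t (v : 'rV[Z]_j) z : H := g i j ((t, z), (const_mx 1, v)).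
have mixedE i j (v : 'rV[Z]_j) :
    mixed_dirs (const_mx 1 : 'rV[R]_i) v = dirs j v ++ time_dirs i.
  congr (_ ++ _); rewrite (eq_map (g := fun=> (1, 0) : R * Z)) => [|l].
    by rewrite map_const_nseq size_enum_ord.
  by rewrite mxE.
have AE i j t v z : (i <= r')%N -> (j <= k')%N -> J° t -> W z ->
    A i j t v z = iter_derive f (dirs j v ++ time_dirs i) (t, z).
  move=> ir jk Jt Wz; have [_ gE _] := gP i j ir jk.
  by rewrite /A gE ?inE// /dij /= mixedE.
have Ad i j t v z : (i <= r')%N -> (j <= k')%N -> J° t -> W z ->
    iter_derivable f (dirs j v ++ time_dirs i) (t, z).
  move=> ir jk Jt Wz; have [fd _] := fo i j (le_r i ir) (le_k j jk).
  by rewrite -mixedE; apply: fd; rewrite oW'.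
have cA i j : (i <= r')%N -> (j <= k')%N -> continuous_on (J `*` (setT `*` W))
    (fun p : R * ('rV[Z]_j * Z) => A i j p.1 p.2.1 p.2.2).
  move=> ir jk; have [/subspace_continuousP cg _ _] := gP i j ir jk.
  apply: (@continuous_on_comp _ ((R * Z) * ('rV[R]_i * 'rV[Z]_j))%type _ _
    ((J `*` W) `*` setT)
    (fun p : R * ('rV[Z]_j * Z) => ((p.1, p.2.2), (const_mx 1 : 'rV[R]_i, p.2.1)))
    (g i j)) => //.
    by continuity.
  by move=> p [Jp [_ Wp]].
pose O : set (R * Z) := J° `*` W.
have oO : open O by apply: open_prod => //; exact: open_interior.
have nearO t z : J° t -> W z -> \forall p \near (t, z), O p.
  by move=> Jt Wz; apply: open_nbhs_nbhs.
(* Any iterated derivative has the next one as its derivative. *)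
have next i j i' j' t (v : 'rV[Z]_j) (v' : 'rV[Z]_j') z (h : R * Z) :
    (i <= r')%N -> (j <= k')%N -> (i' <= r')%N -> (j' <= k')%N ->
    dirs j' v' ++ time_dirs i' = (dirs j v ++ time_dirs i) ++ [:: h] ->
    J° t -> W z ->
    has_dirderiv (fun p : R * Z => A i j p.1 v p.2) (t, z) h (A i' j' t v' z).
  move=> ir jk ir' jk' E Jt Wz.
  have := Ad i' j' t v' z ir' jk' Jt Wz; rewrite AE// E iter_derive_cat.
  move=> /iter_derivable_cat[_ [/dir_derivable_has_dirderiv D _]].
  apply: has_dirderiv_near D; apply: filterS (nearO t z Jt Wz) => -[s y] [Js Wy].
  by rewrite AE.
have time_next i j t (v : 'rV[Z]_j) z : (i < r')%N -> (j <= k')%N -> J° t -> W z ->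
    has_deriv (fun s => A i j s v z) t (A i.+1 j t v z).
  move=> ir jk Jt Wz.
  have := next i j i.+1 j t v v z (1, 0) (ltnW ir) jk ir jk _ Jt Wz.
  move=> /(_ _)/has_dirderivP D; apply/has_derivP => e e0.
  have E : dirs j v ++ time_dirs i.+1 = (dirs j v ++ time_dirs i) ++ [:: (1, 0)].
    by rewrite -catA; congr (_ ++ _); rewrite /time_dirs -addn1 nseqD.
  have /near_realP[d d0 dP] := D E e e0; exists d => // s sd.
  have := dP (s - t); rewrite subr0 => /(_ sd) /=.
  have -> : t + (s - t) *: (1 : R) = s by rewrite /GRing.scale /= mulr1; lra.
  by rewrite scaler0 addr0.
have space_next0 j t (v : 'rV[Z]_j) z x : (j < k')%N -> J° t -> W z ->
    has_dirderiv (A 0%N j t v) z x (A 0%N j.+1 t (rcons_row v x) z).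
  move=> jk Jt Wz.
  have := next 0%N j 0%N j.+1 t v (rcons_row v x) z (0, x) isT (ltnW jk) isT jk _ Jt Wz.
  rewrite !cats0 => /(_ (rcons_row_dirs v x)); rewrite /has_dirderiv /=.
  by congr has_deriv; apply/funext => h; rewrite scaler0 addr0.
have space_next_int i j t (v : 'rV[Z]_j) z x : (i <= r')%N -> (j < k')%N ->
    J° t -> W z -> has_dirderiv (A i j t v) z x (A i j.+1 t (rcons_row v x) z).
  elim: i t z => [|i IHi] t z ir jk Jt Wz; first exact: space_next0.
  have near_WJ : \forall p \near (0 : R, t), W (z + p.1 *: x) /\ J° p.2.
    exists ([set h | W (z + h *: x)], J°) => //=; split=> /=.
      by apply: line_cvg; exact: open_nbhs_nbhs.
    by apply: open_nbhs_nbhs; split=> //; exact: open_interior.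
  have := @schwarz R H (fun s h => A i j h v (z + s *: x))
    (fun s h => A i j.+1 h (rcons_row v x) (z + s *: x))
    (fun s h => A i.+1 j.+1 h (rcons_row v x) (z + s *: x))
    (fun s => A i.+1 j t v (z + s *: x)) 0 t.
  rewrite scale0r addr0; apply.
  - apply: filterS near_WJ => -[s h] /= [Ws Jh]; split.
      by apply: has_dirderiv_shift; apply: IHi => //; exact: ltnW.
    exact: time_next.
  - pose S := [set p : R * R | J p.2 /\ W (z + p.1 *: x)].
    have c : continuous_on S (fun p => A i.+1 j.+1 p.2 (rcons_row v x) (z + p.1 *: x)).
      apply: (@continuous_on_comp _ _ _ S (J `*` (setT `*` W))
        (fun p => (p.2, (rcons_row v x, z + p.1 *: x)))
        (fun p => A i.+1 j.+1 p.1 p.2.1 p.2.2)); [by continuity|exact: cA|].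
      by move=> p [].
    move=> P nP.
    have S0t : S (0, t) by split; [exact: interior_subset Jt|rewrite scale0r addr0].
    have : \forall p \near (0 : R, t), S p ->
      P (A i.+1 j.+1 p.2 (rcons_row v x) (z + p.1 *: x)) := c _ S0t P nP.
    apply: filter_app; apply: filterS near_WJ => p [Wp Jp]; apply; split=> //.
    exact: interior_subset Jp.
  - have : \forall s \near (0 : R), W (z + s *: x).
      by apply: line_cvg; exact: open_nbhs_nbhs.
    by apply: filterS => s Ws; apply: time_next => //; exact: ltnW.
have space_next i j t (v : 'rV[Z]_j) z x : (i <= r')%N -> (j < k')%N ->
    J t -> W z -> has_dirderiv (A i j t v) z x (A i j.+1 t (rcons_row v x) z).
  move=> ir jk Jt Wz.
  have tg := @is_tangent_closure R R Z H J° J W (fun t z => A i j t v z)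
    (fun t p => A i j.+1 t (rcons_row v p.2) p.1) (@interior_subset _ J) oW.
  apply: tg => //.
  - by move=> s y u Js Wy; exact: space_next_int.
  - by move=> s Js; exact: nondegenerate_interval_closure.
  - apply: (@continuous_on_comp _ _ _ _ (J `*` (setT `*` W))
      (fun p : R * Z => (p.1, (v, p.2))) (fun p => A i j p.1 p.2.1 p.2.2)).
    + by continuity.
    + by apply: cA => //; exact: ltnW.
    + by move=> p [].
  - apply: (@continuous_on_comp _ _ _ _ (J `*` (setT `*` W))
      (fun p : R * (Z * Z) => (p.1, (rcons_row v p.2.2, p.2.1)))
      (fun p => A i j.+1 p.1 p.2.1 p.2.2)).
    + apply: continuous_on_pair; first by continuity.
      apply: continuous_on_pair; last by continuity.
      apply: continuous_on_row => l; case: unliftP => [l' _|_]; by continuity.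
    + exact: cA.
    + by move=> p [Jp [Wp _]].
have tangent_A i : (i <= r')%N -> tangent_smooth k' J W (fun t z => A i 0%N t 0 z).
  move=> ir; apply: dir_smooth_tangent_smooth => //.
  apply: (@dir_smooth_family k' 0 k' J W (A i) _ _ _ _ J id (fun=> 0)) => //.
  - by move=> m mk; exact: cA.
  - by move=> m t v z x mk Jt Wz; exact: space_next.
  - by continuity.
  - by continuity.
exists (fun t z => A 0%N 0%N t 0 z).
  move=> t z Jt Wz; have [_ _ g0] := gP 0%N 0%N isT isT.
  by rewrite /A g0// inE.
suff : forall n i, (i + n <= r')%N -> mixed_smooth n k' J W (fun t z => A i 0%N t 0 z).
  by apply; rewrite add0n.
elim=> [|n IHn] i; first by rewrite addn0 => /tangent_A.
rewrite addnS => inr; split; first by apply: tangent_A; exact: leq_trans (leq_addr _ _) (ltnW inr).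
exists (fun t z => A i.+1 0%N t 0 z); last by apply: IHn; rewrite addSn.
by move=> t z Jt Wz; apply: time_next => //; apply: leq_ltn_trans inr; exact: leq_addr.
Qed.

End FromCrs.

(** * One-sided derivatives and gluing *)

Section RelativeDerivative.
Context {R : realType} {E : normedModType R}.

(** Division-free, like [has_deriv]; at an end point of [I] it is the one-sided
   derivative. *)
Definition has_deriv_within (I : set R) (x : R -> E) (t : R) (l : E) :=
  forall e : R, 0 < e -> exists2 d, 0 < d & forall u, I u -> `|u - t| < d ->
    `|x u - x t - (u - t) *: l| <= e * `|u - t|.

Lemma has_deriv_withinP (I : set R) (x : R -> E) (t : R) (l : E) :
  has_deriv_within I x t l <->
  (u - t)^-1 *: (x u - x t) @[u --> within I t^'] --> l.
Proof.
have quotient u : u != t ->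
    x u - x t - (u - t) *: l = (u - t) *: ((u - t)^-1 *: (x u - x t) - l).
  by move=> ut; rewrite scalerBr scalerA divff ?scale1r// subr_eq0.
split=> [dx|/cvgrPdist_le lim e e0].
  apply/cvgrPdist_le => e /dx[d d0 dP].
  suff : \forall u \near t, u != t -> I u -> `|l - (u - t)^-1 *: (x u - x t)| <= e by [].
  apply/near_realP; exists d => // u ud ut Iu; have := dP u Iu ud.
  by rewrite quotient// normrZ mulrC ler_pM2r ?normr_gt0 ?subr_eq0// distrC.
have : \forall u \near t, u != t -> I u -> `|l - (u - t)^-1 *: (x u - x t)| <= e := lim e e0.
move=> /near_realP[d d0 dP]; exists d => // u Iu ud.
have [->|ut] := eqVneq u t; first by rewrite !subrr scale0r subr0 !normr0 mulr0.
by rewrite quotient// normrZ mulrC ler_pM2r ?normr_gt0 ?subr_eq0// distrC dP.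
Qed.

Lemma has_deriv_within_continuous (I : set R) (x : R -> E) (t : R) (l : E) :
  has_deriv_within I x t l -> x u @[u --> within I (nbhs t)] --> x t.
Proof.
move=> dx; have [d d0 dP] := dx 1 ltr01; apply/cvgrPdist_le => e e0.
have L0 : 0 < 1 + `|l| by rewrite ltr_wpDr.
suff : \forall u \near t, I u -> `|x t - x u| <= e by [].
apply/near_realP; exists (Num.min d (e / (1 + `|l|))).
  by rewrite lt_min d0 divr_gt0.
move=> u; rewrite lt_min => /andP[ud ue] Iu; rewrite distrC.
have -> : x u - x t = (x u - x t - (u - t) *: l) + (u - t) *: l by rewrite subrK.
apply: le_trans (ler_normD _ _) _; rewrite normrZ.
have := dP u Iu ud; rewrite mul1r => H.
apply: le_trans (lerD H (lexx _)) _.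
by rewrite -{1}[`|u - t|]mulr1 -mulrDr -ler_pdivlMr// ltW.
Qed.

Lemma has_deriv_within_interior (I : set R) (x : R -> E) (t : R) (l : E) :
  I° t -> has_deriv_within I x t l -> has_deriv x t l.
Proof.
move=> /near_realP[d' d'0 It] dx; apply/has_derivP => e /dx[d d0 dP].
exists (Num.min d d'); first by rewrite lt_min d0.
by move=> s; rewrite lt_min => /andP[sd /It Is]; exact: dP.
Qed.

(** At an end point of the interval the derivative is the limit of the interior
   derivatives, by the mean value inequality. *)
Lemma has_deriv_within_segment (a b : R) (x dx : R -> E) (t : R) :
  continuous_on `[a, b] x -> (forall s, a < s < b -> has_deriv x s (dx s)) ->
  continuous_on `[a, b] dx -> a <= t <= b -> has_deriv_within `[a, b] x t (dx t).
Proof.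
move=> cx hx cdx tI e e0.
have tI' : `[a, b]%classic t by rewrite /= in_itv.
have /continuous_on_curve/(_ t tI' e e0)[d d0 dP] := cdx; exists d => // u.
rewrite /= in_itv /= => uI ud.
pose D s := x s - s *: dx t; pose m (s : R) : R := s * e.
have dm s : has_deriv m s e by exact: (@has_deriv_line R R e s).
have bound p q : p < q -> a <= p -> q <= b -> `|p - t| < d -> `|q - t| < d ->
    `|D q - D p| <= m q - m p.
  move=> pq ap qb; rewrite !ltr_norml => /andP[? ?] /andP[? ?].
  apply: (@mean_value_le _ _ D m (fun s => dx s - dx t) (fun=> e)); first exact: ltW.
  - have sub : `[p, q]%classic `<=` `[a, b]%classic.
      by move=> s; rewrite /= !in_itv /= => /andP[? ?]; apply/andP; split; lra.
    apply: (continuous_on_sub sub) => s sI; apply: (continuous_onD cx _ sI) => v vI.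
    apply: cvg_within_filter; apply: cvgN; apply: cvgZ; [exact: cvg_id|exact: cvg_cst].
  - by apply: has_deriv_continuous_on => s _; exact: dm.
  - move=> s /andP[ps sq]; split; last 1 first.
    + rewrite /= distrC; apply: dP; last by rewrite /= in_itv /=; apply/andP; split; lra.
      by rewrite ltr_norml; apply/andP; split; lra.
    + apply: has_derivB; first by apply: hx; apply/andP; split; lra.
      exact: has_deriv_line.
    + exact: dm.
have E1 : x u - x t - (u - t) *: dx t = D u - D t by rewrite /D; linear_identity R E.
have t0d : `|t - t| < d by rewrite subrr normr0.
move: tI uI => /andP[at_ tb] /andP[au ub].
have [tu|ut|<-] := ltgtP t u.
- rewrite E1 [`|u - t|]gtr0_norm ?subr_gt0//; apply: le_trans (bound t u _ _ _ _ _) _ => //.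
  by rewrite /m -mulrBl mulrC.
- rewrite E1 distrC [`|u - t|]ltr0_norm ?subr_lt0//; apply: le_trans (bound u t _ _ _ _ _) _ => //.
  by rewrite /m opprB -mulrBl mulrC.
- by rewrite !subrr scale0r subr0 !normr0 mulr0.
Qed.

(** On the side of [tau] the points near [t] lie between [t] and [tau], hence in
   [I1]; on the other side there are none of [I2], since [I2] would then contain
   [t]. *)
Lemma interval_union_near (I1 I2 : set R) (tau t : R) :
  is_interval I1 -> is_interval I2 -> I1 tau -> I2 tau -> I1 t -> ~ I2 t ->
  exists2 d, 0 < d & forall u, I2 u -> `|u - t| < d -> I1 u.
Proof.
move=> i1 i2 t1 t2 I1t I2t.
have tt : t != tau by apply: contra_not_neq I2t => ->.
exists `|tau - t|; first by rewrite normr_gt0 subr_eq0 eq_sym.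
move=> u I2u; have [tlt|tgt|/eqP] := ltgtP t tau; last by rewrite (negbTE tt).
- rewrite (gtr0_norm (x := tau - t)) ?subr_gt0// ltr_norml => /andP[? ?].
  have [ut|tu] := leP u t; first by case: I2t; apply: (i2 u tau) => //; apply/andP; split; lra.
  by apply: (i1 t tau) => //; apply/andP; split; lra.
- rewrite (ltr0_norm (x := tau - t)) ?subr_lt0// ltr_norml => /andP[? ?].
  have [ut|tu] := leP t u; first by case: I2t; apply: (i2 tau u) => //; apply/andP; split; lra.
  by apply: (i1 tau t) => //; apply/andP; split; lra.
Qed.

Lemma is_interval_union (I1 I2 : set R) (tau : R) :
  is_interval I1 -> is_interval I2 -> I1 tau -> I2 tau -> is_interval (I1 `|` I2).
Proof.
have half (I I' : set R) : is_interval I -> is_interval I' -> I tau -> I' tau ->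
    forall p q, I p -> I' q -> forall s, p <= s <= q -> (I `|` I') s.
  move=> i i' It I't p q Ip Iq s /andP[ps sq]; have [st|ts] := leP s tau.
    by left; apply: (i p tau) => //; rewrite ps.
  by right; apply: (i' tau q) => //; rewrite ltW.
move=> i1 i2 t1 t2 p q [Ip|Ip] [Iq|Iq] s sI.
- by left; exact: (i1 p q).
- exact: (half I1 I2 i1 i2 t1 t2 p q).
- by rewrite setUC; exact: (half I2 I1 i2 i1 t2 t1 p q).
- by right; exact: (i2 p q).
Qed.

Lemma has_deriv_within_union (I1 I2 : set R) (x : R -> E) (tau t : R) (l : E) :
  is_interval I1 -> is_interval I2 -> I1 tau -> I2 tau -> (I1 `|` I2) t ->
  (I1 t -> has_deriv_within I1 x t l) -> (I2 t -> has_deriv_within I2 x t l) ->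
  has_deriv_within (I1 `|` I2) x t l.
Proof.
have half (I I' : set R) : is_interval I -> is_interval I' -> I tau -> I' tau ->
    I t -> (I t -> has_deriv_within I x t l) -> (I' t -> has_deriv_within I' x t l) ->
    has_deriv_within (I `|` I') x t l.
  move=> i i' It I't tI d1 d2 e e0; have [d d0 dP] := d1 tI e e0.
  have [tI'|tI'] := pselect (I' t).
    have [d' d'0 dP'] := d2 tI' e e0.
    exists (Num.min d d'); first by rewrite lt_min d0.
    by move=> u [Iu|Iu]; rewrite lt_min => /andP[? ?]; [exact: dP|exact: dP'].
  have [d' d'0 dP'] := interval_union_near i i' It I't tI tI'.
  exists (Num.min d d'); first by rewrite lt_min d0.
  move=> u Iu; rewrite lt_min => /andP[ud ud']; apply: dP => //.
  by case: Iu => // Iu; exact: dP'.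
move=> i1 i2 t1 t2 [It|It] d1 d2; first exact: half.
by rewrite setUC; exact: half.
Qed.

End RelativeDerivative.

Section CompactNeighborhoods.
Context {R : realType}.

(** If [t] is the first point of [J], it is its own left end; the last clause
   keeps the compact neighbourhood from shrinking to a point. *)
Let left_end (J : set R) (t d : R) : is_interval J -> J t -> 0 < d ->
  exists a : R, [/\ t - d <= a <= t, forall u : R, a <= u <= t -> J u,
    exists2 e : R, 0 < e & forall u, J u -> `|u - t| < e -> a <= u &
    a = t -> forall u, J u -> t <= u].
Proof.
move=> iJ Jt d0; have [[v [Jv vt]]|nv] := pselect (exists v, J v /\ v < t).
  have atd : Num.max v (t - d) < t by rewrite gt_max vt /=; lra.
  exists (Num.max v (t - d)); split.
  - by rewrite le_max lexx orbT ltW.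
  - move=> u /andP[]; rewrite ge_max => /andP[vu _] ut.
    by apply: (iJ v t) => //; rewrite vu.
  - exists (t - Num.max v (t - d)); first by rewrite subr_gt0.
    by move=> u _; rewrite ltr_norml => /andP[? _]; lra.
  - by move=> E; move: atd; rewrite E ltxx.
have min_t u : J u -> t <= u.
  by move=> Ju; rewrite leNgt; apply/negP => ut; apply: nv; exists u.
exists t; split=> //; first by apply/andP; split; lra.
  by move=> u /andP[? ?]; have -> : u = t by lra.
by exists 1 => // u /min_t.
Qed.

(** The two ends are found separately, the right one as the left end for the
   reflected interval. *)
Lemma compact_interval_neighborhood (J : set R) (t d : R) :
  nondegenerate_interval J -> J t -> 0 < d ->
  exists a b : R, [/\ a < b, a <= t <= b,
    forall u : R, a <= u <= b -> J u /\ `|u - t| <= d &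
    exists2 e : R, 0 < e & forall u, J u -> `|u - t| < e -> a <= u <= b].
Proof.
move=> [iJ [v [w [Jv Jw vw]]]] Jt d0.
have [a [/andP[ta at_] aJ [e e0 eP] amin]] := left_end iJ Jt d0.
have iJN : is_interval [set u | J (- u)].
  move=> p q Jp Jq s /andP[ps sq]; apply: (iJ (- q) (- p)) => //.
  by apply/andP; split; lra.
have [|b' [/andP[tb' b't] b'J [e' e'0 e'P] bmin]] := left_end iJN (t := - t) _ d0.
  by rewrite /= opprK.
exists a, (- b'); split.
- rewrite ltNge; apply/negP => ba.
  have ta' : a = t by lra.
  have tb : b' = - t by lra.
  have vt := amin ta' v Jv; have := bmin tb (- w); rewrite /= opprK => /(_ Jw); lra.
- by apply/andP; split; lra.
- move=> u /andP[au ub]; split; last by rewrite ler_norml; apply/andP; split; lra.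
  have [ut|tu] := leP u t; first by apply: aJ; rewrite au.
  by have := b'J (- u); rewrite /= opprK; apply; apply/andP; split; lra.
- exists (Num.min e e'); first by rewrite lt_min e0.
  move=> u Ju; rewrite lt_min => /andP[ue ue']; rewrite eP//=.
  have E : `|- u - - t| = `|u - t| by rewrite -normrN; congr (`|_|); ring.
  by have := e'P (- u); rewrite E /= opprK => /(_ Ju ue') ?; lra.
Qed.

End CompactNeighborhoods.

(** * Maximal solutions and their domains *)

(** The map that forgets the initial state: the right-hand side depends on the
   current state and the parameter only. *)
Lemma continuous_linear_drop {R : realType} {Z1 Z2 Z3 : tvsType R} :
  continuous_linear (fun q : Z1 * (Z2 * Z3) => (q.1, q.2.2)).
Proof. by split=> //; apply: continuous_onT; continuity. Qed.

Lemma open_drop {R : realType} {Z1 Z2 Z3 : tvsType R} (U : set Z1) (P : set Z3) :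
  open U -> open P -> open [set q : Z1 * (Z2 * Z3) | U q.1 /\ P q.2.2].
Proof.
move=> oU oP.
apply: (open_comp (f := fun q : Z1 * (Z2 * Z3) => (q.1, q.2.2)) (D := U `*` P)).
  by move=> q _; case: (@continuous_linear_drop R Z1 Z2 Z3) => /(_ q).
exact: open_prod.
Qed.

Section MaximalSolutions.
Context {R : realType} {E : completeNormedModType R} {F : tvsType R}.
Variables (J : set R) (U : set E) (P : set F).
Variables (f : R * (E * F) -> E) (G : R -> E * F -> E).
Hypotheses (nJ : nondegenerate_interval J) (oU : open U) (oP : open P).
Hypothesis Gf : forall t q, J t -> (U `*` P) q -> G t q = f (t, q).
Hypothesis sG : tangent_smooth 1 J (U `*` P) G.

(** Without an initial condition, so that solutions can be glued at any common
   time. *)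
Definition solution_on (I : set R) (p : F) (x : R -> E) :=
  forall t, I t -> U (x t) /\ has_deriv_within I x t (f (t, (x t, p))).

Let oW : open (U `*` P). Proof. exact: open_prod. Qed.

Let cG : continuous_on (J `*` (U `*` P)) (fun q => G q.1 q.2).
Proof. by case: sG. Qed.

Let segment_in (a b t : R) : a <= t <= b -> `[a, b]%classic t.
Proof. by rewrite /= in_itv. Qed.

Lemma segment_continuous (a b : R) : `[a, b] `<=` J ->
  continuous_on (`[a, b] `*` (U `*` P)) (fun q => G q.1 q.2).
Proof. by move=> abJ; apply: continuous_on_sub cG => -[t q] [/abJ]. Qed.

Lemma segment_lipschitz (a b : R) : `[a, b] `<=` J ->
  locally_lipschitz `[a, b] (U `*` P) G.
Proof.
move=> abJ t x p /abJ Jt Wxp.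
have [L LP] := tangent_smooth_lipschitz oW sG Jt Wxp; exists L.
by apply: filterS LP => q qL /abJ.
Qed.

(** A solution at inner times that is continuous on the closed interval has the
   one-sided derivatives at its end points. *)
Lemma solves_solution_on (a b : R) (p : F) (x : R -> E) :
  `[a, b] `<=` J -> solves a b (U `*` P) G p x -> solution_on `[a, b] p x.
Proof.
move=> abJ [cx Wx dx] t tI; have tI' : a <= t <= b by move: tI; rewrite /= in_itv.
have [Ut Pp] := Wx t tI'; split=> //; rewrite -Gf//; last exact: abJ.
apply: (has_deriv_within_segment (dx := fun s => G s (x s, p))) => //.
apply: (@continuous_on_comp _ _ _ `[a, b] (`[a, b] `*` (U `*` P))
  (fun s => (s, (x s, p))) (fun q => G q.1 q.2)); last first.
- by move=> s sI; split=> //; apply: Wx; move: sI; rewrite /= in_itv.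
- exact: segment_continuous.
- apply: continuous_on_pair; first by continuity.
  by apply: continuous_on_pair => //; continuity.
Qed.

Lemma solution_on_solves (I : set R) (a b : R) (p : F) (x : R -> E) : P p ->
  I `<=` J -> `[a, b] `<=` I -> solution_on I p x -> solves a b (U `*` P) G p x.
Proof.
move=> Pp IJ abI sx; split.
- apply: (continuous_on_sub abI) => t It; have [_ dx] := sx t It.
  exact: has_deriv_within_continuous dx.
- by move=> t /segment_in/abI/sx[].
- move=> t tI; have It : I° t by apply: interiorS abI _ _; apply/interior_segment.
  have [Ut dx] := sx t (interior_subset It).
  rewrite Gf//; last exact/IJ/(interior_subset It).
  exact: has_deriv_within_interior It dx.
Qed.

Lemma ivp_solutionP (t0 : R) (x0 : E) (p : F) (I : set R) (x : R -> E) :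
  ivp_solution J U f t0 x0 p I x <->
  [/\ nondegenerate_interval I, I `<=` J, I t0 /\ x t0 = x0 & solution_on I p x].
Proof.
by split=> -[nI IJ It0 sx]; split=> // t It; have [Ut dx] := sx t It; split=> //;
  apply/has_deriv_withinP.
Qed.

(** Any common time lies in a compact interval of common times that contains
   [tau], where uniqueness applies. *)
Lemma solutions_agree (I1 I2 : set R) (p : F) (x1 x2 : R -> E) (tau : R) : P p ->
  is_interval I1 -> is_interval I2 -> I1 `<=` J -> I2 `<=` J ->
  solution_on I1 p x1 -> solution_on I2 p x2 -> I1 tau -> I2 tau ->
  x1 tau = x2 tau -> forall t, I1 t -> I2 t -> x1 t = x2 t.
Proof.
move=> Pp i1 i2 I1J I2J s1 s2 tau1 tau2 x12.
have agree (a b : R) : a <= b -> I1 a -> I1 b -> I2 a -> I2 b -> a <= tau <= b ->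
    forall t, a <= t <= b -> x1 t = x2 t.
  move=> ab I1a I1b I2a I2b tauI.
  have ab1 : `[a, b]%classic `<=` I1 by move=> s; rewrite /= in_itv /=; exact: i1.
  have ab2 : `[a, b]%classic `<=` I2 by move=> s; rewrite /= in_itv /=; exact: i2.
  have abJ := subset_trans ab1 I1J.
  apply: (solution_unique oW (segment_continuous abJ) (segment_lipschitz abJ) _ _ tauI x12).
    exact: solution_on_solves ab1 s1.
  exact: solution_on_solves ab2 s2.
move=> t I1t I2t; have [tt|/ltW tt] := leP tau t.
  by apply: (agree tau t) => //; rewrite ?tt lexx.
by apply: (agree t tau) => //; rewrite ?tt lexx.
Qed.

(** The two solutions agree where both are defined and glue to a solution on the
   union of their intervals; by maximality this union is [I]. *)
Lemma maximal_solution_absorbs (t0 : R) (x0 : E) (p : F) (I I2 : set R)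
    (x x2 : R -> E) (tau : R) : P p ->
  maximal_ivp_solution J U f t0 x0 p I x ->
  nondegenerate_interval I2 -> I2 `<=` J -> solution_on I2 p x2 ->
  I tau -> I2 tau -> x2 tau = x tau ->
  I2 `<=` I /\ forall t, I2 t -> x t = x2 t.
Proof.
move=> Pp [/ivp_solutionP[[iI [c [d [Ic Id cd]]]] IJ [It0 xt0] sx] max_I].
move=> [iI2 _] I2J sx2 Itau I2tau x2tau.
have agree t : I t -> I2 t -> x t = x2 t.
  exact: (solutions_agree Pp iI iI2 IJ I2J sx sx2 Itau I2tau).
pose y t := if pselect (I t) then x t else x2 t.
have yx t : I t -> y t = x t by rewrite /y; case: pselect.
have yx2 t : I2 t -> y t = x2 t by rewrite /y; case: pselect => // It /(agree _ It).
have glue (I' : set R) (x' : R -> E) t : (forall s, I' s -> y s = x' s) -> I' t ->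
    solution_on I' p x' -> has_deriv_within I' y t (f (t, (y t, p))).
  move=> yx' I't sx'; rewrite yx'// => e e0; have [e' e'0 eP] := (sx' t I't).2 e e0.
  by exists e' => // u I'u ut; rewrite !yx'//; exact: eP.
suff IE : I `|` I2 = I.
  have I2I : I2 `<=` I by rewrite -IE; exact: subsetUr.
  by split=> // t I2t; apply: agree => //; exact: I2I.
apply: (max_I _ y).
- apply/ivp_solutionP; split.
  + split; first exact: (is_interval_union iI iI2 Itau I2tau).
    by exists c, d; split=> //; left.
  + by move=> t [/IJ|/I2J].
  + by split; [left|rewrite yx].
  + move=> t It; split.
      by case: It => It; [rewrite yx//; case: (sx t It)|rewrite yx2//; case: (sx2 t It)].
    by apply: (has_deriv_within_union iI iI2 Itau I2tau It) => It'; [exact: glue yx It' sx|exact: glue yx2 It' sx2].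
- exact: subsetUl.
- by move=> t; rewrite inE => /yx.
Qed.

(** The truncated equation around the constant curve [y1] has a solution through
   [y1], and it solves the original equation until it leaves the ball around [y1]. *)
Lemma local_solution (p : F) (t1 : R) (y1 : E) : P p -> J t1 -> U y1 ->
  exists a b x, [/\ a < b /\ a <= t1 <= b, `[a, b] `<=` J,
    exists2 e : R, 0 < e & forall u, J u -> `|u - t1| < e -> a <= u <= b,
    solution_on `[a, b] p x & x t1 = y1].
Proof.
move=> Pp Jt1 Uy1.
have [a0 [b0 [ab0 t1I0 abJ0 [e0 e00 eP0]]]] := compact_interval_neighborhood nJ Jt1 ltr01.
have abJ : `[a0, b0]%classic `<=` J by move=> t; rewrite /= in_itv => /abJ0[].
have cst_cont : continuous_on `[a0, b0] (fun=> y1) by continuity.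
have Wcst : forall t, a0 <= t <= b0 -> (U `*` P) (y1, p) by [].
have [rho rho0 /(_ rho)] := truncated_solution t1I0 oW (segment_continuous abJ)
  (segment_lipschitz abJ) cst_cont Wcst.
rewrite rho0 lexx => /(_ isT)/nbhs_singleton/(_ y1)[u [du [ut1 cu hu huf]]].
have t1I0' := segment_in t1I0.
have rho20 : 0 < rho / 2 by rewrite divr_gt0.
have /continuous_on_curve/(_ t1 t1I0' _ rho20)[d d0 dP] := cu.
have n0 : nondegenerate_interval `[a0, b0]%classic.
  split; first exact: interval_is_interval.
  by exists a0, b0; split=> //; rewrite /= in_itv /= lexx ltW.
have d20 : 0 < d / 2 by rewrite divr_gt0.
have [a [b [ab t1I abI [e e_gt0 eP]]]] := compact_interval_neighborhood n0 t1I0' d20.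
have ab_sub : `[a, b]%classic `<=` `[a0, b0]%classic.
  by move=> t; rewrite /= in_itv => /abI[].
exists a, b, u; split=> //.
- exact: subset_trans ab_sub abJ.
- exists (Num.min e0 e); first by rewrite lt_min e00.
  by move=> v Jv; rewrite lt_min => /andP[/(eP0 v Jv)/segment_in v0]; exact: eP.
- have cu' := continuous_on_sub ab_sub cu.
  have close t : a <= t <= b -> du t = G t (u t, p) /\ (U `*` P) (u t, p).
    move=> tI; have [t0I td] := abI t tI; rewrite /= in_itv /= in t0I.
    by apply: huf => //; rewrite -ut1 distrC (le_lt_trans (dP t _ _))//; lra.
  apply: solves_solution_on => //.
    exact: subset_trans ab_sub abJ.
  split=> //; first by move=> t /close[].
  move=> t /andP[at_ tb]; have tI : a <= t <= b by rewrite !ltW.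
  have [<- _] := close t tI; apply: hu.
  by have [] := abI t tI; rewrite /= in_itv.
Qed.

(** A solution can be continued beyond any of its times, so a maximal one is
   defined on a neighbourhood of each of them. *)
Lemma maximal_domain_neighborhood (t0 : R) (x0 : E) (p : F) (I : set R)
    (x : R -> E) (t1 : R) : P p -> maximal_ivp_solution J U f t0 x0 p I x -> I t1 ->
  exists a b : R, [/\ a <= t1 <= b, `[a, b] `<=` I &
    exists2 e : R, 0 < e & forall u, J u -> `|u - t1| < e -> a <= u <= b].
Proof.
move=> Pp mx It1; have [/ivp_solutionP[_ IJ _ sx] _] := mx.
have [a [b [x2 [[ab t1I] abJ nb sx2 x2t1]]]] := local_solution Pp (IJ _ It1) (sx _ It1).1.
exists a, b; split=> //; have nab : nondegenerate_interval `[a, b]%classic.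
  split; first exact: interval_is_interval.
  by exists a, b; split=> //; rewrite /= in_itv /= lexx ltW.
by have [] := maximal_solution_absorbs Pp mx nab abJ sx2 It1 (segment_in t1I) x2t1.
Qed.

Variables (t0 : R) (dom : E * F -> set R) (phi : E * F -> R -> E).
Hypothesis Jt0 : J t0.
Hypothesis max_phi : forall x0 p0, U x0 -> P p0 ->
  maximal_ivp_solution J U f t0 x0 p0 (dom (x0, p0)) (phi (x0, p0)).

(** The initial state is treated as a further parameter: the equation then has the
   parameter space [E * F], and the initial value is its first projection. *)
Lemma flow_box (x1 : E) (p1 : F) (t1 : R) : U x1 -> P p1 -> dom (x1, p1) t1 ->
  exists (a b : R) (N : set (E * F)), [/\ a <= t0 <= b /\ `[a, b] `<=` J,
    open N /\ N (x1, p1),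
    exists2 e : R, 0 < e & forall u, J u -> `|u - t1| < e -> a <= u <= b,
    (forall z, N z -> [/\ (U `*` P) z, `[a, b] `<=` dom z, phi z t0 = z.1 &
      solves a b (U `*` P) G z.2 (phi z)]) &
    continuous_on (`[a, b] `*` N) (fun q => phi q.2 q.1)].
Proof.
move=> Ux1 Pp1 dom1; have mx := max_phi Ux1 Pp1.
have [/ivp_solutionP[nI IJ [It0 xt0] sx] _] := mx.
have [a1 [b1 [t1I ab1I [e e0 eP]]]] := maximal_domain_neighborhood Pp1 mx dom1.
have [a2 [b2 [ab2 t0I2 ab2I _]]] := compact_interval_neighborhood nI It0 ltr01.
pose a := Num.min a1 a2; pose b := Num.max b1 b2.
have aa1 : a <= a1 by rewrite ge_min lexx.
have aa2 : a <= a2 by rewrite ge_min lexx orbT.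
have bb1 : b1 <= b by rewrite le_max lexx.
have bb2 : b2 <= b by rewrite le_max lexx orbT.
have abI : `[a, b]%classic `<=` dom (x1, p1).
  have da : dom (x1, p1) a.
    rewrite /a; case: leP => _; last by apply: (ab2I _ _).1; rewrite lexx ltW.
    by apply: ab1I; rewrite /= in_itv /= lexx; move: t1I => /andP[]; exact: le_trans.
  have db : dom (x1, p1) b.
    rewrite /b; case: leP => _; first by apply: (ab2I _ _).1; rewrite lexx ltW.
    by apply: ab1I; rewrite /= in_itv /= lexx andbT; move: t1I => /andP[]; exact: le_trans.
  by move=> t; rewrite /= in_itv /=; exact: nI.1.
have ab : a < b by rewrite (le_lt_trans aa2)// (lt_le_trans ab2).
have abJ := subset_trans abI IJ.
have t0I : a <= t0 <= b by move: t0I2 => /andP[? ?]; apply/andP; split; lra.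
pose W2 := [set q : E * (E * F) | U q.1 /\ P q.2.2].
pose G2 t (q : E * (E * F)) := G t (q.1, q.2.2).
have oW2 : open W2 by exact: open_drop.
have sG2 : tangent_smooth 1 `[a, b] W2 G2.
  apply: (tangent_smooth_pullback (k := id) _ abJ continuous_linear_drop _ sG) => //.
  by continuity.
have sphi : solves a b W2 G2 (x1, p1) (phi (x1, p1)) := solution_on_solves Pp1 IJ abI sx.
have cG2 : continuous_on (`[a, b] `*` W2) (fun q => G2 q.1 q.2) by case: sG2.
have cfst : {for (x1, p1), continuous (fst : E * F -> E)} by exact: cvg_fst.
have near_sol := solutions_exist_near t0I oW2 cG2 (tangent_smooth_lipschitz oW2 sG2)
  sphi xt0 cfst.
have near_UP : \forall z \near (x1, p1), (U `*` P) z by exact: open_nbhs_nbhs.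
pose N := [set z | (U `*` P) z /\ exists2 u, solves a b W2 G2 z u & u t0 = z.1]°.
have oN : open N by exact: open_interior.
have NP z : N z -> [/\ (U `*` P) z, `[a, b] `<=` dom z, phi z t0 = z.1 &
    solves a b (U `*` P) G z.2 (phi z)].
  case: z => x p /interior_subset[[/= Ux Pp] [u su ut0]].
  have mz := max_phi Ux Pp; have [/ivp_solutionP[nz zJ [zt0 phit0] sz] _] := mz.
  have nab : nondegenerate_interval `[a, b]%classic.
    split; first exact: interval_is_interval.
    by exists a, b; split=> //; rewrite /= in_itv /= lexx ltW.
  have su' : solution_on `[a, b] p u by exact: solves_solution_on.
  have [sub _] := maximal_solution_absorbs Pp mz nab abJ su' zt0 (segment_in t0I)
    (etrans ut0 (esym phit0)).
  by split=> //; exact: solution_on_solves sub sz.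
exists a, b, N; split=> //.
- by split=> //; exact: filterI.
- exists e => // u Ju /(eP u Ju)/andP[? ?]; apply/andP; split; lra.
- apply: (@flow_continuous _ _ _ a b t0 W2 G2 N fst (fun t z => phi z t)) => //.
  + exact: tangent_smooth_lipschitz.
  + by continuity.
  + by move=> z /NP[Wz _ phit0 sz].
Qed.

End MaximalSolutions.

(** * The flow map *)

Lemma is_interval_convex {R : realType} (I : set R) :
  is_interval I -> @convex_set R R^o I.
Proof.
move=> iI x y l; rewrite !inE => Ix Iy; have [xy|/ltW yx] := leP x y.
  by have := @convR_itv R x y l xy; rewrite in_itv; exact: (iI x y).
rewrite convC; move: (_%:i01) => m.
by have := @convR_itv R y x m yx; rewrite in_itv; exact: (iI y x).
Qed.

Lemma flow_smooth_le {R : realType} {H : normedModType R} (m r s : nat)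
    {Z : tvsType R} (I J : set R) (W : set Z) (g : R -> Z -> H) :
  I `<=` J -> (m <= r)%N -> flow_smooth r s J W g -> flow_smooth m s I W g.
Proof.
move=> IJ.
have time (T : topologicalType) (V : set T) (h : R -> T -> H) (n q : nat) :
    (n <= q)%N -> time_smooth q J V h -> time_smooth n I V h.
  elim: q n h => [|q IHq] [|n] h //= nq [ch sh].
  - by split=> //; apply: continuous_on_sub ch => -[t z] [/IJ].
  - by split=> //; apply: continuous_on_sub ch => -[t z] [/IJ].
  - split; first by apply: continuous_on_sub ch => -[t z] [/IJ].
    have [h' dh sh'] := sh; exists h'; last exact: IHq.
    by move=> t z It Vz; apply: dh => //; exact: interiorS IJ _ It.
elim: s Z W g => [|s IHs] Z W g mr; first by move=> [/(time _ _ _ _ _ mr)].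
move=> [/(time _ _ _ _ _ mr) sg [dg tg sdg]]; split=> //.
exists dg; last exact: IHs.
by move=> t z v /IJ; exact: tg.
Qed.

Theorem proposition5p9 (R : realType) (E : completeNormedModType R)
  (F : tvsType R) (hF : hausdorff_space F)
  (r s k : diff_order) (hs1 : diff_order_le (Some 1%N) s) (hk1 : diff_order_le (Some 1%N) k)
  (hrsk : diff_order_le (diff_order_add r s) k)
  (J : set R) (hJ : nondegenerate_interval J)
  (U : set E) (hU : open U) (P : set F) (hP : open P)
  (f : R * (E * F) -> E) (hf : Crs r k J (U `*` P) f)
  (t0 : R) (ht0 : J t0)
  (dom : E * F -> set R) (phi : E * F -> R -> E)
  (hphi : forall (x0 : E) (p0 : F), U x0 -> P p0 ->
    maximal_ivp_solution J U f t0 x0 p0 (dom (x0, p0)) (phi (x0, p0))) :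
  relatively_open (J `*` (U `*` P)) (flow_domain U P dom) /\
  Crs_on (diff_order_add r (Some 1%N)) s J (U `*` P)
    (flow_domain U P dom) (flow phi).
Proof.
have oW : open (U `*` P) by exact: open_prod.
have r0 : diff_order_le (Some 0%N) r by case: r {hrsk hf}.
have [G Gf [sG _]] := Crs_mixed_smooth hJ oW r0 hk1 hf.
have box := flow_box hJ hU hP Gf sG hphi.
have domJ z t : (U `*` P) z -> dom z t -> J t.
  by case: z => x p [/= Ux Pp]; have [[_ dJ _ _] _] := hphi x p Ux Pp; exact: dJ.
have domP t z : flow_domain U P dom (t, z) <-> (U `*` P) z /\ dom z t.
  by split=> [[q Wq [/= qt ->]]|[Wz zt]]; [split|exists z].
split.
  pose X := J `*` (U `*` P).
  exists [set z | X z -> flow_domain U P dom z]°; first exact: open_interior.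
  apply/seteqP; split=> [[t1 [x1 p1]]|z [Xz /interior_subset]]; last exact.
  move=> /domP[[/= Ux1 Pp1] dom1]; split.
    by split=> //; exact: domJ dom1.
  have [a [b [N [_ [oN N1] [e e0 eP] NP _]]]] := box x1 p1 t1 Ux1 Pp1 dom1.
  have near_t : \forall u \near t1, J u -> a <= u <= b.
    by apply/near_realP; exists e => // u ue Ju; exact: eP.
  exists ([set u | J u -> a <= u <= b], N).
    by split=> //; exact: open_nbhs_nbhs.
  move=> [u z] /= [uI /NP[Wz ab_dom _ _]] [/= /uI uab _].
  by apply/domP; split=> //; apply: ab_dom; rewrite /= in_itv.
move=> [t1 [x1 p1]] /domP[[/= Ux1 Pp1] dom1].
have [a [b [N [[t0I abJ] [oN N1] [e e0 eP] NP flow_cont]]]] := box x1 p1 t1 Ux1 Pp1 dom1.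
pose I := J `&` `]t1 - e, t1 + e[%classic.
have I_ab : I `<=` `[a, b].
  move=> u [Ju]; rewrite /= !in_itv /= => /andP[? ?]; apply: eP => //.
  by rewrite ltr_norml; apply/andP; split; lra.
have int_I : is_interval I.
  move=> p q [Jp]; rewrite /= in_itv /= => /andP[p1' p2'] [Jq].
  rewrite /= in_itv /= => /andP[q1' q2'] u /andP[pu uq]; split.
    by apply: (hJ.1 p q) => //; rewrite pu.
  by rewrite /= in_itv /=; apply/andP; split; lra.
exists I, N; split.
- split; first by exists `]t1 - e, t1 + e[%classic => //; exact: interval_open.
  exact: is_interval_convex.
- by split=> // z /NP[].
- split=> //; split; first exact: domJ dom1.
  by rewrite /= in_itv /=; apply/andP; split; lra.
- move=> [u z] [/= Iu /NP[Wz ab_dom _ _]]; apply/domP; split=> //.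
  by apply: ab_dom; exact: I_ab.
apply: (@flow_smooth_Crs R E _ _ _ I N (fun t z => phi z t) oN) => i j ir js.
pose W2 := [set q : E * (E * F) | U q.1 /\ P q.2.2].
have oW2 : open W2 by exact: open_drop.
have i1r : diff_order_le (Some i.-1) r.
  by case: (r) ir => //= n; rewrite addn1; case: i.
(* A time order [i] of the flow takes [i.-1] time derivatives of [f], and each
   derivative in time or space may cost one space derivative of [f]. *)
have ijk : diff_order_le (Some (i.-1 + j)%N) k.
  case: (k) hrsk => // k'; case: (r) i1r => // r'; case: (s) js => // s' /= js' ir' rsk.
  exact: leq_trans (leq_add ir' js') rsk.
have [G' Gf' sG'] := Crs_mixed_smooth hJ oW i1r ijk hf.
apply: (flow_smooth_le I_ab (leqSpred i)).
apply: (@flow_smooth_of_continuous _ a b t0 t0I E (E * F)%type i.-1 j (i.-1 + j) W2 N fst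
  (fun t q => G' t (q.1, q.2.2))) => //.
- by split=> // x; exact: cvg_fst.
- by apply: (mixed_smooth_pullback abJ continuous_linear_drop _ sG').
- move=> z /NP[Wz ab_dom _ [cz Wcz dz]]; split=> //.
  move=> t tI; have tI' : a <= t <= b by move: tI => /andP[? ?]; rewrite !ltW.
  have Jt : J t by apply: abJ; rewrite /= in_itv.
  by have := dz t tI; rewrite Gf ?Gf'//; exact: Wcz.
- by move=> z /NP[].
Qed.
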